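(* Let $1\le k\le n$. For every $(k,n)$-partial noncrossing pairing $(\tau,T)\in\mathcal{A}_{k,n}$ we have $$\Delta_{(\tau,T)} = H(\theta(\tau,T))$$ in $R(k,n)_2=V(2\omega_k)^*$. Thus the Temperley–Lieb immanants $\{\Delta_{(\tau,T)}\mid(\tau,T)\in\mathcal{A}_{k,n}\}$ are exactly the dual canonical basis $\{H(S)\mid S\in B(2\omega_k)\}$.
   Context: $R(k,n)=\mathbb{C}[\Delta_I]/(\text{Plücker relations})$, $I\in\binom{[n]}{k}$ (the $k$-subsets of $[n]=\{1,\dots,n\}$), is the homogeneous coordinate ring of $\mathrm{Gr}(k,n)$, i.e. the coordinate ring of the affine cone $\widehat{\mathrm{Gr}}(k,n)\subset\Lambda^k\mathbb{C}^n$ of decomposable vectors; $R(k,n)_2$ is its degree $2$ part. A $(k,n)$-partial noncrossing pairing $(\tau,T)$ consists of a noncrossing perfect matching $\tau$ of a subset $S\subset[n]$ (points $1,\dots,n$ placed in order on a circle) together with a subset $T\subset[n]\setminus S$, satisfying $2|T|+|S|=2k$. The set of these is $\mathcal{A}_{k,n}$. A pair $(I,J)\in\binom{[n]}{k}^2$ is compatible with $(\tau,T)$ if (a) $I\cap J=T$ and (b) each pair of matched vertices in $\tau$ contains one element of $I$ and one element of $J$. $\mathcal{C}(I,J)$ is the set of $(k,n)$-partial noncrossing pairings compatible with $(I,J)$. The Temperley–Lieb immanants (invariants) $\Delta_{(\tau,T)}\in R(k,n)_2$ are the elements uniquely determined by the (known) identities $$\Delta_I\Delta_J=\sum_{(\tau,T)\in\mathcal{C}(I,J)}\Delta_{(\tau,T)}\qquad\text{for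 all } I,J\in\tbinom{[n]}{k};$$ they form a basis of $R(k,n)_2$. Let $\omega_k=(1^k)$. $B(2\omega_k)$ is the set of semistandard Young tableaux with $k$ rows, $2$ columns and entries in $[n]$. The bijection $\theta:\mathcal{A}_{k,n}\to B(2\omega_k)$ sends $(\tau,T)$ to the tableau with columns $I_1,I_2$ (left, right) where $I_1\cap I_2=T$ and for each strand $(a,b)\in\tau$ with $a<b$ we have $a\in I_1$, $b\in I_2$ (and there are no other entries). $V(2\omega_k)$ is the irreducible $GL(n)$-representation of highest weight $2\omega_k$, realized in $(\Lambda^k\mathbb{C}^n)^{\otimes2}$ as the subrepresentation generated by $v_+=(e_1\wedge\cdots\wedge e_k)^{\otimes2}$. By Borel–Weil $V(2\omega_k)^*=R(k,n)_2$, with $\varphi$ corresponding to the function $X\mapsto\varphi(X\otimes X)$ on $\widehat{\mathrm{Gr}}(k,n)$. $\{G(S)\mid S\in B(2\omega_k)\}$ is the canonical basis (Lusztig; Kashiwara's global basis) of the $U_q(\mathfrak{sl}_n)$-module $V_q(2\omega_k)$ with respect to $v_+$, specialized at $q=1$, labelled by tableaux via the crystal structure on $B(2\omega_k)$: read the rows of a tableau left to right starting from the bottom row, regard each $i$ as '')'' and each $i+1$ as ''('' and pair as usual; $\tilde f_i$ changes the $i$ of the rightmost unpaired '')'' to $i+1$, and $\tilde e_i$ changes the $i+1$ of the leftmost unpaired ''('' to $i$ (result $0$ if none). $\{H(S)\}$ is the dual basis of $V(2\omega_k)^*$, the dual canonical basis. *)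

(* Defs.v *)
From HB Require Import structures.
From mathcomp Require Import all_boot all_order all_algebra.
From mathcomp Require Import fraction.

Set Implicit Arguments.
Unset Strict Implicit.
Unset Printing Implicit Defensive.

Import Order.TTheory GRing.Theory Num.Theory.
Local Open Scope ring_scope.

(* Conventions: [n] = {1..n} is modelled by 'I_n = {0..n-1} and the simple
   roots of sl_n by 'I_n.-1; the root i involves the letters i and i+1 of 'I_n,
   called [low i] and [high i]. *)

Definition low n (i : 'I_n.-1) : 'I_n := widen_ord (leq_pred n) i.

Definition high n (i : 'I_n.-1) : 'I_n :=
  Ordinal (etrans (esym (ltn_predRL i n)) (ltn_ord i)).

Definition ksub (k n : nat) := {I : {set 'I_n} | #|I| == k}.

(** * Partial noncrossing pairings *)

(* (tau, T), where tau is given by its set of two-element blocks; the matched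
   set S is then [cover tau]. *)
Definition pairing n := ({set {set 'I_n}} * {set 'I_n})%type.

Definition noncrossing n (tau : {set {set 'I_n}}) : bool :=
  [forall a : 'I_n, forall b : 'I_n, forall c : 'I_n, forall d : 'I_n,
     [&& (a < b)%N, (b < c)%N & (c < d)%N] ==>
     ~~ (([set a; c] \in tau) && ([set b; d] \in tau))].

Definition pairings k n : {set pairing n} :=
  [set P : pairing n |
    [&& trivIset P.1, [forall B in P.1, #|B| == 2], noncrossing P.1,
        [disjoint P.2 & cover P.1] & (2 * #|P.2| + #|cover P.1| == 2 * k)%N]].

Definition compatible k n (I J : ksub k n) (P : pairing n) : bool :=
  (val I :&: val J == P.2) &&
  [forall B in P.1, (#|B :&: val I| == 1%N) && (#|B :&: val J| == 1%N)].

(** * Tableaux with k rows and 2 columns, and their crystal structure *)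

Definition tableau k n := 'M['I_n]_(k, 2).

Definition ssyt k n (t : tableau k n) : bool :=
  [forall r : 'I_k, forall c : 'I_2, forall d : 'I_2,
     (c <= d)%N ==> (t r c <= t r d)%N] &&
  [forall c : 'I_2, forall r : 'I_k, forall s : 'I_k,
     (r < s)%N ==> (t r c < t s c)%N].

Definition reading_cells k : seq ('I_k * 'I_2) :=
  [seq (rev_ord r, c) | r <- enum 'I_k, c <- enum 'I_2].

(* One step of the bracketing scan; the state holds the number of currently
   open "(" and the last unpaired ")" met so far. *)
Definition bracket_step k n (i : 'I_n.-1) (t : tableau k n)
    (st : nat * option ('I_k * 'I_2)) (c : 'I_k * 'I_2) :=
  if t c.1 c.2 == high i then (st.1.+1, st.2)
  else if t c.1 c.2 == low i then
    if st.1 is d.+1 then (d, st.2) else (0%N, Some c)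
  else st.

Definition ftab k n (i : 'I_n.-1) (t : tableau k n) : option (tableau k n) :=
  if (foldl (bracket_step i t) (0%N, None) (reading_cells k)).2 is Some c
  then Some (\matrix_(r, d) if (r, d) == c then high i else t r d)
  else None.

(* Row r of the highest weight tableau is filled with the r-th letter. *)
Definition top_tableau k n (hkn : (k <= n)%N) : tableau k n :=
  \matrix_(r, c) widen_ord hkn r.

(* ftab_i1 (ftab_i2 (... top)) for the word i1, i2, ... *)
Definition ftab_word k n (hkn : (k <= n)%N) (w : seq 'I_n.-1) :=
  foldr (fun i => obind (@ftab k n i)) (Some (top_tableau hkn)) w.

Definition left_column n (P : pairing n) : {set 'I_n} :=
  P.2 :|: [set a : 'I_n | [exists b : 'I_n, (a < b)%N && ([set a; b] \in P.1)]].

Definition right_column n (P : pairing n) : {set 'I_n} :=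
  P.2 :|: [set b : 'I_n | [exists a : 'I_n, (a < b)%N && ([set a; b] \in P.1)]].

(* [enum] lists a subset of 'I_n increasingly; both columns have k elements
   when P is in [pairings k n], so the default value of [nth] is not used. *)
Definition theta k n (hkn : (k <= n)%N) (P : pairing n) : tableau k n :=
  \matrix_(r, c) nth (widen_ord hkn r)
    (enum (if c == ord0 then left_column P else right_column P)) r.

(** * U_q(sl_n)-modules over Q(q) *)

Definition Qq := {fraction {poly rat}}.

Definition qq : Qq := FracField.tofrac ('X : {poly rat}).

Definition cartan n (i j : 'I_n.-1) : int :=
  if i == j then 2
  else if (i.+1 == j :> nat) || (j.+1 == i :> nat) then -1 else 0.

Record Uq_module n (V : vectType Qq) := UqModule {
  opE : 'I_n.-1 -> 'End(V);
  opF : 'I_n.-1 -> 'End(V);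
  opK : 'I_n.-1 -> 'End(V);
  opKV : 'I_n.-1 -> 'End(V);
  opKK : forall i x, opKV i (opK i x) = x;
  opKKV : forall i x, opK i (opKV i x) = x;
  opK_comm : forall i j x, opK i (opK j x) = opK j (opK i x);
  opKE : forall i j x,
    opK i (opE j (opKV i x)) = qq ^ cartan i j *: opE j x;
  opKF : forall i j x,
    opK i (opF j (opKV i x)) = qq ^ (- cartan i j) *: opF j x;
  opEF : forall i j x, opE i (opF j x) - opF j (opE i x) =
    if i == j then (qq - qq^-1)^-1 *: (opK i x - opKV i x) else 0;
  opE_comm : forall i j x, cartan i j = 0 -> opE i (opE j x) = opE j (opE i x);
  opF_comm : forall i j x, cartan i j = 0 -> opF i (opF j x) = opF j (opF i x);
  opE_serre : forall i j x, cartan i j = -1 ->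
    opE i (opE i (opE j x)) - (qq + qq^-1) *: opE i (opE j (opE i x))
      + opE j (opE i (opE i x)) = 0;
  opF_serre : forall i j x, cartan i j = -1 ->
    opF i (opF i (opF j x)) - (qq + qq^-1) *: opF i (opF j (opF i x))
      + opF j (opF i (opF i x)) = 0
}.

Definition Uq_irreducible n (V : vectType Qq) (M : Uq_module n V) : Prop :=
  fullv != 0%VS :> {vspace V} /\
  forall U : {vspace V},
    (forall i, [/\ (opE M i @: U <= U)%VS, (opF M i @: U <= U)%VS,
                   (opK M i @: U <= U)%VS & (opKV M i @: U <= U)%VS]) ->
    U = 0%VS \/ U = fullv.

(* <h_i, 2 omega_k> = 2 if i is the k-th simple root, and 0 otherwise. *)
Definition highest_weight_vector k n (V : vectType Qq) (M : Uq_module n V)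
    (v : V) : Prop :=
  [/\ v != 0, forall i, opE M i v = 0 &
      forall i, opK M i v = qq ^+ (if i.+1 == k then 2 else 0)%N *: v].

(** * The global basis *)

Definition qint (a : nat) : Qq := (qq ^+ a - qq ^- a) / (qq - qq^-1).

Definition qfact (a : nat) : Qq := \prod_(1 <= j < a.+1) qint j.

Definition divF n (V : vectType Qq) (M : Uq_module n V) (i : 'I_n.-1) (a : nat)
    (x : V) : V :=
  (qfact a)^-1 *: iter a (opF M i) x.

(* Kashiwara's operator, as a functional relation: if x is the sum of the
   F_i^(j) u_j with E_i u_j = 0, then its image is that of the
   F_i^(j+1) u_j. *)
Definition kashiwara_f n (V : vectType Qq) (M : Uq_module n V) (i : 'I_n.-1)
    (x y : V) : Prop :=
  exists (d : nat) (u : 'I_d -> V),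
    [/\ forall j, opE M i (u j) = 0,
        x = \sum_(j < d) divF M i j (u j) &
        y = \sum_(j < d) divF M i j.+1 (u j)].

Fixpoint kashiwara_word n (V : vectType Qq) (M : Uq_module n V) (v : V)
    (w : seq 'I_n.-1) (y : V) : Prop :=
  if w is i :: w' then
    exists2 x, kashiwara_word M v w' x & kashiwara_f M i x y
  else y = v.

Definition regular_at0 (f : Qq) : Prop :=
  exists a b : {poly rat},
    b.[0] != 0 /\ f = FracField.tofrac a / FracField.tofrac b.

Definition crystal_lattice n (V : vectType Qq) (M : Uq_module n V) (v : V)
    (x : V) : Prop :=
  exists (m : nat) (a : 'I_m -> Qq) (y : 'I_m -> V),
    [/\ forall j, regular_at0 (a j),
        forall j, exists w, kashiwara_word M v w (y j) &
        x = \sum_(j < m) a j *: y j].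

Definition eq_mod_qL n (V : vectType Qq) (M : Uq_module n V) (v : V)
    (x y : V) : Prop :=
  exists2 z, crystal_lattice M v z & x - y = qq *: z.

(* Additivity and the second clause make [psi] semilinear with respect to the
   automorphism q |-> q^-1 of Q(q). *)
Definition bar_involution n (V : vectType Qq) (M : Uq_module n V) (v : V)
    (psi : V -> V) : Prop :=
  [/\ {morph psi : x y / x + y}, forall x, psi (qq *: x) = qq^-1 *: psi x,
      psi v = v &
      forall i x, [/\ psi (opE M i x) = opE M i (psi x),
                      psi (opF M i x) = opF M i (psi x) &
                      psi (opK M i x) = opKV M i (psi x)]].

(* Formal Z[q, q^-1]-linear combinations of products of divided powers:
   an entry (p, m, [(i1, a1); (i2, a2); ...]) stands for
   p(q) q^-m F_i1^(a1) F_i2^(a2) .... *)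
Definition integral_form n := seq ({poly int} * nat * seq ('I_n.-1 * nat)).

Definition eval_q n (V : vectType Qq) (M : Uq_module n V) (v : V)
    (s : integral_form n) : V :=
  \sum_(t <- s)
    (FracField.tofrac (map_poly intr t.1.1 : {poly rat}) / qq ^+ t.1.2) *:
    foldr (fun ia => divF M ia.1 ia.2) v t.2.

(* The lower global basis {G(S)}. Its label is transported along the crystal
   isomorphism, i.e. by applying the same Kashiwara operators to v and to the
   highest weight tableau. *)
Definition global_basis k n (hkn : (k <= n)%N) (V : vectType Qq)
    (M : Uq_module n V) (v : V) (G : tableau k n -> V) : Prop :=
  forall S, ssyt S ->
    [/\ exists s, G S = eval_q M v s,
        crystal_lattice M v (G S),
        exists2 psi, bar_involution M v psi & psi (G S) = G S &
        forall w, ftab_word hkn w = Some S ->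
          exists2 b, kashiwara_word M v w b & eq_mod_qL M v (G S) b].

(** * The Grassmannian cone and V(2 omega_k), in Pluecker coordinates *)

Section Classical.
Variable C : fieldType.

(* Coordinates on the k-th exterior power of C^n and on its tensor square, in
   the bases (e_I) and (e_I tensor e_J). *)
Definition Ext k n := {ffun ksub k n -> C^o}.
Definition Ext2 k n := {ffun ksub k n * ksub k n -> C^o}.

(* The r-th smallest element of I. *)
Definition ksub_nth k n (I : ksub k n) (r : 'I_k) : 'I_n :=
  enum_val (cast_ord (esym (eqP (valP I))) r).

(* The wedge product of the rows of A. *)
Definition wedge_rows k n (A : 'M[C]_(k, n)) : Ext k n :=
  [ffun I => \det (colsub (ksub_nth I) A)].

Definition decomposable k n (X : Ext k n) : Prop :=
  exists A : 'M[C]_(k, n), X = wedge_rows A.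

Definition tensor_square k n (X : Ext k n) : Ext2 k n :=
  [ffun p => X p.1 * X p.2].

(* Elements of R(k,n)_2, the degree 2 part of the coordinate ring of the cone
   of decomposable vectors. Elements of this ring are represented by functions
   on Ext k n, of which only the values on decomposable vectors matter. *)
Definition inR2 k n (f : Ext k n -> C) : Prop :=
  exists c : ksub k n * ksub k n -> C, forall X, decomposable X ->
    f X = \sum_p c p * (X p.1 * X p.2).

Definition eqR (k n : nat) (f g : Ext k n -> C) : Prop :=
  forall X, decomposable X -> f X = g X.

Definition TL_immanants k n (Delta : pairing n -> Ext k n -> C) : Prop :=
  (forall P, P \in pairings k n -> inR2 (Delta P)) /\
  forall I J : ksub k n,
    eqR (fun X => X I * X J)
        (fun X => \sum_(P in pairings k n | compatible I J P) Delta P X).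

Definition GL_act k n (g : 'M[C]_n) (x : Ext2 k n) : Ext2 k n :=
  [ffun p => \sum_(r : ksub k n * ksub k n)
     \det (mxsub (ksub_nth p.1) (ksub_nth r.1) g) *
     \det (mxsub (ksub_nth p.2) (ksub_nth r.2) g) * x r].

Definition vplus k n : Ext2 k n :=
  [ffun p => ((val p.1 == [set i : 'I_n | (i < k)%N]) &&
              (val p.2 == [set i : 'I_n | (i < k)%N]))%:R].

(* V(2 omega_k), the GL(n)-subrepresentation generated by vplus. *)
Definition inV2 k n (x : Ext2 k n) : Prop :=
  exists (m : nat) (c : 'I_m -> C) (g : 'I_m -> 'M[C]_n),
    (forall j, g j \in unitmx) /\
    x = \sum_(j < m) c j *: GL_act (g j) (vplus k n).

(* Elements of the dual of V(2 omega_k); only the values on V(2 omega_k)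
   matter. *)
Definition inV2_dual k n (phi : Ext2 k n -> C) : Prop :=
  forall (a : C) (x y : Ext2 k n), inV2 x -> inV2 y ->
    phi (a *: x + y) = a * phi x + phi y.

(* Whether f_i = E_(i+1,i) in gl_n sends e_I to e_J (otherwise the coefficient
   of e_J in f_i e_I is zero). *)
Definition lowers k n (i : 'I_n.-1) (I J : ksub k n) : bool :=
  [&& low i \in val I, high i \notin val I &
      val J == high i |: (val I :\ low i)].

Definition f1 k n (i : 'I_n.-1) (x : Ext2 k n) : Ext2 k n :=
  [ffun p => \sum_(I | lowers i I p.1) x (I, p.2)
           + \sum_(J | lowers i J p.2) x (p.1, J)].

Definition divf1 k n (i : 'I_n.-1) (a : nat) (x : Ext2 k n) : Ext2 k n :=
  (a`!%:R)^-1 *: iter a (f1 i) x.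

(* The value of an integral form at q = 1, v being specialized to vplus. *)
Definition eval_1 k n (s : integral_form n) : Ext2 k n :=
  \sum_(t <- s) ((t.1.1).[1])%:~R *:
    foldr (fun ia => divf1 ia.1 ia.2) (vplus k n) t.2.

Definition specializes k n (V : vectType Qq) (M : Uq_module n V) (v : V)
    (x : V) (y : Ext2 k n) : Prop :=
  exists2 s, x = eval_q M v s & y = eval_1 k s.

Definition dual_basis k n (g : tableau k n -> Ext2 k n)
    (H : tableau k n -> Ext2 k n -> C) : Prop :=
  forall S, ssyt S ->
    inV2_dual (H S) /\ forall S', ssyt S' -> H S (g S') = (S == S')%:R.

End Classical.

(* Main.v *)
From HB Require Import structures.
Require Import Defs.
From mathcomp Require Import all_boot all_order all_fingroup all_algebra.
From mathcomp Require Import fraction zify ring.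
From mathcomp Require Import reals complex.
From Stdlib Require Import Classical.
Set Implicit Arguments.
Unset Strict Implicit.
Unset Printing Implicit Defensive.
Import Order.TTheory GRing.Theory Num.Theory.
Import FracField.
Local Open Scope ring_scope.

(* Idea. V_q(2 omega_k) embeds in the tensor square of the q-exterior power,
   by v |-> e_[k] (x) e_[k]; the standard dot product there is contravariant
   and, Q(q) being formally real, anisotropic, which makes the embedding well
   defined. To a partial noncrossing pairing (tau, T) attach the vector
   b = sum of q^(number of strands whose left end is in J) e_I (x) e_J over the
   pairs (I, J) compatible with (tau, T). Every divided power of an F_i sends b
   to 0 or to a bar-invariant multiple of such a vector, so the elements of the
   integral form are Laurent polynomial combinations of the b's; moreover b is
   e_I (x) e_J modulo q, where I, J are the columns of theta(tau, T). Since the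
   b's are linearly independent modulo q, a bar-invariant element of the
   integral form congruent to e_I (x) e_J equals b: the global basis is the
   family of the b's. At q = 1 the identities defining the Temperley-Lieb
   immanants say precisely that X (x) X is the sum of the Delta(tau, T)(X) b,
   i.e. that the immanants are the dual basis. *)

(** * Exchanging the letters of a simple root *)

(** The obstacle is that V is any irreducible module with a highest weight vector of the right
    weight, and that the integral form representing G(S) is arbitrary. The map to the tensor square
    is therefore built as a relation [gen]. Its delicate point is that an image of 0 is orthogonal
    to the top vector; this comes from grading V by the product of the K_i^(i (n - i)), which has
    different eigenvalues on words of different lengths. No bar involution is put on the tensor
    square. The divided powers act on the b's through scalars in q + q^-1 only, so on an integral
    form the bar involution merely replaces q by q^-1 in the scalar coefficients. The coefficients
    on the b's are thus Laurent polynomials over the integers, independent of the field and of the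
    parameter: once forced over Q(q), they are known at q = 1 as well. Labels are matched by
    following one crystal path to each tableau, along which the columns, the residue modulo q and a
    noncrossing matching move together. This also yields the surjectivity of theta. *)

Section Swap.
Variable n : nat.
Implicit Types (i j : 'I_n.-1) (I J : {set 'I_n}).

Definition sw i I : {set 'I_n} := [set x | tperm (low i) (high i) x \in I].
(* e_I is the upper (isu), resp. lower (isd), vector of a two-dimensional
   string of the i-th sl_2; otherwise it is invariant. *)
Definition isu i I := (low i \in I) && (high i \notin I).
Definition isd i I := (low i \notin I) && (high i \in I).

Lemma low_neq_high i : (low i == high i) = false.
Proof. by apply/eqP => /(congr1 val) /=; lia. Qed.

Lemma high_neq_low i : (high i == low i) = false.
Proof. by rewrite eq_sym low_neq_high. Qed.

Lemma low_inj : injective (@low n).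
Proof. by move=> i j /(congr1 val) /= /val_inj. Qed.

Lemma high_inj : injective (@high n).
Proof. by move=> i j /(congr1 val) /= [] /val_inj. Qed.

Lemma low_in_sw i I : (low i \in sw i I) = (high i \in I).
Proof. by rewrite inE tpermL. Qed.

Lemma high_in_sw i I : (high i \in sw i I) = (low i \in I).
Proof. by rewrite inE tpermR. Qed.

Lemma other_in_sw i x I : x != low i -> x != high i -> (x \in sw i I) = (x \in I).
Proof. by move=> xl xh; rewrite inE tpermD // eq_sym. Qed.

Lemma sw_sw i : involutive (sw i).
Proof. by move=> I; apply/setP => x; rewrite !inE tpermK. Qed.

Lemma isu_sw i I : isu i (sw i I) = isd i I.
Proof. by rewrite /isu /isd low_in_sw high_in_sw andbC. Qed.

Lemma isd_sw i I : isd i (sw i I) = isu i I.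
Proof. by rewrite /isu /isd low_in_sw high_in_sw andbC. Qed.

Lemma isd_isu i I : isd i I -> isu i I = false.
Proof. by rewrite /isu /isd => /andP[/negPf ->]. Qed.

Lemma isu_isd i I : isu i I -> isd i I = false.
Proof. by rewrite /isu /isd => /andP[->]. Qed.

Lemma ltn_low_high i x : x != low i -> x != high i ->
  [/\ (x < high i)%N = ~~ (high i < x)%N, (low i < x)%N = (high i < x)%N &
      (x < low i)%N = ~~ (high i < x)%N].
Proof. by rewrite -!val_eqE /= => xl xh; split; lia. Qed.

Lemma tperm_low_high i (x : 'I_n) : let s := tperm (low i) (high i) in
  [/\ (x == low i :> nat) ==> (s x == (low i).+1 :> nat),
      (x == (low i).+1 :> nat) ==> (s x == low i :> nat) &
      (x != low i :> nat) && (x != (low i).+1 :> nat) ==> (s x == x :> nat)].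
Proof. by move=> s; rewrite /s; case: tpermP => [->|->|/eqP + /eqP]; rewrite -?val_eqE /=; split;
  lia. Qed.

(** The transposition of two adjacent letters inverts no pair but these two letters themselves, so
    it is increasing off either of them. *)
Lemma tperm_ltn i (z p q : 'I_n) : z = low i \/ z = high i -> p != z -> q != z ->
  (p < q)%N -> (tperm (low i) (high i) p < tperm (low i) (high i) q)%N.
Proof.
move=> zab pz qz pq; have [x1 x2 x3] := tperm_low_high i p; have [y1 y2 y3] := tperm_low_high i q.
have {}pz : p != z :> nat by []. have {}qz : q != z :> nat by [].
have zi : (z == low i :> nat) || (z == (low i).+1 :> nat).
  by case: zab => ->; rewrite eqxx ?orbT.
lia.
Qed.

Lemma sw_in i I : low i \in I -> high i \in I -> sw i I = I.
Proof.
move=> lI hI; apply/setP => x; rewrite inE.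
by case: tpermP => [->|->|]; rewrite ?lI ?hI.
Qed.

Lemma local_typeP i I :
  [\/ isu i I = true /\ isd i I = false, isu i I = false /\ isd i I = true
    | isu i I = false /\ isd i I = false].
Proof.
rewrite /isu /isd; case: (low i \in I); case: (high i \in I) => /=;
  by [constructor 1 | constructor 2 | constructor 3].
Qed.

Lemma card_sw i I : #|sw i I| = #|I|.
Proof.
have -> : sw i I = [set tperm (low i) (high i) x | x in I].
  apply/setP => x; rewrite inE; apply/idP/imsetP => [xI|[y yI ->]].
    by exists (tperm (low i) (high i) x); rewrite ?tpermK.
  by rewrite tpermK.
by rewrite card_imset //; apply: perm_inj.
Qed.

Lemma sw_notin i I : low i \notin I -> high i \notin I -> sw i I = I.
Proof.
move=> /negPf lI /negPf hI; apply/setP => x; rewrite inE.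
by case: tpermP => [->|->|]; rewrite ?lI ?hI.
Qed.

Lemma roots_cases i j : i != j ->
  [\/ high i = low j, high j = low i |
    [/\ low i != low j, low i != high j, high i != low j & high i != high j]].
Proof.
move=> ij.
have [e|n1] := eqVneq (high i) (low j); first by constructor 1.
have [e|n2] := eqVneq (high j) (low i); first by constructor 2.
by constructor 3; split=> //; rewrite ?(inj_eq (@high_inj _)) ?(inj_eq (@low_inj _)) // eq_sym.
Qed.

Lemma high_low_neq i j : high i = low j -> (low i == high j) = false.
Proof. by move=> /(congr1 val) /= e; apply/eqP => /(congr1 val) /=; lia. Qed.

(** With [sw_comm], this says that E_i and F_j commute on one exterior factor: the two composites
    are nonzero on the same e_I and lead to the same subset. For adjacent roots both composites
    vanish. *)
Lemma isu_isd_comm i j I : i != j ->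
  isu i I && isd j (sw i I) = isd j I && isu i (sw j I).
Proof.
move=> ij; case: (roots_cases ij) => [e|e|[n1 n2 n3 n4]].
- rewrite /isu /isd -!e high_in_sw.
  have -> : (high i \in sw j I) = (high j \in I) by rewrite e low_in_sw.
  by case: (low i \in I); case: (high i \in I); case: (high j \in I); rewrite /= ?andbF.
- rewrite /isu /isd e low_in_sw.
  have -> : (low i \in sw j I) = (low j \in I) by rewrite -e high_in_sw.
  by case: (low i \in I); case: (high i \in I); case: (low j \in I); rewrite /= ?andbF.
by rewrite /isu /isd !other_in_sw // 1?eq_sym // andbC.
Qed.

Lemma sw_comm i j I : i != j -> isu i I -> isd j (sw i I) ->
  sw j (sw i I) = sw i (sw j I).
Proof.
move=> ij; case: (roots_cases ij) => [e|e|[n1 n2 n3 n4]].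
- by rewrite /isu /isd -!e high_in_sw => /andP[->].
- by rewrite /isu /isd e low_in_sw => /andP[_ /negPf ->]; rewrite andbF.
move=> _ _; apply/setP => x; rewrite !inE; congr (_ \in I).
case: (tpermP (low j) (high j) x) => [->|->|/eqP xj /eqP xj'].
- by rewrite !(tpermD (x := low i) (y := high i)) // tpermL.
- by rewrite !(tpermD (x := low i) (y := high i)) // tpermR.
by case: (tpermP (low i) (high i) x) => [_|_|/eqP xi /eqP xi'];
  rewrite tpermD // eq_sym.
Qed.

End Swap.

(** * Weights of the vectors e_I *)

Section Kap.
Variables (n : nat) (F : fieldType) (u : F).
Hypothesis u0 : u != 0.
Implicit Types (i j : 'I_n.-1) (I J : {set 'I_n}).

(** The eigenvalue of K_i on e_I. *)
Definition kap i I : F := if isu i I then u else if isd i I then u^-1 else 1.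

Lemma kap_neq0 i I : kap i I != 0.
Proof. by rewrite /kap; case: ifP => // _; case: ifP => // _; rewrite ?invr_neq0 ?oner_eq0. Qed.

Lemma kap_sw i I : kap i (sw i I) = (kap i I)^-1.
Proof.
rewrite /kap isu_sw isd_sw; case: ifP => [/isd_isu ->|_]; first by rewrite invrK.
by case: ifP; rewrite ?invr1.
Qed.

(** Here e_(sw j I) is E_j e_I, whose weight is that of e_I plus the j-th simple root. *)
Lemma kap_swd i j I : isd j I -> kap i (sw j I) = u ^ cartan i j * kap i I.
Proof.
rewrite /cartan; have [->|ij] := eqVneq i j.
  by move=> dI; rewrite kap_sw /kap dI (isd_isu dI) invrK -exprnP; field.
case: (roots_cases ij) => [e|e|[n1 n2 n3 n4]].
- have -> : (i.+1 == j :> nat) = true by apply/eqP; move/(congr1 val): e.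
  rewrite /isd -e => /andP[hI jI].
  have li : (low i \in sw j I) = (low i \in I).
    by rewrite other_in_sw // ?high_low_neq // -e low_neq_high.
  rewrite /kap /isu /isd li e low_in_sw jI -e (negPf hI) andbF /= !andbT andbF.
  by case: (low i \in I) => //=; rewrite ?mulVf ?mulr1.
- have -> : (i.+1 == j :> nat) || (j.+1 == i :> nat) = true.
    by apply/orP; right; apply/eqP; move/(congr1 val): e.
  rewrite /isd e => /andP[hI jI].
  have li : (high i \in sw j I) = (high i \in I).
    by rewrite other_in_sw // 1?eq_sym ?high_low_neq // e low_neq_high.
  rewrite /kap /isu /isd li -e high_in_sw (negPf hI) e jI /=.
  by case: (high i \in I) => //=; rewrite ?mulVf ?mulr1.
have -> : (i.+1 == j :> nat) || (j.+1 == i :> nat) = false.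
  apply/negP => /orP[] /eqP e.
    by move/eqP: n3; apply; apply: val_inj.
  by move/eqP: n2; apply; apply: val_inj.
by move=> _; rewrite expr0z mul1r /kap /isu /isd !other_in_sw // eq_sym.
Qed.

Lemma kap_swu i j I : isu j I -> kap i (sw j I) = u ^ (- cartan i j) * kap i I.
Proof.
move=> uI; have := @kap_swd i j (sw j I); rewrite isd_sw sw_sw => /(_ uI) ->.
by rewrite mulrA -expfzDr // addNr mul1r.
Qed.

End Kap.

(** * The tensor square of the q-exterior algebra *)

Section Tensor.
Variables (n : nat) (F : fieldType) (u : F).

Definition tensor := {ffun {set 'I_n} * {set 'I_n} -> F^o}.
Implicit Types (i j : 'I_n.-1) (I J : {set 'I_n}) (x y : tensor).

(* The tensor square of the q-exterior algebra for the coproduct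
   F |-> 1 (x) F + F (x) K,  E |-> E (x) 1 + K^-1 (x) E,  K |-> K (x) K. *)
Definition tF i x : tensor := [ffun p : {set 'I_n} * {set 'I_n} =>
  (isd i p.2)%:R * (x (p.1, sw i p.2) : F)
  + (isd i p.1)%:R * kap u i p.2 * (x (sw i p.1, p.2) : F)].
Definition tE i x : tensor := [ffun p : {set 'I_n} * {set 'I_n} =>
  (isu i p.1)%:R * (x (sw i p.1, p.2) : F)
  + (isu i p.2)%:R * (kap u i p.1)^-1 * (x (p.1, sw i p.2) : F)].
Definition tK i x : tensor := [ffun p : {set 'I_n} * {set 'I_n} =>
  kap u i p.1 * kap u i p.2 * (x p : F)].
Definition tKV i x : tensor := [ffun p : {set 'I_n} * {set 'I_n} =>
  (kap u i p.1)^-1 * (kap u i p.2)^-1 * (x p : F)].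

Fact tF_is_linear i : linear (tF i).
Proof. by move=> a x y; apply/ffunP => p; rewrite !ffunE /GRing.scale /=; ring. Qed.
HB.instance Definition _ i := GRing.isLinear.Build F tensor tensor _ (tF i) (tF_is_linear i).

Fact tE_is_linear i : linear (tE i).
Proof. by move=> a x y; apply/ffunP => p; rewrite !ffunE /GRing.scale /=; ring. Qed.
HB.instance Definition _ i := GRing.isLinear.Build F tensor tensor _ (tE i) (tE_is_linear i).

Fact tK_is_linear i : linear (tK i).
Proof. by move=> a x y; apply/ffunP => p; rewrite !ffunE /GRing.scale /=; ring. Qed.
HB.instance Definition _ i := GRing.isLinear.Build F tensor tensor _ (tK i) (tK_is_linear i).

Fact tKV_is_linear i : linear (tKV i).
Proof. by move=> a x y; apply/ffunP => p; rewrite !ffunE /GRing.scale /=; ring. Qed.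
HB.instance Definition _ i := GRing.isLinear.Build F tensor tensor _ (tKV i) (tKV_is_linear i).

Hypothesis u0 : u != 0.

Lemma tKF i j x : tK i (tF j x) = u ^ (- cartan i j) *: tF j (tK i x).
Proof.
apply/ffunP => -[I J]; rewrite !ffunE /= /GRing.scale /=.
have c0 : u ^ cartan i j != 0 by rewrite expfz_neq0.
rewrite -invr_expz.
case dJ : (isd j J); case dI : (isd j I); rewrite ?(mul0r, mulr0, addr0) //.
- by rewrite !(kap_swd u0 i dJ) !(kap_swd u0 i dI) /=; field.
- by rewrite !(kap_swd u0 i dJ) /=; field.
- by rewrite !(kap_swd u0 i dI) /=; field.
Qed.

Lemma tKVF i j x : tKV i (tF j x) = u ^ (cartan i j) *: tF j (tKV i x).
Proof.
apply/ffunP => -[I J]; rewrite !ffunE /= /GRing.scale /=.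
have c0 : u ^ cartan i j != 0 by rewrite expfz_neq0.
have kI := kap_neq0 u0 i I; have kJ := kap_neq0 u0 i J.
case dJ : (isd j J); case dI : (isd j I); rewrite ?(mul0r, mulr0, addr0) //.
- by rewrite !(kap_swd u0 i dJ) !(kap_swd u0 i dI) /=; field; rewrite c0 kI kJ.
- by rewrite !(kap_swd u0 i dJ) /=; field; rewrite c0 kI kJ.
- by rewrite !(kap_swd u0 i dI) /=; field; rewrite c0 kI kJ.
Qed.

Lemma tEF_diff i j x : i != j -> tE i (tF j x) = tF j (tE i x).
Proof.
move=> ij; apply/ffunP => -[I J]; rewrite !ffunE /=.
have cI := isu_isd_comm I ij; have cJ := isu_isd_comm J ij.
have sI := @sw_comm _ i j I ij; have sJ := @sw_comm _ i j J ij.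
rewrite !mulrDr.
have t1 : (isu i I)%:R * ((isd j (sw i I))%:R * kap u j J * x (sw j (sw i I), J)) =
    (isd j I)%:R * kap u j J * ((isu i (sw j I))%:R * x (sw i (sw j I), J)) :> F.
  move: cI sI; case uI: (isu i I) => /=.
    case: (isd j (sw i I)) => /esym; last by move=> cI _;
      rewrite !mul0r mulr0 mulrACA -natrM mulnb cI mul0r.
    by move=> /andP[-> ->] -> //; rewrite !mul1r.
  by move=> /esym cI _; rewrite mul0r mulrACA -natrM mulnb cI mul0r.
have t2 : (isu i J)%:R / kap u i I * ((isd j (sw i J))%:R * x (I, sw j (sw i J))) =
    (isd j J)%:R * ((isu i (sw j J))%:R / kap u i I * x (I, sw i (sw j J))) :> F.
  move: cJ sJ; case: (isu i J) => /= cJ sJ.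
    move: cJ sJ; case: (isd j (sw i J)) => /esym cJ sJ.
      by case/andP: cJ => -> ->; rewrite sJ // !mul1r.
    by rewrite !mul0r mulr0 mulrA mulrA -natrM mulnb cJ !mul0r.
  by rewrite !mul0r mulrA mulrA -natrM mulnb -cJ !mul0r.
(* In this mixed term both scalars coming from K are shifted: one order gains u^(- cartan j i), the
   other u^(- cartan i j), and the Cartan matrix is symmetric. *)
have t3 : (isu i J)%:R / kap u i I *
      ((isd j I)%:R * kap u j (sw i J) * x (sw j I, sw i J)) =
    (isd j I)%:R * kap u j J * ((isu i J)%:R / kap u i (sw j I) * x (sw j I, sw i J)) :> F.
  case uJ: (isu i J); last by rewrite !(mul0r, mulr0).
  case dI: (isd j I); last by rewrite !(mul0r, mulr0).
  rewrite (kap_swd u0 i dI) (kap_swu u0 j uJ).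
  have -> : cartan j i = cartan i j by rewrite /cartan eq_sym orbC.
  have c0 : u ^ cartan i j != 0 by rewrite expfz_neq0.
  rewrite -invr_expz; field.
  by rewrite c0 kap_neq0.
have t4 : (isu i I)%:R * ((isd j J)%:R * x (sw i I, sw j J)) =
    (isd j J)%:R * ((isu i I)%:R * x (sw i I, sw j J)) :> F by rewrite mulrCA.
rewrite t1 t2 t3 t4; ring.
Qed.

Hypothesis u2 : u - u^-1 != 0.

Lemma tEF_same i x : tE i (tF i x) - tF i (tE i x) =
  (u - u^-1)^-1 *: (tK i x - tKV i x).
Proof.
have u21 : u * u - 1 != 0.
  by apply: contra u2 => /eqP e; rewrite -(mulfK u0 (u - u^-1)) mulrBl mulVf // e mul0r.
apply/ffunP => -[I J]; rewrite !ffunE /= !isd_sw !isu_sw !sw_sw.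
rewrite !kap_sw /GRing.scale /= /kap.
case: (local_typeP i I) => -[uI dI]; case: (local_typeP i J) => -[uJ dJ];
rewrite ?uI ?dI ?uJ ?dJ /=; field; rewrite ?u0 ?u21 ?oner_neq0 //=.
Qed.

End Tensor.

(** * The field Q(q) *)

Notation tf := (@tofrac {poly rat}).

Lemma qq_neq0 : qq != 0.
Proof. by rewrite /qq tofrac_eq0 polyX_eq0. Qed.

Lemma qqX_neq1 k : (0 < k)%N -> qq ^+ k != 1.
Proof.
move=> k0; rewrite /qq -rmorphXn -(rmorph1 tf) tofrac_eq.
apply/eqP => /(congr1 (fun p : {poly rat} => p.[0])); rewrite !hornerE.
by move=> /eqP; rewrite expr0n gtn_eqF //= eq_sym oner_eq0.
Qed.

Lemma qq_sub_inv_neq0 : qq - qq^-1 != 0.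
Proof.
rewrite subr_eq0; apply: contra (qqX_neq1 (isT : 0 < 2)%N) => /eqP e.
by rewrite expr2 {1}e mulVf ?qq_neq0.
Qed.

Lemma qq2_neq0 : 1 + qq ^+ 2 != 0.
Proof.
rewrite /qq -rmorphXn -(rmorph1 tf) -rmorphD tofrac_eq0.
apply/eqP => /(congr1 (fun p : {poly rat} => p.[0])); rewrite !hornerE.
by move=> /eqP; rewrite ?expr0n ?addr0 ?oner_eq0.
Qed.

Lemma regular_tf p : regular_at0 (tf p).
Proof. by exists p, 1; rewrite hornerC oner_neq0 rmorph1 divr1. Qed.

Lemma regular_0 : regular_at0 0.
Proof. by rewrite -(rmorph0 tf); apply: regular_tf. Qed.

Lemma regular_1 : regular_at0 1.
Proof. by rewrite -(rmorph1 tf); apply: regular_tf. Qed.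

Lemma regular_qq : regular_at0 qq.
Proof. exact: regular_tf. Qed.

Lemma horner0_neq0 (p : {poly rat}) : p.[0] != 0 -> p != 0.
Proof. by apply: contraNneq => ->; rewrite horner0. Qed.

Lemma regularD f g : regular_at0 f -> regular_at0 g -> regular_at0 (f + g).
Proof.
move=> [a [b [b0 ->]]] [c [d [d0 ->]]]; exists (a * d + c * b), (b * d).
rewrite hornerM mulf_neq0 // rmorphD !rmorphM; split=> //.
by rewrite addf_div // tofrac_eq0 horner0_neq0.
Qed.

Lemma regularM f g : regular_at0 f -> regular_at0 g -> regular_at0 (f * g).
Proof.
move=> [a [b [b0 ->]]] [c [d [d0 ->]]]; exists (a * c), (b * d).
by rewrite hornerM mulf_neq0 // !rmorphM mulf_div.
Qed.

Lemma regular_inv_qq2 : regular_at0 (1 + qq ^+ 2)^-1.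
Proof.
exists 1, (1 + 'X ^+ 2); split; first by rewrite !hornerE ?expr0n ?addr0 oner_neq0.
by rewrite (rmorphD tf) (rmorphXn tf) (rmorph1 tf) div1r.
Qed.

Lemma tf_eq_qq_regular p f : regular_at0 f -> tf p = qq * f -> p.[0] = 0.
Proof.
move=> [a [b [b0 ->]]] e; have b1 := horner0_neq0 b0.
have: p * b = 'X * a.
  apply/eqP; rewrite -tofrac_eq !rmorphM /= e; apply/eqP.
  by rewrite /qq mulrA -!mulrA mulVf ?mulr1 // tofrac_eq0.
move=> /(congr1 (fun p : {poly rat} => p.[0])); rewrite !hornerE => /eqP.
by rewrite mulf_eq0 (negPf b0) orbF => /eqP.
Qed.

Lemma Qq_denominator (f : Qq) : exists2 d, d != 0 & exists e, f * tf d = tf e.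
Proof.
rewrite -[f]generic_quotient.reprK; set x := generic_quotient.repr f.
exists (frac x).2; first exact: denom_ratioP.
exists (frac x).1; unlock tofrac; rewrite -[LHS]pi_mul.
apply/eqmodP; rewrite /= equivfE /mulf /=.
have n1 : 1 != 0 :> {poly rat} by rewrite oner_neq0.
by rewrite !numden_Ratio ?mulf_neq0 ?denom_ratioP // !mulr1 mulrC.
Qed.

Lemma Qq_common_denominator (I : finType) (f : I -> Qq) :
  exists2 d, d != 0 & exists e : I -> {poly rat}, forall i, f i * tf d = tf (e i).
Proof.
have [ds ds0 /fin_all_exists[es des]] := fin_all_exists2 (fun i => Qq_denominator (f i)).
exists (\prod_i ds i); first by apply/prodf_neq0 => i _.
exists (fun i => es i * \prod_(j | j != i) ds j) => i.
by rewrite (bigD1 i) //= !rmorphM /= mulrA des.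
Qed.

(** Descent: the constant terms are rational numbers with vanishing sum of squares, so every e_i is
    divisible by 'X, and the quotients satisfy the same equation with a smaller sum of sizes. *)
Lemma sqr_sum_poly_eq0 (I : finType) (e : I -> {poly rat}) :
  \sum_i e i ^+ 2 = 0 -> forall i, e i = 0.
Proof.
have [m] := ubnP (\sum_i size (e i)); elim: m e => // m IHm e le_m se.
have e0 i : (e i).[0] = 0.
  have /eqP : \sum_i (e i).[0] ^+ 2 = 0.
    have := congr1 (fun p : {poly rat} => p.[0]) se; rewrite /= horner_sum horner0 => h.
    by rewrite -[RHS]h; apply: eq_bigr => j _; rewrite horner_exp.
  rewrite psumr_eq0 => [/allP h|j _]; last exact: sqr_ge0.
  by have := h i (mem_index_enum _); rewrite sqrf_eq0 => /eqP.
have /(_ _) de i : exists d, e i = d * 'X.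
  have : root (e i) 0 by rewrite rootE e0.
  by rewrite root_factor_theorem => /dvdpP[d]; rewrite subr0 => ->; exists d.
have [d deq] := fin_all_exists de.
have [/forallP /= z|] := boolP [forall i, e i == 0]; first by move=> i; apply/eqP.
rewrite negb_forall => /existsP[i ei].
have d0 : forall i, d i = 0.
  apply: IHm.
    rewrite ltnS in le_m; apply: leq_trans le_m.
    rewrite [X in (_ < X)%N](bigD1 i) //= (bigD1 i) //=.
    have di : d i != 0 by apply: contraNneq ei; rewrite deq => ->; rewrite mul0r.
    rewrite deq size_mulX // -addSn leq_add // leq_sum // => j _.
    rewrite deq; have [->|dj] := eqVneq (d j) 0; first by rewrite mul0r.
    by rewrite size_mulX.
  move: se; under eq_bigr => j _ do rewrite deq exprMn.
  by rewrite -mulr_suml => /eqP; rewrite mulf_eq0 expf_eq0 polyX_eq0 orbF => /eqP.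
by move: ei; rewrite deq d0 mul0r eqxx.
Qed.

Lemma sqr_sum_Qq_eq0 (I : finType) (f : I -> Qq) :
  \sum_i f i * f i = 0 -> forall i, f i = 0.
Proof.
have [d d0 [e de]] := Qq_common_denominator f; move=> sf.
have td0 : tf d != 0 by rewrite tofrac_eq0.
have e0 : forall i, e i = 0.
  apply: sqr_sum_poly_eq0; apply/eqP; rewrite -tofrac_eq0 rmorph_sum /=.
  under eq_bigr => i _ do rewrite rmorphXn /= -de expr2 mulrACA.
  by rewrite -mulr_suml sf mul0r.
by move=> i; apply: (mulIf td0); rewrite de e0 mul0r rmorph0.
Qed.

(** * Contravariant form and Kashiwara operators *)

Section Form.
Variables (n : nat) (F : fieldType) (u : F).
Hypothesis u0 : u != 0.
Implicit Types (i : 'I_n.-1) (I J : {set 'I_n}) (x y : tensor n F).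

Definition form x y : F := \sum_p (x p : F) * (y p : F).

Lemma formDl a x x' y : form (a *: x + x') y = a * form x y + form x' y.
Proof.
by rewrite /form mulr_sumr -big_split; apply: eq_bigr => p _; rewrite !ffunE /GRing.scale /=; ring.
Qed.

Lemma formC x y : form x y = form y x.
Proof. by apply: eq_bigr => p _; rewrite mulrC. Qed.

(** The adjoint of F_i is u E_i K_i: on a two-dimensional string K_i acts on the lower vector by
    u^-1, which the factor u compensates. Each summand of F_i is moved to the other argument by
    reindexing along the swap in its tensor factor. *)
Lemma form_adjoint i x y : form (tF u i x) y = u * form x (tE u i (tK u i y)).
Proof.
pose s1 := fun p : {set 'I_n} * {set 'I_n} => (sw i p.1, p.2).
pose s2 := fun p : {set 'I_n} * {set 'I_n} => (p.1, sw i p.2).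
have b1 : involutive s1 by move=> [I J]; rewrite /s1 /= sw_sw.
have b2 : involutive s2 by move=> [I J]; rewrite /s2 /= sw_sw.
rewrite /form; under eq_bigr => p _ do rewrite ffunE mulrDl.
rewrite big_split /= [X in X + _](reindex s2) /=; last exact: onW_bij (inv_bij b2).
rewrite [X in _ + X](reindex s1) /=; last exact: onW_bij (inv_bij b1).
rewrite -big_split mulr_sumr; apply: eq_bigr => -[I J] _.
rewrite !ffunE /= !isd_sw !sw_sw !kap_sw /kap.
case: (local_typeP i I) => -[uI dI]; case: (local_typeP i J) => -[uJ dJ];
rewrite ?uI ?dI ?uJ ?dJ;
by rewrite /s1 /s2 /= ?invr1 ?invrK; field.
Qed.

(** Each tensor factor is a sum of i-strings of dimension at most two. *)
Lemma tF_cube i x : tF u i (tF u i (tF u i x)) = 0.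
Proof.
apply/ffunP => -[I J]; rewrite !ffunE /= !isd_sw !sw_sw.
case dI : (isd i I); case dJ : (isd i J); rewrite ?(isd_isu dI) ?(isd_isu dJ) /=; ring.
Qed.

Hypothesis u2 : 1 + u ^+ 2 != 0.

(* Kashiwara's lowering operator: it sends F^(j) y to F^(j+1) y when E y = 0,
   see [ft_dF]. *)
Definition ft i x : tensor n F := [ffun p : {set 'I_n} * {set 'I_n} =>
  if isd i p.1 then
    if isd i p.2 then
      (x (sw i p.1, p.2) + u * (x (p.1, sw i p.2) : F)) * (1 + u ^+ 2)^-1 : F
    else if isu i p.2 then u * (x (sw i p.1, p.2) : F)
    else x (sw i p.1, p.2)
  else if isd i p.2 then x (p.1, sw i p.2) else 0].

Fact ft_is_linear i : linear (ft i).
Proof.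
move=> a x y; apply/ffunP => p; rewrite !ffunE /GRing.scale /=.
by do !case: ifP => _; ring.
Qed.
HB.instance Definition _ i :=
  GRing.isLinear.Build F (tensor n F) (tensor n F) _ (ft i) (ft_is_linear i).

Lemma tE_eq0 i x I J : tE u i x = 0 ->
  (isu i I)%:R * (x (sw i I, J) : F) + (isu i J)%:R * (kap u i I)^-1 * (x (I, sw i J) : F) = 0.
Proof. by move=> /ffunP /(_ (I, J)); rewrite !ffunE. Qed.

Lemma ft_tF0 i x : tE u i x = 0 -> ft i x = tF u i x.
Proof.
move=> Ex; apply/ffunP => -[I J]; rewrite !ffunE /=.
have e1 := @tE_eq0 i x (sw i I) (sw i J) Ex.
rewrite !isu_sw !sw_sw !kap_sw in e1; rewrite /kap in e1 *.
case dI : (isd i I) e1; case dJ : (isd i J); rewrite ?(isd_isu dI) ?(isd_isu dJ) /= => e1.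
- have -> : x (I, sw i J) = - (u^-1)%R * (x (sw i I, J) : F) :> F.
    move: e1; rewrite !mul1r invrK => /eqP; rewrite addr_eq0 => /eqP ->.
    by field.
  by field; rewrite u0 u2.
- by case uJ: (isu i J) => /=; ring.
- by ring.
- by ring.
Qed.

Lemma ft_tF1 i x : tE u i x = 0 ->
  ft i (tF u i x) = (u + u^-1)^-1 *: tF u i (tF u i x).
Proof.
move=> Ex; apply/ffunP => -[I J]; rewrite !ffunE /= !isd_sw !sw_sw /GRing.scale /=.
(* These facts collect the coordinates of E_i x = 0: x vanishes where a lower vector stands next to
   an invariant one or to another lower one. *)
have z1 : isu i I = false -> isd i I = false -> isd i J = true -> x (I, J) = 0 :> F.
  move=> uI dI dJ; have := @tE_eq0 i x I (sw i J) Ex.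
  by rewrite isu_sw sw_sw uI dJ /kap uI dI invr1 mul0r !mul1r add0r.
have z2 : isu i J = false -> isd i J = false -> isd i I = true -> x (I, J) = 0 :> F.
  move=> uJ dJ dI; have := @tE_eq0 i x (sw i I) J Ex.
  by rewrite isu_sw sw_sw uJ dI !mul0r !mul1r addr0.
have z3 : isd i I = true -> isd i J = true -> x (I, J) = 0 :> F.
  move=> dI dJ; have := @tE_eq0 i x (sw i I) J Ex.
  by rewrite isu_sw sw_sw dI (isd_isu dJ) !mul0r !mul1r addr0.
have z5 : isu i I = true -> isd i J = true -> x (sw i I, J) = 0 :> F.
  move=> uI dJ; have := @tE_eq0 i x I J Ex.
  by rewrite uI (isd_isu dJ) !mul0r !mul1r addr0.
have ui : u + u^-1 != 0.
  by apply: contra u2 => /eqP e; rewrite expr2 -(mulfV u0) -mulrDr addrC e mulr0.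
have z6 : isd i I = true -> isu i J = true -> x (I, sw i J) = 0 :> F.
  move=> dI uJ; have := @tE_eq0 i x (sw i I) (sw i J) Ex.
  by rewrite !isu_sw !sw_sw dI (isu_isd uJ) !mul0r !mul1r addr0.
rewrite !kap_sw /kap.
case: (local_typeP i I) => -[uI dI]; case: (local_typeP i J) => -[uJ dJ];
rewrite ?uI ?dI ?uJ ?dJ;
rewrite /= ?(z1 uI dI dJ) ?(z2 uJ dJ dI) ?(z3 dI dJ) ?(z5 uI dJ) ?(z6 dI uJ); try (by ring).
by field; rewrite u0 oner_neq0 /= addrC -expr2.
Qed.

Lemma ft_tF2 i x : ft i (tF u i (tF u i x)) = 0.
Proof.
apply/ffunP => -[I J]; rewrite !ffunE /= !isd_sw !sw_sw /=.
case: (local_typeP i I) => -[uI dI]; case: (local_typeP i J) => -[uJ dJ];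
rewrite ?uI ?dI ?uJ ?dJ;
by rewrite /=; ring.
Qed.

(** The characteristic property of Kashiwara's operator, with c j in the role of [j]!. Since F_i^3 =
    0, it amounts to the cases j = 0 and j = 1, both sides being 0 from j = 2 on. *)
Lemma ft_dF (c : nat -> F) i x j : c 0%N = 1 -> c 1%N = 1 -> c 2%N = u + u^-1 ->
  tE u i x = 0 ->
  ft i ((c j)^-1 *: iter j (tF u i) x) = (c j.+1)^-1 *: iter j.+1 (tF u i) x.
Proof.
move=> c0 c1 c2 Ex; rewrite linearZ; case: j => [|[|[|j]]] /=.
- by rewrite c0 c1 ft_tF0.
- by rewrite c1 c2 ft_tF1 // invr1 scale1r.
- by rewrite ft_tF2 tF_cube !scaler0.
by rewrite tF_cube !linear0.
Qed.

End Form.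

(** * Weights *)

Definition tbasis n (F : fieldType) (p : {set 'I_n} * {set 'I_n}) : tensor n F :=
  [ffun r => (r == p)%:R : F].

Definition top_set k n : {set 'I_n} := [set i : 'I_n | (i < k)%N].

Definition tvac k n (F : fieldType) : tensor n F := tbasis F (top_set k n, top_set k n).

Section Vacuum.
Variables (k n : nat) (F : fieldType) (u : F).

Lemma isd_top (i : 'I_n.-1) : isd i (top_set k n) = false.
Proof. by apply/negP; rewrite /isd !inE /= -leqNgt => /andP[a b]; lia. Qed.

Lemma isu_top (i : 'I_n.-1) : isu i (top_set k n) = (i.+1 == k).
Proof. by rewrite /isu !inE /= -leqNgt; lia. Qed.

Lemma sw_eq_top (i : 'I_n.-1) I : isu i I -> (sw i I == top_set k n) = false.
Proof.
move=> uI; apply/negP => /eqP e; have := isd_top i.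
by rewrite -e isd_sw uI.
Qed.

Lemma tE_vac (i : 'I_n.-1) : tE u i (tvac k n F) = 0.
Proof.
apply/ffunP => -[I J]; rewrite !ffunE /= !xpair_eqE.
have -> : (isu i I)%:R * ((sw i I == top_set k n) && (J == top_set k n))%:R = 0 :> F.
  by case uI: (isu i I); rewrite ?mul0r // sw_eq_top // mulr0.
have -> : (isu i J)%:R / kap u i I * ((I == top_set k n) && (sw i J == top_set k n))%:R = 0 :> F.
  by case uJ: (isu i J); rewrite ?mul0r // sw_eq_top // andbF mulr0.
by rewrite addr0.
Qed.

Lemma tK_vac (i : 'I_n.-1) :
  tK u i (tvac k n F) = u ^+ (if i.+1 == k then 2 else 0)%N *: tvac k n F.
Proof.
apply/ffunP => -[I J]; rewrite !ffunE /= /GRing.scale /= xpair_eqE.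
case: eqP => [->|]; last by rewrite !mulr0.
case: eqP => [->|]; last by rewrite !mulr0.
rewrite /kap !isu_top !isd_top /=; case: eqP => _; rewrite ?expr0 ?mulr1 //.
Qed.

Lemma tKV_vac (i : 'I_n.-1) :
  tKV u i (tvac k n F) = (u ^+ (if i.+1 == k then 2 else 0)%N)^-1 *: tvac k n F.
Proof.
apply/ffunP => -[I J]; rewrite !ffunE /= /GRing.scale /= xpair_eqE.
case: eqP => [->|]; last by rewrite !mulr0.
case: eqP => [->|]; last by rewrite !mulr0.
rewrite /kap !isu_top !isd_top /=; case: eqP => _; rewrite ?expr0 ?invr1 ?mulr1 //.
by rewrite expr2 invfM.
Qed.

Lemma form_vac : form (tvac k n F) (tvac k n F) = 1.
Proof.
rewrite /form (bigD1 (top_set k n, top_set k n)) //= !ffunE eqxx mulr1 big1 ?addr0 //.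
by move=> p /negPf pt; rewrite !ffunE pt mulr0.
Qed.

End Vacuum.

Lemma sum_delta_ord (N m : nat) (G : nat -> int) :
  \sum_(i < N) (m == i)%:Z * G i = (m < N)%N%:Z * G m.
Proof.
have [mN|Nm] := ltnP m N; last first.
  by rewrite mul0r big1 // => i _; rewrite gtn_eqF ?mul0r //; apply: leq_trans Nm.
rewrite (bigD1 (Ordinal mN)) //= eqxx big1 ?addr0 // => i im.
by rewrite (negPf (_ : m != i)) ?mul0r // eq_sym; apply: contra im => /eqP e; apply/eqP/val_inj.
Qed.

(** The coefficients C(m) = m (n - m), with m = i + 1, express the sum of the positive coroots in
    the simple ones, and every simple root takes the value 2 there: 2 C(m) - C(m - 1) - C(m + 1) =
    2. The boundary terms are absent because C vanishes at 0 and n. *)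
Lemma cartan_rho n (j : 'I_n.-1) :
  \sum_(i < n.-1) (i.+1 * (n.-1 - i))%N%:Z * cartan i j = 2.
Proof.
pose C m := (m * (n - m))%N%:Z.
have e1 (i : 'I_n.-1) : (i.+1 * (n.-1 - i))%N%:Z * cartan i j =
   2 * ((j == i :> nat)%:Z * C i.+1) - (j == i.+1 :> nat)%:Z * C i.+1 - (j.+1 == i)%:Z * C i.+1.
  have -> : (i.+1 * (n.-1 - i))%N%:Z = C i.+1 by rewrite /C; congr (Posz (_ * _)); lia.
  have -> : cartan i j = 2 * (j == i :> nat)%:Z - (j == i.+1 :> nat)%:Z - (j.+1 == i)%:Z.
    rewrite /cartan -val_eqE /= (eq_sym (nat_of_ord j)) (eq_sym (nat_of_ord j) i.+1).
    case: (i =P j :> nat) => a; case: (i.+1 =P j :> nat) => b;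
    case: (j.+1 =P i :> nat) => c //=; lia.
  by ring.
rewrite (eq_bigr _ (fun i _ => e1 i)) !big_split /= !sumrN -mulr_sumr.
rewrite (sum_delta_ord n.-1 j (fun i => C i.+1)) (sum_delta_ord n.-1 j.+1 (fun i => C i.+1)).
have -> : \sum_(i < n.-1) (j == i.+1 :> nat)%:Z * C i.+1 = C j.
  case: j {e1} => -[|j] /= jn; first by rewrite /C mul0n big1.
  under eq_bigr => i _ do rewrite eqSS.
  by rewrite (sum_delta_ord n.-1 j (fun i => C i.+1)) ltnW // mul1r.
rewrite ltn_ord mul1r /C; case: j {e1} => j /= jn.
have [jn1|jn1] := ltnP j.+1 n.-1; rewrite ?mul1r ?mul0r; nia.
Qed.

(** Applying f - mu N kills the last summand and multiplies the others by nonzero scalars, which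
    gives the induction on N. *)
Lemma eigenvectors_indep (K : fieldType) (V : lmodType K) (f : V -> V) (mu : nat -> K) :
  linear f -> injective mu -> forall N (xs : nat -> V),
  (forall l, f (xs l) = mu l *: xs l) -> \sum_(l < N) xs l = 0 ->
  forall l, (l < N)%N -> xs l = 0.
Proof.
move=> flin imu.
have fD x y : f (x + y) = f x + f y by rewrite -[x]scale1r flin !scale1r.
have f0 : f 0 = 0 by apply: (addrI (f 0)); rewrite -fD !addr0.
have fZ a x : f (a *: x) = a *: f x by rewrite -[a *: x]addr0 flin f0 addr0.
elim=> [//|N IHN] xs fx; rewrite big_ord_recr /= => s0.
have fs : f (\sum_(l < N) xs l) = \sum_(l < N) mu l *: xs l.
  transitivity (\sum_(l < N) f (xs l)); last by apply: eq_bigr => l _; rewrite fx.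
  by elim: (N) => [|m IHm]; rewrite ?big_ord0 // !big_ord_recr /= fD IHm.
have h l : (l < N)%N -> xs l = 0.
  move=> lN; have /(_ l lN) : forall l, (l < N)%N -> (mu l - mu N) *: xs l = 0.
    apply: (IHN (fun l => (mu l - mu N) *: xs l)) => [m|]; first by rewrite fZ fx !scalerA mulrC.
    under eq_bigr => m _ do rewrite scalerBl.
    rewrite sumrB -fs -scaler_sumr.
    have -> : \sum_(l < N) xs l = - xs N by apply/eqP; rewrite -addr_eq0 s0.
    by rewrite -scaleN1r fZ fx !scalerA mulrC subrr.
  by move=> /eqP; rewrite scaler_eq0 subr_eq0 (inj_eq imu) ltn_eqF // => /eqP.
move=> l; rewrite ltnS leq_eqVlt => /orP[/eqP ->|]; last exact: h.
by move: s0; rewrite big1 ?add0r // => m _; apply: h.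
Qed.

(** * Embedding the module in the tensor square *)

(* The subspace of maximal dimension among those contained in P. *)
Lemma vspace_of_pred (K : fieldType) (V : vectType K) (P : V -> Prop) :
  P 0 -> (forall a x y, P x -> P y -> P (a *: x + y)) ->
  exists U : {vspace V}, forall x, x \in U <-> P x.
Proof.
move=> P0 Plin.
suff h m (U : {vspace V}) : (\dim {:V} - \dim U <= m)%N -> (forall x, x \in U -> P x) ->
    exists U : {vspace V}, forall x, x \in U <-> P x.
  apply: (h _ 0%VS (leqnn _)) => x; by rewrite memv0 => /eqP ->.
elim: m U => [|m IHm] U dU UP.
  exists U => x; split; first exact: UP.
  have -> : U = {:V}%VS by apply/eqP; rewrite -(geq_leqif (dimv_leqif_eq (subvf U))); lia.
  by rewrite memvf.
have [h|h] := classic (forall x, P x -> x \in U); first by exists U => x; split;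
  [apply: UP | apply: h].
have [x hx] := not_all_ex_not _ _ h.
have [Px /negP xU] := imply_to_and _ _ hx.
apply: (IHm (U + <[x]>)%VS).
  have UU : (U <= U + <[x]>)%VS by apply: addvSl.
  have := dimv_leqif_eq UU => -[dle deq].
  have : \dim U != \dim (U + <[x]>)%VS.
    rewrite deq; apply: contra xU => /eqP ->.
    by rewrite (subvP (addvSr U <[x]>%VS)) // memv_line.
  have := dimvS (subvf (U + <[x]>)%VS); lia.
move=> y /memv_addP[z zU [w /vlineP[a ->] ->]].
by rewrite addrC; apply: Plin => //; apply: UP.
Qed.

Section Transfer.
Variables (k n : nat) (V : vectType Qq) (M : Uq_module n V) (v : V).
Hypothesis hM : Uq_irreducible M.
Hypothesis hv : highest_weight_vector k M v.
Implicit Types (i j : 'I_n.-1).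

Local Notation tq := (tensor n Qq).
Local Notation w0 := (tvac k n Qq).

(* The graph of the morphism from V to the tensor square sending v to w0. *)
Inductive gen : V -> tq -> Prop :=
| gen_hw : gen v w0
| gen_lin a x y x' y' : gen x y -> gen x' y' -> gen (a *: x + x') (a *: y + y')
| gen_F i x y : gen x y -> gen (opF M i x) (tF qq i y).

Lemma gen_eq x y x' y' : gen x y -> x = x' -> y = y' -> gen x' y'.
Proof. by move=> ? <- <-. Qed.

Lemma gen0 : gen 0 0.
Proof. by apply: (gen_eq (gen_lin (-1) gen_hw gen_hw)); rewrite scaleN1r addNr. Qed.

Lemma genD x y x' y' : gen x y -> gen x' y' -> gen (x + x') (y + y').
Proof. by move=> h h'; apply: (gen_eq (gen_lin 1 h h')); rewrite scale1r. Qed.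

Lemma genZ a x y : gen x y -> gen (a *: x) (a *: y).
Proof. by move=> h; apply: (gen_eq (gen_lin a h gen0)); rewrite addr0. Qed.

Lemma genB x y x' y' : gen x y -> gen x' y' -> gen (x - x') (y - y').
Proof. by move=> h h'; rewrite -scaleN1r -[- y']scaleN1r; apply: genD => //; apply: genZ. Qed.

Lemma gen_sum (I : Type) (r : seq I) (P : pred I) (f : I -> V) (g : I -> tq) :
  (forall t, P t -> gen (f t) (g t)) ->
  gen (\sum_(t <- r | P t) f t) (\sum_(t <- r | P t) g t).
Proof.
by move=> h; elim/big_rec2: _ => [|i x y Pi gxy]; [apply: gen0 | apply: genD => //; apply: h].
Qed.

Lemma opKF' i j x : opK M i (opF M j x) = qq ^ (- cartan i j) *: opF M j (opK M i x).
Proof. by rewrite -opKF opKK. Qed.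

Lemma opKVF i j x : opKV M i (opF M j x) = qq ^ (cartan i j) *: opF M j (opKV M i x).
Proof.
rewrite -{1}[x](opKKV M i) -(scale1r (opF M j _)).
have -> : 1 = qq ^ cartan i j * qq ^ (- cartan i j) by rewrite -expfzDr ?qq_neq0 // subrr.
by rewrite -scalerA -opKF' linearZ /= opKK.
Qed.

Lemma opKV_hw i : opKV M i v = (qq ^+ (if i.+1 == k then 2 else 0)%N)^-1 *: v.
Proof.
have [_ _ hK] := hv; rewrite -{2}(opKK M i v) hK linearZ /= scalerA mulVf ?scale1r //.
exact: (expf_neq0 _ qq_neq0).
Qed.

(** By construction the graph is closed under the F_j only. Closure under K_i, its inverse and E_i
    follows by commuting them past the F_j down to the highest weight vectors, where both sides
    agree. *)
Lemma gen_K i x y : gen x y -> gen (opK M i x) (tK qq i y).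
Proof.
elim=> [|a x1 y1 x2 y2 _ h1 _ h2|j x1 y1 _ h].
- by have [_ _ ->] := hv; rewrite tK_vac; exact: (genZ _ gen_hw).
- by rewrite !linearP; apply: gen_lin.
- by rewrite opKF' (tKF qq_neq0); exact: (genZ _ (gen_F _ h)).
Qed.

Lemma gen_KV i x y : gen x y -> gen (opKV M i x) (tKV qq i y).
Proof.
elim=> [|a x1 y1 x2 y2 _ h1 _ h2|j x1 y1 _ h].
- by rewrite opKV_hw tKV_vac; exact: (genZ _ gen_hw).
- by rewrite !linearP; apply: gen_lin.
- by rewrite opKVF (tKVF qq_neq0); exact: (genZ _ (gen_F _ h)).
Qed.

Lemma gen_E i x y : gen x y -> gen (opE M i x) (tE qq i y).
Proof.
elim=> [|a x1 y1 x2 y2 _ h1 _ h2|j x1 y1 h h'].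
- by have [_ -> _] := hv; rewrite tE_vac; apply: gen0.
- by rewrite !linearP; apply: gen_lin.
- rewrite -[opE M i _](subrK (opF M j (opE M i x1))) opEF.
  rewrite -[tE _ i _](subrK (tF qq j (tE qq i y1))).
  apply: genD; last exact: gen_F.
  case: eqP => [<-|/eqP ij].
    rewrite (tEF_same qq_neq0 qq_sub_inv_neq0); exact: (genZ _ (genB (gen_K _ h) (gen_KV _ h))).
  by rewrite (tEF_diff qq_neq0) // subrr; apply: gen0.
Qed.

(** The domain of the graph is a submodule, and it contains v, which is nonzero. *)
Lemma gen_total x : exists y, gen x y.
Proof.
have [U UP] : exists U : {vspace V}, forall x, x \in U <-> exists y, gen x y.
  apply: vspace_of_pred; first by exists 0; apply: gen0.
  by move=> a x1 x2 [y1 g1] [y2 g2]; exists (a *: y1 + y2); apply: gen_lin.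
apply/UP; have [_ /(_ U) hU] := hM.
case: hU => [i|U0|->]; last exact: memvf.
  split; apply/subvP => _ /memv_imgP[z /UP[y gz] ->]; apply/UP.
  - by exists (tE qq i y); apply: gen_E.
  - by exists (tF qq i y); apply: gen_F.
  - by exists (tK qq i y); apply: gen_K.
  - by exists (tKV qq i y); apply: gen_KV.
have [v0 _ _] := hv; have : v \in U by apply/UP; exists w0; apply: gen_hw.
by rewrite U0 !memv0 (negPf v0).
Qed.

(* The product of the K_i^(i (n - i)) scales every F_j by q^-2, hence it
   grades V by the length of the words in the F_i applied to v. *)
Definition opKrho (x : V) : V :=
  foldr (fun i => iter (i.+1 * (n.-1 - i)) (opK M i)) x (enum 'I_n.-1).

Lemma opKrho_linear : linear opKrho.
Proof.
move=> a x y; rewrite /opKrho; elim: (enum _) => //= i s ->.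
by elim: (_ * _)%N => //= m ->; rewrite linearP.
Qed.

Lemma opKrho0 : opKrho 0 = 0.
Proof. by have := opKrho_linear (-1) 0 0; rewrite scaler0 addr0 scaleN1r addNr. Qed.

Lemma opKrhoF j x : opKrho (opF M j x) = qq ^- 2 *: opF M j (opKrho x).
Proof.
have -> : qq ^- 2 = qq ^ (- (2 : int)) by [].
rewrite -(cartan_rho j) -sumrN -big_enum /opKrho /=.
elim: (enum _) => [|i s IHs] /=; first by rewrite big_nil expr0z scale1r.
rewrite IHs big_cons.
move: (foldr _ _ _) => z; elim: (_ * _)%N => [|m IHm] /=.
  by rewrite mul0r oppr0 add0r.
rewrite IHm linearZ /= opKF' scalerA -expfzDr ?qq_neq0 //; congr (_ ^ _ *: _).
by rewrite -addn1 PoszD; ring.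
Qed.

Lemma opKrho_hw : exists2 c, c != 0 & opKrho v = c *: v.
Proof.
rewrite /opKrho; elim: (enum _) => [|i s [c c0 IHs]] /=.
  by exists 1; rewrite ?oner_neq0 ?scale1r.
rewrite IHs; elim: (_ * _)%N => [|m [d d0 IHm]] /=; first by exists c.
have [_ _ hK] := hv; rewrite IHm linearZ /= hK scalerA.
exists (d * qq ^+ (if i.+1 == k then 2 else 0)%N); last by [].
exact: (mulf_neq0 d0 (expf_neq0 _ qq_neq0)).
Qed.

(** The component xs l collects the words of length l in the F_i. Its degree 0 part is visible on
    the tensor side as the coefficient of y on the top vector, because an image of F_j is orthogonal
    to that vector: E_j kills it. *)
Lemma gen_graded c : opKrho v = c *: v -> forall x y, gen x y ->
  exists (N : nat) (xs : nat -> V),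
  [/\ forall l, opKrho (xs l) = (c * qq ^- (2 * l)) *: xs l,
      forall l, (N <= l)%N -> xs l = 0,
      x = \sum_(l < N) xs l & xs 0%N = form y w0 *: v].
Proof.
move=> hc x y; elim=> [|a x1 y1 x2 y2 _ [N1 [xs1 [k1 z1 s1 h1]]] _ [N2 [xs2 [k2 z2 s2 h2]]]|j x1
  y1 _ [N [xs [kx z s h]]]].
- exists 1%N, (fun l => if l == 0%N then v else 0); split.
  + case=> [|l] /=; first by rewrite hc muln0 expr0 invr1 mulr1.
    by rewrite opKrho0 scaler0.
  + by case.
  + by rewrite big_ord1.
  + by rewrite form_vac scale1r.
- exists (maxn N1 N2), (fun l => a *: xs1 l + xs2 l); split.
  + by move=> l; rewrite opKrho_linear k1 k2 scalerDr !scalerA mulrC.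
  + by move=> l; rewrite geq_max => /andP[l1 l2]; rewrite z1 // z2 // scaler0 addr0.
  + have ext (xs : nat -> V) N N' : (N <= N')%N -> (forall l, (N <= l)%N -> xs l = 0) ->
        \sum_(l < N) xs l = \sum_(l < N') xs l.
      move=> NN' hz; rewrite (big_ord_widen N' xs NN') big_mkcond; apply: eq_bigr => l _.
      by case: ltnP => // /hz.
    rewrite s1 s2 (ext _ N1 _ (leq_maxl N1 N2)) // (ext _ N2 _ (leq_maxr N1 N2)) //.
    by rewrite scaler_sumr -big_split.
  + by rewrite h1 h2 formDl scalerDl scalerA.
- exists N.+1, (fun l => if l is l'.+1 then opF M j (xs l') else 0); split.
  + case=> [|l].
      by rewrite opKrho0 scaler0.
    rewrite opKrhoF kx linearZ /= scalerA; congr (_ *: _).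
    by rewrite mulrCA -invfM mulnS exprD.
  + by case=> // l; rewrite ltnS => /z ->; rewrite linear0.
  + by rewrite big_ord_recl add0r s linear_sum; apply: eq_bigr.
  + by rewrite form_adjoint ?qq_neq0 // tK_vac linearZ /= tE_vac scaler0 formC /form big1 ?mulr0
    ?scale0r // => p _; rewrite ffunE mul0r.
Qed.

(** As q is not a root of unity the eigenvalues of [opKrho] in different degrees differ, so every
    component of 0 vanishes, in particular [form y w0 *: v] in degree 0. *)
Lemma gen0_vac y : gen 0 y -> form y w0 = 0.
Proof.
move=> g0; have [c c0 hc] := opKrho_hw; have [v0 _ _] := hv.
have [N [xs [kx z s h]]] := gen_graded hc g0.
have muI : injective (fun l => c * qq ^- (2 * l)).
  move=> l m /= /(mulfI c0) /invr_inj.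
  wlog lm : l m / (l <= m)%N => [hw|].
    by case/orP: (leq_total l m) => ? e; [apply: hw | symmetry; apply: hw].
  rewrite -{1}(subnKC lm) mulnDr exprD -{1}[qq ^+ (2 * l)]mulr1.
  move=> /(mulfI (expf_neq0 _ qq_neq0)) /esym /eqP e.
  case: (posnP (m - l)%N) => [|ml]; first lia.
  by have := qqX_neq1 (_ : 0 < 2 * (m - l))%N; rewrite e => /(_ _) -/(_ ltac:(lia)).
have /eqP : xs 0%N = 0.
  case: (posnP N) => [N0|N0]; first by apply: z; rewrite N0.
  exact: (eigenvectors_indep opKrho_linear muI kx (esym s)).
by rewrite h scaler_eq0 (negPf v0) orbF => /eqP.
Qed.

(** By adjunction, pairing y with F_i z is pairing an image of E_i K_i 0 = 0 with z, so the
    orthogonality to the top vector spreads to every element of the image. Pairing y with itself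
    then gives a vanishing sum of squares in Q(q). *)
Lemma gen0_inj y : gen 0 y -> y = 0.
Proof.
move=> g0; have h x z : gen x z -> forall y, gen 0 y -> form y z = 0.
  elim=> [|a x1 z1 x2 z2 _ h1 _ h2|i x1 z1 _ h1] y' gy'; first exact: gen0_vac.
  - by rewrite formC formDl !(formC _ y') h1 // h2 // mulr0 addr0.
  - rewrite formC form_adjoint ?qq_neq0 // formC h1 ?mulr0 //.
    by have := gen_E i (gen_K i gy'); rewrite !linear0.
have /sqr_sum_Qq_eq0 y0 := h _ _ g0 _ g0.
by apply/ffunP => p; rewrite ffunE y0.
Qed.

Lemma gen_fun x y y' : gen x y -> gen x y' -> y = y'.
Proof.
move=> g g'; apply/eqP; rewrite -subr_eq0; apply/eqP/gen0_inj.
by apply: (gen_eq (genB g g')); rewrite ?subrr.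
Qed.

End Transfer.

(** * Noncrossing matchings *)

Section Matchings.
Variable n : nat.

(* A partial noncrossing pairing (tau, T), with tau given by the involution
   whose nontrivial orbits are the strands. *)
Definition matching := ({ffun 'I_n -> 'I_n} * {set 'I_n})%type.
Implicit Types (Q : matching) (i : 'I_n.-1) (x y : 'I_n).

Definition valid Q : bool :=
  [&& [forall x, Q.1 (Q.1 x) == x],
      [forall x : 'I_n, forall y : 'I_n,
        ~~ [&& (x < y)%N, (y < Q.1 x)%N & (Q.1 x < Q.1 y)%N]] &
      [forall x in Q.2, Q.1 x == x]].

Lemma validP Q : reflect
  [/\ involutive Q.1,
      forall x y, (x < y)%N -> (y < Q.1 x)%N -> (Q.1 y <= Q.1 x)%N &
      forall x, x \in Q.2 -> Q.1 x = x] (valid Q).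
Proof.
apply: (iffP and3P) => -[h1 h2 h3]; split.
- by move=> x; apply/eqP/(forallP h1).
- move=> x y xy yx; have := forallP (forallP h2 x) y; rewrite xy yx /=; lia.
- by move=> x xT; apply/eqP/(implyP (forallP h3 x)).
- by apply/forallP => x; apply/eqP.
- apply/forallP => x; apply/forallP => y; apply/negP => /and3P[xy yx].
  by rewrite ltnNge h2.
- by apply/forallP => x; apply/implyP => /h3 ->.
Qed.

Definition opens Q : {set 'I_n} := [set x | (x \in Q.2) || (x < Q.1 x)%N].
Definition closes Q : {set 'I_n} := [set x | (x \in Q.2) || (Q.1 x < x)%N].
(** The index of the only term of the vector attached to Q that survives at q = 0 ([bcoef_lead]),
    and the pair of columns of the tableau ([cols_theta]). *)
Definition lead Q := (opens Q, closes Q).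

Lemma lead_fixed Q x : valid Q -> Q.1 x = x ->
  ((x \in opens Q) = (x \in Q.2)) * ((x \in closes Q) = (x \in Q.2)).
Proof. by move=> _ fx; rewrite !inE fx ltnn !orbF. Qed.

Lemma lead_matched Q x : valid Q -> Q.1 x != x ->
  ((x \in opens Q) = (x < Q.1 x)%N) * ((x \in closes Q) = (Q.1 x < x)%N).
Proof.
move=> /validP[_ _ hT] fx; rewrite !inE.
by have -> : (x \in Q.2) = false by apply: contraNF fx => /hT ->.
Qed.

Lemma matching_eq Q Q' : Q.1 = Q'.1 -> Q.2 = Q'.2 -> Q = Q'.
Proof. by case: Q; case: Q' => f' T' f T /= -> ->. Qed.

(** A noncrossing matching is determined by its left and right ends, as a bracketing is by its word;
    T is where the two sets meet. *)
Lemma lead_inj Q Q' : valid Q -> valid Q' -> lead Q = lead Q' -> Q = Q'.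
Proof.
move=> vQ vQ' [eo ec].
have [fK nc hT] := validP _ vQ; have [fK' nc' hT'] := validP _ vQ'.
have eoM x : (x \in opens Q) = (x \in opens Q') by rewrite eo.
have ecM x : (x \in closes Q) = (x \in closes Q') by rewrite ec.
have eT x : (x \in Q.2) = (x \in Q'.2).
  have [h|h] := eqVneq (Q.1 x) x; have [h'|h'] := eqVneq (Q'.1 x) x.
  - by have := eoM x; rewrite (lead_fixed vQ h) (lead_fixed vQ' h').
  - have := eoM x; have := ecM x; rewrite !(lead_fixed vQ h) !(lead_matched vQ' h').
    have h2 : (x < Q'.1 x)%N != (Q'.1 x < x)%N by move: h'; rewrite -val_eqE /=; lia.
    by move=> e1 e2; move: h2; rewrite -e1 -e2 eqxx.
  - have := eoM x; have := ecM x; rewrite !(lead_fixed vQ' h') !(lead_matched vQ h).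
    have h2 : (x < Q.1 x)%N != (Q.1 x < x)%N by move: h; rewrite -val_eqE /=; lia.
    by move=> e1 e2; move: h2; rewrite e1 e2 eqxx.
  - by apply/idP/idP => [/hT e|/hT' e]; [rewrite e eqxx in h | rewrite e eqxx in h'].
have elt x : (x < Q.1 x)%N = (x < Q'.1 x)%N.
  case xT : (x \in Q.2).
    by rewrite hT // hT' // -eT.
  by have := eoM x; rewrite !inE -eT xT.
have egt x : (Q.1 x < x)%N = (Q'.1 x < x)%N.
  case xT : (x \in Q.2).
    by rewrite hT // hT' // -eT.
  by have := ecM x; rewrite !inE -eT xT.
(* Induction on the span of the strand of Q opening at x: another mate under Q'
   of its right end would give a crossing, in Q' or in Q, or contradict the
   induction hypothesis at a nested strand. *)
have main m x : (Q.1 x - x <= m)%N -> (x < Q.1 x)%N -> Q'.1 x = Q.1 x.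
  elim: m x => [|m IHm] x lem xlt; first by lia.
  have xlt' : (x < Q'.1 x)%N by rewrite -elt.
  have := egt (Q.1 x); rewrite fK xlt => /esym elt1.
  set y := Q'.1 (Q.1 x) in elt1 *.
  have fy : Q'.1 y = Q.1 x by rewrite /y fK'.
  case: (ltngtP y x) => [yx|xy|/val_inj e]; last by rewrite -{1}e fy.
    have := nc' y x yx; rewrite fy => /(_ xlt) le1.
    have ne : Q'.1 x != Q.1 x.
      by apply/eqP => e; move: yx; rewrite /y -e fK' ltnn.
    set z := Q'.1 x in xlt' le1 ne *.
    have zlt : (z < Q.1 x)%N by rewrite ltn_neqAle le1 andbT.
    have fz : Q'.1 z = x by rewrite /z fK'.
    have zc : (Q.1 z < z)%N by rewrite egt fz.
    have wx : (x < Q.1 z)%N.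
      rewrite ltnNge; apply/negP => wx.
      have wx' : (Q.1 z < x)%N.
        rewrite ltn_neqAle wx andbT; apply/eqP => /val_inj e.
        by move: zlt; rewrite -e fK ltnn.
      by have := nc (Q.1 z) x wx'; rewrite fK => /(_ xlt'); rewrite leqNgt zlt.
    have : Q'.1 (Q.1 z) = Q.1 (Q.1 z).
      by apply: IHm; rewrite fK //; lia.
    by rewrite fK => e; have := fK' (Q.1 z); rewrite e fz => e2; move: wx; rewrite e2 ltnn.
  have ylt : (y < Q.1 x)%N by [].
  have yo : (y < Q.1 y)%N by rewrite elt fy.
  have fyx := nc x y xy ylt.
  have fyne : Q.1 y != Q.1 x by apply/eqP => /(inv_inj fK) e; move: xy; rewrite e ltnn.
  have : Q'.1 y = Q.1 y.
    by apply: IHm => //; lia.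
  by rewrite fy => e; rewrite e eqxx in fyne.
have eT2 : Q.2 = Q'.2 by apply/setP.
suff e1 : Q.1 = Q'.1 by apply: matching_eq.
apply/ffunP => x.
case: (ltngtP x (Q.1 x)) => [xf|fx|/val_inj e].
- by rewrite (main _ _ (leqnn _)).
- have := main _ (Q.1 x) (leqnn _); rewrite fK => /(_ fx) e.
  by rewrite -{2}e fK'.
- apply: val_inj => /=; move: (elt x) (egt x); rewrite -e ltnn; lia.
Qed.

End Matchings.

(** * Operations on matchings that describe the action of F_i *)

Section Moves.
Variables (n : nat) (i : 'I_n.-1).
Implicit Types (Q : matching n) (x y : 'I_n).
Local Notation a := (low i).
Local Notation b := (high i).
Local Notation s := (tperm (low i) (high i)).

Definition cupm Q : matching n :=
  ([ffun x => if x == a then b else if x == b then a else Q.1 x], Q.2 :\ a).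

Definition movem Q : matching n := ([ffun x => s (Q.1 (s x))], sw i Q.2).

Definition capm Q : matching n :=
  ([ffun x => if (x == a) || (x == b) then x else
              if Q.1 x == a then Q.1 b else if Q.1 x == b then Q.1 a else Q.1 x],
   b |: Q.2).

Lemma cupm_valid Q : valid Q -> Q.1 a = a -> Q.1 b = b -> b \notin Q.2 -> valid (cupm Q).
Proof.
move=> /validP[fK nc hT] fa fb bT; have ba := high_neq_low i.
have ne x : x != a -> Q.1 x != a by move=> xa; rewrite -fa (inj_eq (inv_inj fK)).
have neb x : x != b -> Q.1 x != b by move=> xb; rewrite -fb (inj_eq (inv_inj fK)).
apply/validP; split=> [x|x y|x] /=.
- rewrite !ffunE; case: (eqVneq x a) => [->|xa]; first by rewrite ba eqxx.
  case: (eqVneq x b) => [->|xb]; first by rewrite eqxx.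
  by rewrite (negPf (ne _ xa)) (negPf (neb _ xb)) fK.
- rewrite !ffunE; case: (eqVneq x a) => [->|xa] /=; first by lia.
  case: (eqVneq x b) => [->|xb] /=; first by lia.
  have n1 : Q.1 x != a :> nat by apply: (ne _ xa).
  have n2 : Q.1 x != b :> nat by apply: (neb _ xb).
  move=> xy yx.
  case: (eqVneq y a) => [e|ya] /=; first by move: xy yx n1 n2; rewrite e /=; lia.
  case: (eqVneq y b) => [e|yb] /=; first by move: xy yx n1 n2; rewrite e /=; lia.
  exact: nc.
- rewrite !inE !ffunE => /andP[/negPf -> xT].
  by case: eqP => [e|_]; [rewrite e (negPf bT) in xT | apply: hT].
Qed.

(** One of a, b is a fixed point z of the new involution. Strand ends avoid z, and off z the
    transposition is increasing, so a crossing would come from a crossing of Q. *)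
Lemma movem_valid Q : valid Q -> Q.1 a = a \/ Q.1 b = b -> valid (movem Q).
Proof.
move=> /validP[fK nc hT] fab.
set g := (movem Q).1.
have gK : involutive g by move=> x; rewrite !ffunE tpermK fK tpermK.
have fixg z : g z = z -> forall x, g x != x -> x != z /\ g x != z.
  move=> ez x gx; have xz : x != z by apply: contraNneq gx => ->; apply/eqP.
  by split=> //; apply: contraNneq xz => e; apply/eqP/(inv_inj gK); rewrite e ez.
apply/validP; split=> [//|x y|x]; rewrite -/g.
- move=> xy yx; have [z [ez zab]] : exists z, g z = z /\ (z = a \/ z = b).
    by case: fab => e; [exists b | exists a]; rewrite ffunE ?tpermL ?tpermR e ?tpermL ?tpermR;
      split; auto.
  rewrite leqNgt; apply/negP => gxy.
  have [nx ngx] : x != z /\ g x != z.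
    by apply: fixg => //; rewrite -val_eqE /=; lia.
  have [ny ngy] : y != z /\ g y != z.
    by apply: fixg => //; rewrite -val_eqE /=; lia.
  have hx : Q.1 (s x) = s (g x) by rewrite ffunE tpermK.
  have hy : Q.1 (s y) = s (g y) by rewrite ffunE tpermK.
  have := nc (s x) (s y); rewrite hx hy => /(_ (tperm_ltn zab nx ny xy)).
  move=> /(_ (tperm_ltn zab ny ngx yx)); rewrite leqNgt => /negP; apply.
  exact: tperm_ltn zab ngx ngy gxy.
- by rewrite inE ffunE => /hT ->; rewrite tpermK.
Qed.

Lemma inside_mate Q (z p : 'I_n) : valid Q -> (z < p < Q.1 z)%N -> (z < Q.1 p < Q.1 z)%N.
Proof.
move=> /validP[fK nc _] /andP[zp pZ]; have fI := inv_inj fK.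
have ne : Q.1 p != Q.1 z.
  by apply/eqP => /fI e; move: zp; rewrite e ltnn.
have ne' : Q.1 p != z by apply/eqP => e; move: pZ; rewrite -e fK ltnn.
rewrite (ltn_neqAle (Q.1 p)) nc // andbT ne andbT ltnNge; apply/negP => le_pz.
have lt_pz : (Q.1 p < z)%N by rewrite ltn_neqAle le_pz andbT.
by have := nc _ _ lt_pz; rewrite fK => /(_ zp); rewrite leqNgt pZ.
Qed.

Lemma capm_valid Q : valid Q -> Q.1 a != a -> Q.1 b != b -> valid (capm Q).
Proof.
move=> vQ; have /validP[fK nc hT] := vQ; move=> fa fb; have ba := high_neq_low i.
have fI := inv_inj fK.
set g := (capm Q).1.
(* The four kinds of points: a and b themselves, the mate of a, the mate of b, and the ends of
   ordinary strands. *)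
have gval x : [\/ (x = a \/ x = b) /\ g x = x,
    [/\ x != a, x != b, Q.1 x = a & g x = Q.1 b],
    [/\ x != a, x != b, Q.1 x = b & g x = Q.1 a] |
    [/\ [/\ x != a, x != b, Q.1 x != a & Q.1 x != b], g x = Q.1 x, x != Q.1 a & x != Q.1 b]].
  rewrite /g ffunE; case: (eqVneq x a) => [->|xa] /=; first by constructor 1; auto.
  case: (eqVneq x b) => [->|xb] /=; first by constructor 1; auto.
  case: (eqVneq (Q.1 x) a) => [e|e]; first by constructor 2.
  case: (eqVneq (Q.1 x) b) => [e'|e']; first by constructor 3.
  constructor 4; split=> //.
    by apply: contra e => /eqP ->; rewrite fK.
  by apply: contra e' => /eqP ->; rewrite fK.
apply/validP; split.
- move=> x; case: (gval x) => [[_ e]|[xa xb e1 e2]|[xa xb e1 e2]|[[xa xb e1 e2] e3 e4 e5]].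
  + by rewrite /g !e.
  + rewrite -/g e2 /g ffunE fK (negPf fb) orbF ba eqxx.
    case: eqP => [e|_]; last by rewrite -e1 fK.
    by move: xb; rewrite -(inj_eq fI) e1 e eqxx.
  + rewrite -/g e2 /g ffunE fK eqxx (negPf fa) /=.
    case: eqP => [e|_]; last by rewrite -e1 fK.
    by move: xa; rewrite -(inj_eq fI) e1 e eqxx.
  + rewrite -/g e3 /g ffunE fK (negPf e1) (negPf e2) (negPf xa) (negPf xb) //.
- move=> x y; rewrite -/g => xy yx; rewrite leqNgt; apply/negP => gxy.
  have ex : g x != x by rewrite neq_ltn (ltn_trans xy yx) orbT.
  have ey : g y != y by rewrite neq_ltn (ltn_trans yx gxy) orbT.
  (* an ordinary strand separates neither a from b, nor, being noncrossing,
     their mates *)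
  have oth z : [/\ [/\ z != a, z != b, Q.1 z != a & Q.1 z != b], g z = Q.1 z, z != Q.1 a & z !=
    Q.1 b] ->
      (z < Q.1 a < Q.1 z)%N = (z < Q.1 b < Q.1 z)%N.
    move=> [[z1 z2 z3 z4] _ _ _].
    have mateE (p : 'I_n) : (z < Q.1 p < Q.1 z)%N = (z < p < Q.1 z)%N.
      by apply/idP/idP => /(inside_mate vQ) //; rewrite fK.
    rewrite !mateE; have eb : b = a.+1 :> nat by [].
    have {}z1 : z != a :> nat by []. have {}z2 : z != b :> nat by [].
    have {}z3 : Q.1 z != a :> nat by []. have {}z4 : Q.1 z != b :> nat by [].
    move: (nat_of_ord (Q.1 z)) (nat_of_ord z) (nat_of_ord a) (nat_of_ord b) eb z1 z2 z3 z4.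
    by clear; lia.
  case: (gval x) => [[_ e]|[xa xb e1 e2]|[xa xb e1 e2]|ox]; first by rewrite e eqxx in ex.
  + have exc : x = Q.1 a by rewrite -e1 fK.
    case: (gval y) => [[_ e]|[ya yb e3 e4]|[ya yb e3 e4]|oy]; first by rewrite e eqxx in ey.
    * by move: xy; rewrite exc -e3 fK ltnn.
    * by move: yx; rewrite e2 -e3 fK ltnn.
    have := oth y oy; case: oy => _ gy _ _; rewrite -exc -e2 -gy yx gxy.
    by rewrite (ltnNge y x) (ltnW xy).
  + have exc : x = Q.1 b by rewrite -e1 fK.
    case: (gval y) => [[_ e]|[ya yb e3 e4]|[ya yb e3 e4]|oy]; first by rewrite e eqxx in ey.
    * by move: yx; rewrite e2 -e3 fK ltnn.
    * by move: xy; rewrite exc -e3 fK ltnn.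
    have := oth y oy; case: oy => _ gy _ _; rewrite -exc -e2 -gy yx gxy.
    by rewrite (ltnNge y x) (ltnW xy).
  have := oth x ox; have [_ gx _ _] := ox; rewrite -gx.
  case: (gval y) => [[_ e]|[ya yb e3 e4]|[ya yb e3 e4]|[_ gy _ _]]; first by rewrite e eqxx in ey.
  + by rewrite -e3 fK -e4 xy yx /= (ltnNge (g y)) (ltnW gxy) andbF.
  + by rewrite -e3 fK -e4 xy yx /= (ltnNge (g y)) (ltnW gxy) andbF.
  by move=> _; have := nc x y xy; rewrite -gx -gy => /(_ yx); rewrite leqNgt gxy.
- move=> x; rewrite -/g !inE => /orP[/eqP ->|xT].
    by rewrite /g ffunE eqxx orbT.
  rewrite /g ffunE hT //; case: (eqVneq x a) => //= xa; by case: (eqVneq x b).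
Qed.

End Moves.

(** * The vectors attached to matchings *)

Section Coef.
Variables (n : nat) (R : comNzRingType) (u : R).
Implicit Types (Q : matching n) (p : {set 'I_n} * {set 'I_n}) (x : 'I_n).

(** A strand is tested at both ends but carries its power of u at the left end only, so that the
    coefficient is a plain product over the points. *)
Definition loc Q p x : R :=
  if Q.1 x == x then (((x \in p.1) == (x \in Q.2)) && ((x \in p.2) == (x \in Q.2)))%:R
  else (((x \in p.1) != (x \in p.2)) && ((x \in p.1) != (Q.1 x \in p.1)))%:R *
       (if (x < Q.1 x)%N && (x \in p.2) then u else 1).

(* The coefficient of e_I (x) e_J in the basis vector attached to Q: zero
   unless (I, J) is compatible with Q, and otherwise u to the number of strands
   whose left end is in J. *)
Definition bcoef Q p : R := \prod_x loc Q p x.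

Lemma bcoef_eq0 Q p x : loc Q p x = 0 -> bcoef Q p = 0.
Proof. by rewrite /bcoef (bigD1 x) //= => ->; rewrite mul0r. Qed.

Lemma bcoef_split (s : seq 'I_n) Q p : uniq s ->
  bcoef Q p = \prod_(x <- s) loc Q p x * \prod_(x | x \notin s) loc Q p x.
Proof.
by move=> us; rewrite /bcoef (bigID (mem s)) /= big_uniq.
Qed.

End Coef.

Lemma rmorph_bcoef n (R S : comNzRingType) (f : {rmorphism R -> S}) u (Q : matching n) p :
  f (bcoef u Q p) = bcoef (f u) Q p.
Proof.
rewrite rmorph_prod; apply: eq_bigr => x _; rewrite /loc; case: ifP => _.
  by rewrite rmorph_nat.
by rewrite rmorphM rmorph_nat; case: ifP => _; rewrite ?rmorph1.
Qed.

(** At u = 0 a compatible pair survives only if no left end is in J, that is, if every left end is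
    in I. *)
Lemma bcoef_lead n (Q : matching n) p : valid Q ->
  bcoef (0 : rat) Q p = (p == lead Q)%:R.
Proof.
move=> vQ; have [fK nc hT] := validP _ vQ; case: eqP => [->|ne].
  rewrite /bcoef big1 // => x _; rewrite /loc /=.
  have [fx|fx] := eqVneq (Q.1 x) x.
    by rewrite !(lead_fixed vQ fx) eqxx.
  have ffx : Q.1 (Q.1 x) != Q.1 x by rewrite fK eq_sym.
  rewrite !(lead_matched vQ fx) (lead_matched vQ ffx).1 fK.
  by case: (ltngtP x (Q.1 x)) => [||/val_inj e] /=; rewrite ?mulr1 // -e eqxx in fx.
rewrite /= mulr0n; apply/eqP; apply: contra_notT ne => /prodf_neq0 h0.
have {h0}h x : loc (0 : rat) Q p x != 0 by apply: h0.
case: p h => I J h; congr pair; apply/setP => x; have := h x; rewrite /loc /=.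
  have [fx|fx] := eqVneq (Q.1 x) x.
    by rewrite (lead_fixed vQ fx); case: (x \in I); case: (x \in J); case: (x \in Q.2);
      rewrite /= ?eqxx.
  have ffx : Q.1 (Q.1 x) != Q.1 x by rewrite fK eq_sym.
  have := h (Q.1 x); rewrite /loc /= fK [x == _]eq_sym (negPf fx) (lead_matched vQ fx).
  case: (ltngtP x (Q.1 x)) => [||/val_inj e] /=; last by rewrite -e eqxx in fx.
    by case: (x \in I); case: (x \in J); case: (_ \in I); case: (_ \in J);
      rewrite /= ?mulr0 ?mul0r ?eqxx.
  by case: (x \in I); case: (x \in J); case: (_ \in I); case: (_ \in J);
    rewrite /= ?mulr0 ?mul0r ?eqxx.
have [fx|fx] := eqVneq (Q.1 x) x.
  by rewrite (lead_fixed vQ fx); case: (x \in I); case: (x \in J); case: (x \in Q.2);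
    rewrite /= ?eqxx.
have := h (Q.1 x); rewrite /loc /= fK [x == _]eq_sym (negPf fx) (lead_matched vQ fx).
case: (ltngtP x (Q.1 x)) => [||/val_inj e] /=; last by rewrite -e eqxx in fx.
  by case: (x \in I); case: (x \in J); case: (_ \in I); case: (_ \in J);
    rewrite /= ?mulr0 ?mul0r ?eqxx.
by case: (x \in I); case: (x \in J); case: (_ \in I); case: (_ \in J);
  rewrite /= ?mulr0 ?mul0r ?eqxx.
Qed.

Definition bvec n (F : fieldType) (u : F) (Q : matching n) : tensor n F :=
  [ffun p => bcoef u Q p : F].

Section Action.
Variables (n : nat) (F : fieldType) (u : F) (i : 'I_n.-1).
Hypothesis u0 : u != 0.
Implicit Types (Q : matching n) (I J : {set 'I_n}) (x : 'I_n).
Local Notation a := (low i).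
Local Notation b := (high i).

(** In every term a belongs to neither index, or b belongs to both, so that there is nothing to
    lower. *)
Lemma tF_bvec_eq0 Q : (Q.1 a = a /\ a \notin Q.2) \/ (Q.1 b = b /\ b \in Q.2) ->
  tF u i (bvec u Q) = 0.
Proof.
move=> h; apply/ffunP => -[I J]; rewrite !ffunE /=.
have z1 : isd i J -> bcoef u Q (I, sw i J) = 0.
  move=> /andP[aJ bJ]; case: h => -[e eT].
    by apply: (@bcoef_eq0 _ _ _ _ _ a); rewrite /loc e eqxx /= low_in_sw bJ (negPf eT) andbF.
  by apply: (@bcoef_eq0 _ _ _ _ _ b); rewrite /loc e eqxx /= high_in_sw eT (negPf aJ) andbF.
have z2 : isd i I -> bcoef u Q (sw i I, J) = 0.
  move=> /andP[aI bI]; case: h => -[e eT].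
    by apply: (@bcoef_eq0 _ _ _ _ _ a); rewrite /loc e eqxx /= low_in_sw bI (negPf eT).
  by apply: (@bcoef_eq0 _ _ _ _ _ b); rewrite /loc e eqxx /= high_in_sw eT (negPf aI).
have -> : (isd i J)%:R * bcoef u Q (I, sw i J) = 0.
  by case dJ: (isd i J); rewrite ?mul0r // z1 ?mulr0.
by case dI: (isd i I); rewrite ?mul0r ?addr0 // z2 ?mulr0 ?addr0.
Qed.

(* Only the factors at a, b and their mates change. *)
Lemma tF_bvec_local (s : seq 'I_n) Q Q' (c : F) :
  uniq s -> a \in s -> b \in s ->
  (forall x, x \notin s -> [/\ Q.1 x \notin s, Q'.1 x = Q.1 x & (x \in Q'.2) = (x \in Q.2)]) ->
  (forall I J,
    (isd i J)%:R * \prod_(x <- s) loc u Q (I, sw i J) x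
    + (isd i I)%:R * kap u i J * \prod_(x <- s) loc u Q (sw i I, J) x
    = c * \prod_(x <- s) loc u Q' (I, J) x) ->
  tF u i (bvec u Q) = c *: bvec u Q'.
Proof.
move=> us sa sb out hloc; apply/ffunP => -[I J]; rewrite !ffunE /GRing.scale /=.
rewrite !(bcoef_split _ _ _ us) [RHS]mulrA -hloc.
have ne x : x \notin s -> x != a /\ x != b.
  by move=> xs; split; apply: contraNneq xs => ->.
have e1 : \prod_(x | x \notin s) loc u Q (I, sw i J) x = \prod_(x | x \notin s) loc u Q' (I, J) x.
  apply: eq_bigr => x xs; have [fs f'x Tx] := out x xs; have [xa xb] := ne x xs.
  have [fa fb] := ne _ fs.
  by rewrite /loc f'x Tx /= !other_in_sw.
have e2 : \prod_(x | x \notin s) loc u Q (sw i I, J) x = \prod_(x | x \notin s) loc u Q' (I, J) x.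
  apply: eq_bigr => x xs; have [fs f'x Tx] := out x xs; have [xa xb] := ne x xs.
  have [fa fb] := ne _ fs.
  by rewrite /loc f'x Tx /= !other_in_sw.
by rewrite e1 e2; ring.
Qed.

Lemma tF_cup Q : valid Q -> Q.1 a = a -> Q.1 b = b -> a \in Q.2 -> b \notin Q.2 ->
  tF u i (bvec u Q) = bvec u (cupm i Q).
Proof.
move=> vQ fa fb aT bT; have [fK _ _] := validP _ vQ.
have ab := low_neq_high i; have ba := high_neq_low i.
rewrite -[RHS]scale1r; apply: (@tF_bvec_local [:: a; b]).
- by rewrite /= inE ab.
- by rewrite inE eqxx.
- by rewrite !inE eqxx orbT.
- move=> x; rewrite !inE negb_or => /andP[xa xb]; rewrite ffunE (negPf xa) (negPf xb) /=;
  split=> //.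
  by rewrite -{1}fa -{1}fb !(inj_eq (inv_inj fK)) (negPf xa) (negPf xb).
move=> I J; rewrite !big_cons !big_nil /loc /= !ffunE fa fb !eqxx ba !low_in_sw !high_in_sw.
rewrite ?(inE, ab, ba, aT, negPf bT, eqxx) /= ltnSn ltnNge leqnSn /kap /isu /isd.
by case: (a \in I); case: (b \in I); case: (a \in J); case: (b \in J); rewrite /=; field.
Qed.

(** Both terms of the strand (a, b) end with b in I and J. The term with a in J has coefficient u
    and is lowered on the right; the one with a in I is lowered on the left and receives u^-1 from K
    on J. The sum is the value of a closed loop. *)
Lemma tF_capE Q : valid Q -> Q.1 a = b ->
  tF u i (bvec u Q) = (u + u^-1) *: bvec u (capm i Q).
Proof.
move=> vQ fa; have [fK _ hT] := validP _ vQ.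
have fb : Q.1 b = a by rewrite -fa fK.
have ab := low_neq_high i; have ba := high_neq_low i.
have aT : (a \in Q.2) = false by apply/negP => /hT /eqP; rewrite fa ba.
apply: (@tF_bvec_local [:: a; b]).
- by rewrite /= inE ab.
- by rewrite inE eqxx.
- by rewrite !inE eqxx orbT.
- move=> x; rewrite !inE negb_or => /andP[xa xb]; rewrite ffunE (negPf xa) (negPf xb) /=.
  have fxa : Q.1 x != a by rewrite -fb (inj_eq (inv_inj fK)).
  have fxb : Q.1 x != b by rewrite -fa (inj_eq (inv_inj fK)).
  by rewrite (negPf fxa) (negPf fxb).
move=> I J; rewrite !big_cons !big_nil /loc /= !ffunE fa fb !eqxx ba !low_in_sw !high_in_sw.
rewrite ?(inE, ab, ba, aT, eqxx) /= ltnSn ltnNge leqnSn /kap /isu /isd.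
by case: (a \in I); case: (b \in I); case: (a \in J); case: (b \in J); rewrite /=; field.
Qed.

(** In every term exactly one factor can be lowered, and where K is involved it acts by 1. The order
    of the strand ends is unchanged, hence so is the power of u. *)
Lemma tF_move Q : valid Q ->
  (Q.1 a = a /\ a \in Q.2) /\ Q.1 b != b \/ Q.1 a != a /\ (Q.1 b = b /\ b \notin Q.2) ->
  tF u i (bvec u Q) = bvec u (movem i Q).
Proof.
move=> vQ; have [fK nc hT] := validP _ vQ; have fI := inv_inj fK.
have ab := low_neq_high i; have ba := high_neq_low i.
move=> [[[fa aT] fb]|[fa [fb bT]]]; rewrite -[RHS]scale1r.
- have bT : (b \in Q.2) = false by apply: contraNF fb => /hT ->.
  set c := Q.1 b in fb *.
  have fc : Q.1 c = b by rewrite /c fK.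
  have fbc : Q.1 b = c by [].
  have ca : (c == a) = false by rewrite -fa (inj_eq fI) ba.
  have ac : (a == c) = false by rewrite eq_sym.
  have cb : (c == b) = false by rewrite (negPf fb).
  have bc : (b == c) = false by rewrite eq_sym.
  apply: (@tF_bvec_local [:: a; b; c]).
  + by rewrite /= !inE ab ac bc.
  + by rewrite inE eqxx.
  + by rewrite !inE eqxx orbT.
  + move=> x; rewrite !inE !negb_or => /and3P[xa xb xc]; rewrite ffunE.
    have fxa : Q.1 x != a by rewrite -{1}fa (inj_eq fI).
    have fxb : Q.1 x != b by rewrite -{1}fc (inj_eq fI).
    have fxc : Q.1 x != c by rewrite (inj_eq fI).
    by rewrite fxa fxb fxc !tpermD // eq_sym.
  have tc : tperm a b c = c by rewrite tpermD // eq_sym ?ca ?cb.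
  have cT : (c \in Q.2) = false by apply: contraFF cb => /hT; rewrite fc => ->.
  move=> I J; rewrite !big_cons !big_nil /loc /= ?(ffunE, tpermL, tpermR, tc, fa, fbc, fc).
  rewrite !(@other_in_sw _ i c) ?ca ?cb // ?(low_in_sw, high_in_sw, aT, bT, ac, ca, bc, cb, ab,
    ba, eqxx) /=.

  have [o1 o2 o3] := ltn_low_high (negbT ca) (negbT cb).
  rewrite o1 o2 o3 /kap /isu /isd.
  case: (a \in I); case: (b \in I); case: (a \in J); case: (b \in J);
  rewrite /= ?(andbF, mul0r, mulr0, mul1r, mulr1, addr0, add0r) //;
by case: (b < c)%N; case: (c \in I); case: (c \in J);
  rewrite /= ?(mul0r, mulr0, mul1r, mulr1, addr0, add0r) //; ring.
have aT : (a \in Q.2) = false by apply: contraNF fa => /hT ->.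
set c := Q.1 a in fa *.
have fc : Q.1 c = a by rewrite /c fK.
have fac : Q.1 a = c by [].
have cb : (c == b) = false by rewrite -fb (inj_eq fI) ab.
have bc : (b == c) = false by rewrite eq_sym.
have ca : (c == a) = false by rewrite (negPf fa).
have ac : (a == c) = false by rewrite eq_sym.
apply: (@tF_bvec_local [:: a; b; c]).
+ by rewrite /= !inE ab ac bc.
+ by rewrite inE eqxx.
+ by rewrite !inE eqxx orbT.
+ move=> x; rewrite !inE !negb_or => /and3P[xa xb xc]; rewrite ffunE.
  have fxa : Q.1 x != a by rewrite -{1}fc (inj_eq fI).
  have fxb : Q.1 x != b by rewrite -{1}fb (inj_eq fI).
  have fxc : Q.1 x != c by rewrite (inj_eq fI).
  by rewrite fxa fxb fxc !tpermD // eq_sym.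
have tc : tperm a b c = c by rewrite tpermD // eq_sym ?ca ?cb.
move=> I J; rewrite !big_cons !big_nil /loc /= ?(ffunE, tpermL, tpermR, tc, fb, fac, fc).
rewrite !(@other_in_sw _ i c) ?ca ?cb // ?(low_in_sw, high_in_sw, aT, negPf bT, ac, ca, bc, cb,
  ab, ba, eqxx) /=.
have [o1 o2 o3] := ltn_low_high (negbT ca) (negbT cb).
rewrite o1 o2 o3 /kap /isu /isd.
case: (a \in I); case: (b \in I); case: (a \in J); case: (b \in J);
  rewrite /= ?(andbF, mul0r, mulr0, mul1r, mulr1, addr0, add0r) //;
by case: (b < c)%N; case: (c \in I); case: (c \in J);
  rewrite /= ?(mul0r, mulr0, mul1r, mulr1, addr0, add0r) //; ring.
Qed.

(** Any other order, such as Q b < a < b < Q a, makes the strands at a and b cross. *)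
Lemma mates_order Q : valid Q -> Q.1 a != a -> Q.1 b != b -> Q.1 a != b ->
  [\/ (Q.1 a < a)%N && (b < Q.1 b)%N, (Q.1 b < Q.1 a)%N && (Q.1 a < a)%N |
      (b < Q.1 b)%N && (Q.1 b < Q.1 a)%N].
Proof.
move=> vQ fa fb fab; have [fK nc _] := validP _ vQ.
have fI := inv_inj fK.
have fba : Q.1 b != a by apply: contraNneq fab => <-; rewrite fK.
have fne : Q.1 b != Q.1 a by rewrite (inj_eq fI) high_neq_low.
have nc1 := nc a b (ltnSn _); have nc2 := nc (Q.1 a) (Q.1 b).
have nc3 := nc (Q.1 b) a; rewrite !fK in nc2 nc3.
have [o1 o2 o3] := ltn_low_high fa fab; have [o4 o5 o6] := ltn_low_high fba fb.
have e1 : (Q.1 b < Q.1 a)%N = ~~ (Q.1 a < Q.1 b)%N.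
  by case: ltngtP => // /val_inj e; rewrite e eqxx in fne.
case c1 : (b < Q.1 a)%N in o1 o2 o3; case c2 : (b < Q.1 b)%N in o4 o5 o6.
- by constructor 3; rewrite c2 e1 -leqNgt nc1.
- have := nc3; rewrite o6 /= => /(_ isT (ltnSn _)); rewrite leqNgt c1 //.
- by constructor 1; rewrite o3 c2.
constructor 2; rewrite o3 e1 andbT; apply/negP => h.
by have := nc2 h; rewrite o6 => /(_ isT); rewrite leqNgt ltnSn.
Qed.

(** Only the terms with a and b in different factors survive, and then their mates are in different
    factors too, as the new strand requires. The terms with b in J receive u^-1 from K; these are
    exactly the terms in which the number of left ends in J falls by one, in each of the three
    orders. *)
Lemma tF_cap Q : valid Q -> Q.1 a != a -> Q.1 b != b -> Q.1 a != b ->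
  tF u i (bvec u Q) = bvec u (capm i Q).
Proof.
move=> vQ fa fb fab; have [fK nc hT] := validP _ vQ; have fI := inv_inj fK.
have ab := low_neq_high i; have ba := high_neq_low i.
have aT : (a \in Q.2) = false by apply: contraNF fa => /hT ->.
have bT : (b \in Q.2) = false by apply: contraNF fb => /hT ->.
have cT : (Q.1 a \in Q.2) = false by apply: contraNF fa => /hT; rewrite fK => <-.
have dT : (Q.1 b \in Q.2) = false by apply: contraNF fb => /hT; rewrite fK => <-.
have fca := fK a; have fdb := fK b.
have da : (Q.1 b == a) = false by apply/negP => /eqP e; rewrite -e fK eqxx in fab.
have dc : (Q.1 b == Q.1 a) = false by rewrite (inj_eq fI) ba.
have [c fac] : exists c, Q.1 a = c by exists (Q.1 a).
have [d fbd] : exists d, Q.1 b = d by exists (Q.1 b).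
have := mates_order vQ fa fb fab; rewrite !fac !fbd => order;
  rewrite ?fac ?fbd in fa fb fab cT dT fca fdb da dc.
move/negPf: fa => ca; move/negPf: fb => db; move/negPf: fab => cb.
have [ac bd bc ad cd] : [/\ (a == c) = false, (b == d) = false, (b == c) = false, (a == d) =
  false & (c == d) = false].
  by rewrite (eq_sym a c) (eq_sym b d) (eq_sym b c) (eq_sym a d) (eq_sym c d) ca cb da db dc.
rewrite -[RHS]scale1r; apply: (@tF_bvec_local [:: a; b; c; d]).
- by rewrite /= !inE ab ac ad bc bd cd.
- by rewrite inE eqxx.
- by rewrite !inE eqxx orbT.
- move=> x; rewrite !inE !negb_or => /and4P[xa xb xc xd]; rewrite ffunE (negPf xa) (negPf xb) /=.
  have fxa : Q.1 x != a by rewrite -fca (inj_eq fI).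
  have fxb : Q.1 x != b by rewrite -fdb (inj_eq fI).
  have fxc : Q.1 x != c by rewrite -fac (inj_eq fI).
  have fxd : Q.1 x != d by rewrite -fbd (inj_eq fI).
  by rewrite fxa fxb fxc fxd (negPf fxa) (negPf fxb).
move=> I J; rewrite !big_cons !big_nil /loc /= ?(ffunE, fac, fbd, fca, fdb, eqxx, ab, ba, ca, cb,
  da, db) /=.
rewrite !(@other_in_sw _ i c) ?ca ?cb // !(@other_in_sw _ i d) ?da ?db //.
rewrite ?(low_in_sw, high_in_sw, inE, aT, bT, cT, dT, ac, ca, bc, cb, ab, ba, ad, da, bd, db, cd,
  dc, eqxx) /=.
have [o1 o2 o3] := ltn_low_high (negbT ca) (negbT cb).
have [o4 o5 o6] := ltn_low_high (negbT da) (negbT db).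
have e1 : (c < d)%N = ~~ (d < c)%N.
  by case: ltngtP => // /val_inj e; rewrite e eqxx in cd.
have lt_ab : (a < b)%N by [].
have order' : [\/ [/\ (b < c)%N = false, (b < d)%N = true & (d < c)%N = false],
   [/\ (b < c)%N = false, (b < d)%N = false & (d < c)%N = true] |
   [/\ (b < c)%N = true, (b < d)%N = true & (d < c)%N = true]].
  case: order => /andP[h1 h2].
  - constructor 1; split=> //; first by move: o3; rewrite h1 => /esym/negbTE.
    by apply/negbTE; rewrite -e1 (ltn_trans h1) // (ltn_trans lt_ab).
  - constructor 2; split=> //; first by move: o3; rewrite h2 => /esym/negbTE.
    by move: o6; rewrite (ltn_trans h1 h2) => /esym/negbTE.
  by constructor 3; split=> //; apply: ltn_trans h2.
rewrite ?(o1, o2, o3, o4, o5, o6, e1) /kap /isu /isd.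
case: (a \in I); case: (b \in I); case: (a \in J); case: (b \in J);
  rewrite /= ?(andbF, mul0r, mulr0, mul1r, mulr1, addr0, add0r) //;
case: (c \in I); case: (c \in J); case: (d \in I); case: (d \in J);
  rewrite /= ?(andbF, andbT, mul0r, mulr0, mul1r, mulr1, addr0, add0r) //;
by case: order' => -[-> -> ->]; rewrite /= ?(mul0r, mulr0, mul1r, mulr1, addr0, add0r) //; field.
Qed.

End Action.

(* c plays the role of the factorials [a]!, of which only the values for
   a <= 2 matter, since F_i^3 = 0 on the tensor square. *)
Definition qfactorials (F : fieldType) (u : F) (c : nat -> F) :=
  [/\ c 0%N = 1, c 1%N = 1, c 2%N = u + u^-1 & forall a, c a != 0].

(** * Words in divided powers, uniformly in the field and the parameter *)

Section Words.
Variable n : nat.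
Implicit Types (Q : matching n) (i : 'I_n.-1).

(** The matching, the bit e (zero or not) and the exponent r are chosen before the field and u; this
    uniformity later carries identities from Q(q) to u = 1. The scalar is a power of [2], hence
    invariant under u -> u^-1. *)
Lemma divided_power_bvec Q i m : valid Q -> exists Q' (e : bool) (r : nat), valid Q' /\
  forall (F : fieldType) (u : F) (c : nat -> F), u != 0 -> qfactorials u c ->
  (c m)^-1 *: iter m (tF u i) (bvec u Q) = (e%:R * (u + u^-1) ^+ r) *: bvec u Q'.
Proof.
move=> vQ; have [fK nc hT] := validP _ vQ; have fI := inv_inj fK.
have ab := low_neq_high i; have ba := high_neq_low i.
case: m => [|m].
  exists Q, true, 0%N; split=> // F u c u0 [c0 _ _ _] /=.
  by rewrite c0 invr1 mulr1.
have zero : (forall (F : fieldType) (u : F), u != 0 -> tF u i (bvec u Q) = 0) ->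
   exists Q' (e : bool) (r : nat), valid Q' /\
   forall (F : fieldType) (u : F) (c : nat -> F), u != 0 -> qfactorials u c ->
   (c m.+1)^-1 *: iter m.+1 (tF u i) (bvec u Q) = (e%:R * (u + u^-1) ^+ r) *: bvec u Q'.
  move=> h; exists Q, false, 0%N; split=> // F u c u0 _.
  rewrite iterSr h // mul0r scale0r; have -> : iter m (tF u i) 0 = 0.
    by elim: m => //= m ->; rewrite linear0.
  by rewrite scaler0.
have once (Q' : matching n) r : valid Q' ->
    (forall (F : fieldType) (u : F), u != 0 -> tF u i (bvec u Q) = (u + u^-1) ^+ r *: bvec u Q') ->
    (forall (F : fieldType) (u : F), u != 0 -> tF u i (bvec u Q') = 0) ->
   exists Q' (e : bool) (r : nat), valid Q' /\
   forall (F : fieldType) (u : F) (c : nat -> F), u != 0 -> qfactorials u c ->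
   (c m.+1)^-1 *: iter m.+1 (tF u i) (bvec u Q) = (e%:R * (u + u^-1) ^+ r) *: bvec u Q'.
  move=> vQ' h h'; case: (m) => [|m'].
    exists Q', true, r; split=> // F u c u0 [_ c1 _ _].
    by rewrite /= h // c1 invr1 scale1r mul1r.
  exists Q', false, 0%N; split=> // F u c u0 _.
  rewrite !iterSr h // linearZ /= h' // scaler0 mul0r scale0r.
  have -> : iter m' (tF u i) 0 = 0 by elim: m' => //= m' ->; rewrite linear0.
  by rewrite scaler0.
have [fa|fa] := eqVneq (Q.1 (low i)) (low i); have [fb|fb] := eqVneq (Q.1 (high i)) (high i).
- case aT: (low i \in Q.2); last first.
    by apply: zero => F u u0; apply: tF_bvec_eq0; left; rewrite aT.
  case bT: (high i \in Q.2).
    by apply: zero => F u u0; apply: tF_bvec_eq0; right.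
  have vc := cupm_valid vQ fa fb (negbT bT).
  have fa' : (cupm i Q).1 (low i) = high i by rewrite ffunE eqxx.
  have fb' : (cupm i Q).1 (high i) = low i by rewrite ffunE ba eqxx.
  have vcc : valid (capm i (cupm i Q)) by apply: capm_valid; rewrite // ?fa' ?fb' ?ab ?ba.
  case: (m) => [|[|m']].
  + exists (cupm i Q), true, 0%N; split=> // F u c u0 [_ c1 _ _].
    by rewrite /= c1 invr1 mul1r expr0 !scale1r tF_cup ?bT.
  (* The second application of F_i closes the strand just created; its loop value u + u^-1 cancels
     against the factorial c 2. *)
  + exists (capm i (cupm i Q)), true, 0%N; split=> // F u c u0 [_ _ c2 cn].
    rewrite /= tF_cup ?bT // tF_capE // c2 scalerA mulVf ?mul1r ?expr0 //.
    by rewrite -c2 cn.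
  + exists Q, false, 0%N; split=> // F u c u0 _.
    by rewrite /= tF_cube mul0r scale0r scaler0.
- have bT : (high i \in Q.2) = false by apply: contraNF fb => /hT ->.
  case aT: (low i \in Q.2); last first.
    by apply: zero => F u u0; apply: tF_bvec_eq0; left; rewrite aT.
  apply: (@once (movem i Q) 0%N) => [|F u u0|F u u0].
  + by apply: movem_valid; auto.
  + by rewrite scale1r tF_move //; left.
  + by apply: tF_bvec_eq0; right; rewrite ffunE tpermR fa tpermL high_in_sw aT.
- case bT: (high i \in Q.2).
    by apply: zero => F u u0; apply: tF_bvec_eq0; right.
  apply: (@once (movem i Q) 0%N) => [|F u u0|F u u0].
  + by apply: movem_valid; auto.
  + by rewrite scale1r tF_move // bT; right.
  + by apply: tF_bvec_eq0; left; rewrite ffunE tpermL fb tpermR low_in_sw bT.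
have aT : (low i \in Q.2) = false by apply: contraNF fa => /hT ->.
have [e|fab] := eqVneq (Q.1 (low i)) (high i).
  apply: (@once (capm i Q) 1%N) => [|F u u0|F u u0].
  + exact: capm_valid.
  + by rewrite expr1 tF_capE.
  + by apply: tF_bvec_eq0; left; rewrite ffunE eqxx !inE ab aT.
apply: (@once (capm i Q) 0%N) => [|F u u0|F u u0].
+ exact: capm_valid.
+ by rewrite scale1r tF_cap.
+ by apply: tF_bvec_eq0; left; rewrite ffunE eqxx !inE ab aT.
Qed.

Definition vac_matching k : matching n := ([ffun x => x], top_set k n).

Lemma vac_matching_valid k : valid (vac_matching k).
Proof.
by apply/validP; split=> [x|x y|x _]; rewrite !ffunE //; move=> xy yx; lia.
Qed.

Lemma lead_vac k : lead (vac_matching k) = (top_set k n, top_set k n).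
Proof. by congr pair; apply/setP => x; rewrite !inE !ffunE ltnn orbF. Qed.

Lemma bvec_vac k (F : fieldType) (u : F) : bvec u (vac_matching k) = tvac k n F.
Proof.
apply/ffunP => -[I J]; rewrite !ffunE xpair_eqE.
have lE x : loc u (vac_matching k) (I, J) x =
    (((x \in I) == (x \in top_set k n)) && ((x \in J) == (x \in top_set k n)))%:R.
  by rewrite /loc /= ffunE eqxx.
case: eqP => [->|/eqP neI] /=; last first.
  have [x /negPf h] : exists x, (x \in I) != (x \in top_set k n).
    by apply/existsP; apply: contraNT neI; rewrite negb_exists => /forallP h;
       apply/eqP/setP => x; apply/eqP; rewrite -[_ == _]negbK.
  by apply: (@bcoef_eq0 _ _ _ _ _ x); rewrite lE h.
case: eqP => [eJ|/eqP neJ] /=; last first.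
  have [x /negPf h] : exists x, (x \in J) != (x \in top_set k n).
    by apply/existsP; apply: contraNT neJ; rewrite negb_exists => /forallP h;
       apply/eqP/setP => x; apply/eqP; rewrite -[_ == _]negbK.
  by apply: (@bcoef_eq0 _ _ _ _ _ x); rewrite /loc /= ffunE eqxx h andbF.
by rewrite /bcoef big1 // => x _; rewrite /loc /= ffunE eqxx eJ !eqxx.
Qed.

Definition tword k (F : fieldType) (u : F) (c : nat -> F) (w : seq ('I_n.-1 * nat)) :=
  foldr (fun ia x => (c ia.2)^-1 *: iter ia.2 (tF u ia.1) x) (tvac k n F) w.

Lemma tword_bvec k w : exists Q (e : bool) (r : nat), valid Q /\
  forall (F : fieldType) (u : F) (c : nat -> F), u != 0 -> qfactorials u c ->
  tword k u c w = (e%:R * (u + u^-1) ^+ r) *: bvec u Q.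
Proof.
elim: w => [|[i m] w [Q [e [r [vQ hQ]]]]].
  exists (vac_matching k), true, 0%N; split=> [|F u c _ _]; first exact: vac_matching_valid.
  by rewrite mulr1 scale1r bvec_vac.
have [Q' [e' [r' [vQ' hQ']]]] := divided_power_bvec i m vQ.
exists Q', (e && e'), (r + r')%N; split=> // F u c u0 hc.
rewrite /= hQ //; have -> : forall a (x : tensor n F), iter m (tF u i) (a *: x) = a *: iter m (tF
  u i) x.
  by move=> a x; elim: m {hQ'} => //= m ->; rewrite linearZ.
rewrite scalerA [(c m)^-1 * _]mulrC -[LHS]scalerA (hQ' F u c u0 hc) scalerA; congr (_ *: _).
by rewrite -mulnb natrM exprD mulrACA.
Qed.

Definition ev (F : fieldType) (p : {poly int}) (z : F) : F := (map_poly intr p).[z].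

(** The point z at which the scalar coefficients are evaluated is kept apart from the parameter u of
    the module: z = q^-1 with u = q represents the bar conjugate. *)
Definition teval k (F : fieldType) (u : F) (c : nat -> F) (z : F) (s : integral_form n) :=
  \sum_(t <- s) (ev t.1.1 z / z ^+ t.1.2) *: tword k u c t.2.

(** The words contribute powers of u + u^-1 = z + z^-1, so the same integer polynomials D serve for
    z = u = q, for z = q^-1 with u = q, and for z = u = 1. *)
Lemma teval_bvec k (s : integral_form n) : exists (N : nat) (D : matching n -> {poly int}),
  forall (F : fieldType) (u z : F) (c : nat -> F), u != 0 -> z != 0 ->
  z + z^-1 = u + u^-1 -> qfactorials u c ->
  teval k u c z s = z ^- N *: \sum_(Q | valid Q) ev (D Q) z *: bvec u Q.
Proof.
elim: s => [|[[p m] w] s [N [D hD]]].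
  exists 0%N, (fun=> 0) => F u z c _ _ _ _; rewrite /teval big_nil big1 ?scaler0 // => Q _.
  by rewrite /ev rmorph0 horner0 scale0r.
have [Q0 [e [r [vQ0 hQ0]]]] := tword_bvec k w.
(* In the common denominator, m belongs to the new entry and r clears (z + z^-1)^r = (z^2 + 1)^r /
   z^r; the old and the new terms receive the complementary powers of 'X. *)
exists (N + (m + r))%N, (fun Q => D Q * 'X^(m + r) + (e && (Q == Q0))%:R * p * ('X^2 + 1) ^+ r *
  'X^N).
move=> F u z c u0 z0 zu hc.
rewrite /teval big_cons -/(teval k u c z s) hD // hQ0 //=.
have evE Q : ev (D Q * 'X^(m + r) + (e && (Q == Q0))%:R * p * ('X^2 + 1) ^+ r * 'X^N) z =
    ev (D Q) z * z ^+ (m + r) + (e && (Q == Q0))%:R * ev p z * (z ^+ 2 + 1) ^+ r * z ^+ N.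
  rewrite /ev !(rmorphD, rmorphM, rmorphXn, rmorph_nat, rmorph1) /= !map_polyX.
  by rewrite !(hornerD, hornerM, horner_exp, hornerX, hornerMn, hornerC).
under [in RHS]eq_bigr => Q _ do rewrite evE scalerDl.
rewrite big_split /= scalerDr addrC; congr (_ + _).
  rewrite exprD invfM -scalerA; congr (_ *: _); rewrite scaler_sumr; apply: eq_bigr => Q _.
  by rewrite scalerA mulrC mulfK // expf_neq0.
rewrite (bigD1 Q0) //= eqxx andbT big1 ?addr0; last first.
  by move=> Q /andP[_ /negPf ->]; rewrite andbF !mul0r scale0r.
rewrite !scalerA; congr (_ *: _).
have -> : z ^+ 2 + 1 = (u + u^-1) * z by rewrite -zu mulrDl mulVf.
rewrite exprMn !exprD; field.
by rewrite !expf_neq0.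
Qed.

End Words.

(** * The crystal lattice *)

Lemma qnumber2 (F : fieldType) (u : F) : u != 0 -> u - u^-1 != 0 ->
  (u ^+ 2 - u ^- 2) / (u - u^-1) = u + u^-1.
Proof.
by move=> u0 h; apply: (mulIf h); rewrite mulfVK // -exprVn subr_sqr mulrC.
Qed.

Lemma qint_neq0 a : (0 < a)%N -> qint a != 0.
Proof.
move=> a0; rewrite /qint; apply: (mulf_neq0 _ (invr_neq0 qq_sub_inv_neq0)).
rewrite subr_eq0; apply: contra (qqX_neq1 (_ : 0 < a + a)%N) => [/eqP e|]; last by lia.
by rewrite exprD {1}e mulVf // expf_neq0 ?qq_neq0.
Qed.

Lemma qfact_neq0 a : qfact a != 0.
Proof.
rewrite /qfact big_seq_cond; elim/big_rec: _ => [|j x]; first exact: oner_neq0.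
by rewrite mem_index_iota => /andP[/andP[j0 _] _] x0; apply: (mulf_neq0 (qint_neq0 j0) x0).
Qed.

Lemma qfactorials_qq : qfactorials qq qfact.
Proof.
have q1 : qint 1 = 1.
  by rewrite /qint expr1 (mulfV qq_sub_inv_neq0).
split; last exact: qfact_neq0.
- by rewrite /qfact big_nil.
- by rewrite /qfact big_nat1.
- rewrite /qfact big_nat_recr //= big_nat1 q1 mul1r.
  exact: (qnumber2 qq_neq0 qq_sub_inv_neq0).
Qed.

Lemma tf_ev (p : {poly int}) : tf (map_poly intr p) = ev p qq.
Proof.
rewrite /ev; elim/poly_ind: p => [|p c IHp]; first by rewrite !rmorph0 horner0.
rewrite !(rmorphD (map_poly _)) !(rmorphM (map_poly _)) /= !map_polyX !map_polyC /=.
rewrite hornerD hornerM hornerX hornerC -IHp (rmorphD tf) (rmorphM tf) /=.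
congr (_ + _); by rewrite -[c%:~R%:P]/(polyC c%:~R) rmorph_int [LHS]rmorph_int.
Qed.

Lemma bcoef_horner0 n (Q : matching n) p :
  (bcoef ('X : {poly rat}) Q p).[0] = bcoef 0 Q p.
Proof. by rewrite -[LHS]/(horner_eval 0 _) rmorph_bcoef /= /horner_eval hornerX. Qed.

Section Lattice.
Variable n : nat.
Implicit Types (i : 'I_n.-1) (x y z : tensor n Qq) (p : {set 'I_n} * {set 'I_n}).

Definition in_lattice x := forall p, regular_at0 (x p).

Lemma in_lattice0 : in_lattice 0.
Proof. by move=> p; rewrite ffunE; apply: regular_0. Qed.

Lemma in_latticeD x y : in_lattice x -> in_lattice y -> in_lattice (x + y).
Proof. by move=> hx hy p; rewrite ffunE; apply: regularD. Qed.

Lemma in_latticeZ a x : regular_at0 a -> in_lattice x -> in_lattice (a *: x).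
Proof. by move=> ha hx p; rewrite ffunE; apply: regularM. Qed.

Lemma in_lattice_tbasis p : in_lattice (tbasis Qq p).
Proof. by move=> r; rewrite ffunE; case: eqP => _; [apply: regular_1 | apply: regular_0]. Qed.

Lemma in_lattice_ft i x : in_lattice x -> in_lattice (ft qq i x).
Proof.
move=> hx p; rewrite ffunE; have rq := regular_qq.
case: ifP => _; case: ifP => _; [|case: ifP => _| |]; rewrite ?regular_0 //.
- by apply: regularM regular_inv_qq2; apply: regularD => //; apply: regularM.
- exact: regularM.
- exact: regular_0.
Qed.

Definition cong_mod_q x p := exists2 z, in_lattice z & x = tbasis Qq p + qq *: z.

Lemma cong_mod_q_bvec (Q : matching n) : valid Q -> cong_mod_q (bvec qq Q) (lead Q).
Proof.
move=> vQ; have /(_ _) h p : exists a, bcoef ('X : {poly rat}) Q p = (p == lead Q)%:R + a * 'X.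
  have : root (bcoef ('X : {poly rat}) Q p - (p == lead Q)%:R) 0.
    by rewrite rootE hornerD hornerN bcoef_horner0 bcoef_lead // -polyC_natr hornerC subrr.
  rewrite root_factor_theorem => /dvdpP[a]; rewrite subr0 => e; exists a.
  by rewrite -e addrC subrK.
have [a ha] := fin_all_exists h.
exists [ffun p => tf (a p) : Qq]; first by move=> p; rewrite ffunE; apply: regular_tf.
apply/ffunP => p; rewrite !ffunE /GRing.scale /= {1}/qq -(rmorph_bcoef tf) ha.
by rewrite (rmorphD tf) (rmorphM tf) (rmorph_nat tf) mulrC.
Qed.

(** Modulo q the vectors are distinct elements of the standard basis, by [lead_inj]. If a
    combination is divisible by q, its coordinate at [lead Q] therefore shows that the coefficient
    of Q is; this is repeated m times. *)
Lemma leading_divisible m (e : matching n -> {poly rat}) z : in_lattice z ->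
  \sum_(Q | valid Q) tf (e Q) *: bvec qq Q = qq ^+ m *: z ->
  forall Q, valid Q -> exists d, e Q = d * 'X^m.
Proof.
elim: m e z => [|m IHm] e z hz he Q vQ; first by exists (e Q); rewrite mulr1.
have {}IHm : forall Q, exists d, valid Q -> e Q = d * 'X^m.
  move=> Q'; case vQ': (valid Q'); last by exists 0.
  have [||d ->] := IHm e (qq *: z) _ _ _ vQ'; last by exists d.
    exact: (in_latticeZ regular_qq hz).
  by rewrite he exprSr scalerA.
have [d hd] := fin_all_exists IHm.
have hs : \sum_(Q | valid Q) tf (d Q) *: bvec qq Q = qq *: z.
  have qm : qq ^+ m != 0 := expf_neq0 m qq_neq0.
  apply: (scalerI qm); rewrite scaler_sumr scalerA -exprSr -he.
  apply: eq_bigr => Q' vQ'; rewrite (hd _ vQ') (rmorphM tf) (rmorphXn tf) scalerA mulrC //.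
have : (d Q).[0] = 0.
  have := congr1 (fun x : tensor n Qq => x (lead Q) : Qq) hs;
    rewrite sum_ffunE ffunE /GRing.scale /=.
  have -> : \sum_(Q0 | valid Q0) (tf (d Q0) *: bvec qq Q0) (lead Q) =
     tf (\sum_(Q0 | valid Q0) d Q0 * bcoef 'X Q0 (lead Q)).
    rewrite (rmorph_sum tf); apply: eq_bigr => Q0 _; rewrite !ffunE (rmorphM tf).
    by rewrite (rmorph_bcoef tf).
  move=> /tf_eq_qq_regular -/(_ (hz _)); rewrite horner_sum => h; rewrite -[RHS]h.
  rewrite (bigD1 Q) //= big1 ?addr0 => [|Q' /andP[vQ' QQ']].
    by rewrite hornerM bcoef_horner0 bcoef_lead // eqxx mulr1.
  rewrite hornerM bcoef_horner0 bcoef_lead //; case: eqP => [/(lead_inj vQ vQ') e0|];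
    last by rewrite mulr0.
  by rewrite e0 eqxx in QQ'.
move=> d0; have : root (d Q) 0 by rewrite rootE d0.
rewrite root_factor_theorem => /dvdpP[d']; rewrite subr0 => e'; exists d'.
by rewrite (hd _ vQ) e' exprS mulrA.
Qed.

(** After clearing denominators, 0 lies in q^m times the lattice for every m; taking for m the size
    of a coefficient forces that coefficient to be 0. *)
Lemma bvec_free (f : matching n -> Qq) : \sum_(Q | valid Q) f Q *: bvec qq Q = 0 ->
  forall Q, valid Q -> f Q = 0.
Proof.
have [d d0 [e he]] := Qq_common_denominator f.
have td0 : tf d != 0 by rewrite tofrac_eq0.
move=> sf Q vQ; apply: (mulIf td0); rewrite he mul0r; apply/eqP; rewrite tofrac_eq0.
apply: contraT => eQ.
have [] := @leading_divisible (size (e Q)) e 0 in_lattice0 _ Q vQ.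
  rewrite scaler0; transitivity (tf d *: \sum_(Q' | valid Q') f Q' *: bvec qq Q').
    by rewrite scaler_sumr; apply: eq_bigr => Q' _; rewrite scalerA -he mulrC.
  by rewrite sf scaler0.
move=> a ea; have a0 : a != 0 by apply: contraNneq eQ => a0; rewrite ea a0 mul0r.
have := congr1 (fun p : {poly rat} => size p) ea; rewrite /= size_mulXn //.
by move=> /eqP; rewrite -{1}[size _]addn0 eqn_add2l eq_sym size_poly_eq0 (negPf a0).
Qed.

End Lattice.

(** * Bar involution and global basis *)

Definition evr (r : {poly rat}) (z : Qq) : Qq := (map_poly (tf \o polyC) r).[z].

Lemma evrD r s z : evr (r + s) z = evr r z + evr s z.
Proof. by rewrite /evr rmorphD hornerD. Qed.

Lemma evrM r s z : evr (r * s) z = evr r z * evr s z.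
Proof. by rewrite /evr rmorphM hornerM. Qed.

Lemma evr_Xn m z : evr 'X^m z = z ^+ m.
Proof. by rewrite /evr map_polyXn hornerXn. Qed.

Lemma evr_nat m z : evr m%:R z = m%:R.
Proof. by rewrite /evr rmorph_nat -polyC_natr hornerC. Qed.

Lemma evr_qq r : evr r qq = tf r.
Proof.
rewrite /evr; elim/poly_ind: r => [|p c IHp]; first by rewrite !rmorph0 horner0.
rewrite !(rmorphD (map_poly _)) !(rmorphM (map_poly _)) /= !map_polyX !map_polyC /=.
by rewrite hornerD hornerM hornerX hornerC IHp (rmorphD tf) (rmorphM tf).
Qed.

Lemma ev_evr (p : {poly int}) z : ev p z = evr (map_poly intr p) z.
Proof.
rewrite /ev /evr -map_poly_comp; congr (_.[z]); apply: eq_map_poly => c /=.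
by rewrite rmorph_int [RHS]rmorph_int.
Qed.

(** The constant part c cancels, leaving q d = q^-1 d'. *)
Lemma bar_cancel (F : fieldType) (q c d d' : F) N : q != 0 ->
  q ^- N * (c * q ^+ N + d * q ^+ N.+1) = q^-1 ^- N * (c * q^-1 ^+ N + d' * q^-1 ^+ N.+1) ->
  q ^+ 2 * d = d'.
Proof.
move=> q0 e; have qN : q ^+ N != 0 by rewrite expf_neq0.
have e1 : q ^- N * (c * q ^+ N + d * q ^+ N.+1) = c + d * q.
  by rewrite exprS; field.
have e2 : q^-1 ^- N * (c * q^-1 ^+ N + d' * q^-1 ^+ N.+1) = c + d' / q.
  by rewrite exprS exprVn invrK; field; rewrite q0 qN.
move: e; rewrite e1 e2 => /addrI e.
by rewrite expr2 -mulrA [q * d]mulrC e; field.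
Qed.

(** The equation equates q d(q), with positive powers of q only, and q^-1 d(q^-1), with negative
    ones only. Scaled by a power of q, it becomes a comparison of sizes of polynomials. *)
Lemma bar_small_eq0 (d : {poly rat}) : qq ^+ 2 * evr d qq = evr d qq^-1 -> d = 0.
Proof.
move=> e; apply/eqP; apply: contraT => d0.
pose M := size d.
have : 'X^(M + 2) * d = \sum_(i < M) d`_i *: 'X^(M - i).
  apply/eqP; rewrite -tofrac_eq (rmorphM tf) (rmorphXn tf) /= -/qq -(evr_qq d) exprD -mulrA e.
  apply/eqP; rewrite (rmorph_sum tf) /evr horner_coef size_map_poly mulr_sumr.
  apply: eq_bigr => i _; rewrite coef_map /= -mul_polyC (rmorphM tf) (rmorphXn tf) -/qq mulrCA.
  congr (_ * _); have -> : qq ^+ M = qq ^+ (M - i) * qq ^+ i.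
    by rewrite -exprD subnK // ltnW // ltn_ord.
  by rewrite -mulrA exprVn (mulfV (expf_neq0 _ qq_neq0)) mulr1.
move=> /(congr1 (fun p : {poly rat} => size p)) /=.
rewrite mulrC size_mulXn // => hs.
have : (size (\sum_(i < M) d`_i *: 'X^(M - i))%R <= M.+1)%N.
  apply: (leq_trans (size_sum _ _ _)); apply/bigmax_leqP => i _.
  by rewrite (leq_trans (size_scale_leq _ _)) // size_polyXn ltnS leq_subr.
by rewrite -hs addn2 leqNgt => /negP[]; rewrite !addSn !ltnS leq_addr.
Qed.

Lemma qq_invE (z : Qq) : z^-1 + z^-1^-1 = z + z^-1.
Proof. by rewrite invrK addrC. Qed.

Lemma cong_mod_q_add n (t y z : tensor n Qq) p :
  cong_mod_q y p -> in_lattice z -> t - y = qq *: z -> cong_mod_q t p.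
Proof.
move=> [z0 lz0 ->] lz /eqP; rewrite subr_eq => /eqP ->.
by exists (z + z0); [exact: in_latticeD | rewrite addrCA scalerDr].
Qed.

Lemma delta_coef_sum n (F : fieldType) N (D : matching n -> {poly int}) Q0 :
  valid Q0 -> (forall Q, valid Q -> D Q = (Q == Q0)%:R * 'X^N) ->
  (1 : F) ^- N *: \sum_(Q | valid Q) ev (D Q) 1 *: bvec 1 Q = bvec (1 : F) Q0.
Proof.
move=> vQ0 DE; rewrite expr1n invr1 scale1r (bigD1 Q0) //= big1 ?addr0.
  by rewrite DE // eqxx mul1r /ev map_polyXn hornerXn expr1n scale1r.
move=> Q /andP[vQ /negPf e].
by rewrite DE // e mul0r /ev rmorph0 horner0 scale0r.
Qed.

Lemma comb_sub_delta (K : fieldType) (W : lmodType K) (I : finType) (P : pred I) (i0 : I)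
    (c : I -> K) (b : I -> W) (q : K) N (t z z' : W) : q != 0 -> P i0 ->
  q ^- N *: \sum_(i | P i) c i *: b i = t + q *: z -> b i0 = t + q *: z' ->
  \sum_(i | P i) (c i - (i == i0)%:R * q ^+ N) *: b i = q ^+ N.+1 *: (z - z').
Proof.
move=> q0 Pi0 e1 e2; have qN : q ^+ N != 0 by rewrite expf_neq0.
under eq_bigr => i _ do rewrite scalerBl; rewrite sumrB.
have -> : \sum_(i | P i) c i *: b i = q ^+ N *: (t + q *: z).
  by rewrite -e1 scalerA mulfV // scale1r.
have -> : \sum_(i | P i) ((i == i0)%:R * q ^+ N) *: b i = q ^+ N *: (t + q *: z').
  rewrite (bigD1 i0 Pi0) big1 /= => [|i /andP[_ /negPf e]]; last by rewrite e mul0r scale0r.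
  by rewrite addr0 eqxx mul1r e2.
by rewrite -scalerBr opprD addrACA subrr add0r -scalerBr scalerA exprSr.
Qed.

Lemma comb_sub (K : fieldType) (W : lmodType K) (I : finType) (P : pred I)
    (c d : I -> K) (b : I -> W) (a a' : K) :
  a *: \sum_(i | P i) c i *: b i = a' *: \sum_(i | P i) d i *: b i ->
  \sum_(i | P i) (a * c i - a' * d i) *: b i = 0.
Proof.
move=> e; under eq_bigr => i _ do rewrite scalerBl -!scalerA.
by rewrite sumrB -!scaler_sumr e subrr.
Qed.

(** Uniqueness of a bar-invariant element with given residue modulo q. By [leading_divisible] each
    Laurent coefficient is 0 or 1 plus q d(q) with d a polynomial; by [bvec_free] the coefficients
    are bar-invariant one by one; then d = 0 by [bar_small_eq0]. *)
Lemma laurent_rigid n N (D : matching n -> {poly int}) Q0 : valid Q0 ->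
  cong_mod_q (qq ^- N *: \sum_(Q | valid Q) ev (D Q) qq *: bvec qq Q) (lead Q0) ->
  qq ^- N *: \sum_(Q | valid Q) ev (D Q) qq *: bvec qq Q =
    qq^-1 ^- N *: \sum_(Q | valid Q) ev (D Q) qq^-1 *: bvec qq Q ->
  forall Q, valid Q -> D Q = (Q == Q0)%:R * 'X^N.
Proof.
move=> vQ0 [z0 lz0 hz0] eyy.
pose r Q := map_poly intr (D Q) : {poly rat}.
have evD Q z : ev (D Q) z = evr (r Q) z by exact: ev_evr.
pose del Q := (Q == Q0)%:R : {poly rat}.
have div Q : valid Q -> exists d, r Q - del Q * 'X^N = d * 'X^(N.+1).
  move=> vQ; have [z4 lz4 hz4] := cong_mod_q_bvec vQ0.
  have lz : in_lattice (z0 - z4).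
    rewrite -[- z4]scaleN1r; apply: (in_latticeD lz0); apply: (in_latticeZ _ lz4).
    by rewrite -(rmorph1 tf) -(rmorphN tf); exact: regular_tf.
  apply: (@leading_divisible _ N.+1 (fun Q' => r Q' - del Q' * 'X^N) _ lz _ Q vQ).
  rewrite -(comb_sub_delta qq_neq0 vQ0 hz0 hz4); apply: eq_bigr => Q' _.
  congr (_ *: _); rewrite (rmorphB tf) (rmorphM tf) (rmorphXn tf) (rmorph_nat tf).
  by congr (_ - _); rewrite /= evD evr_qq.
have bar Q : valid Q -> qq ^- N * evr (r Q) qq = qq^-1 ^- N * evr (r Q) qq^-1.
  move=> vQ; apply: subr0_eq; move: Q vQ; apply: bvec_free.
  rewrite -[RHS](comb_sub eyy); apply: eq_bigr => Q' _.
  by congr (_ *: _); congr (_ - _); congr (_ * _); rewrite evD.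
move=> Q vQ; have [d hd] := div Q vQ.
have rE : r Q = del Q * 'X^N + d * 'X^(N.+1) by rewrite -hd addrC subrK.
suff d0 : d = 0.
  move: rE; rewrite d0 mul0r addr0 => rE.
  apply: (@map_inj_poly _ _ (intr : int -> rat)); first exact: intr_inj.
    by [].
  by rewrite -/(r Q) rE rmorphM /= map_polyXn rmorph_nat.
have evX z : evr (r Q) z = (Q == Q0)%:R * z ^+ N + evr d z * z ^+ N.+1.
  by rewrite rE evrD !evrM !evr_Xn evr_nat.
apply: bar_small_eq0; move: (bar Q vQ); rewrite !evX; clear.
exact: (@bar_cancel _ qq _ _ _ _ qq_neq0).
Qed.

(** * Integral form, bar involution and crystal lattice seen in the tensor square *)

Section Global.
Variables (k n : nat) (V : vectType Qq) (M : Uq_module n V) (v : V).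
Hypothesis hM : Uq_irreducible M.
Hypothesis hv : highest_weight_vector k M v.
Implicit Types (i : 'I_n.-1).

Local Notation gen := (gen k M v).

Lemma gen_divF i a x y : gen x y ->
  gen (divF M i a x) ((qfact a)^-1 *: iter a (tF qq i) y).
Proof.
move=> g; rewrite /divF; apply: genZ; elim: a => //= a IHa; exact: gen_F.
Qed.

Lemma gen_word w :
  gen (foldr (fun ia => divF M ia.1 ia.2) v w) (tword k qq qfact w).
Proof.
elim: w => [|[i a] w IHw] /=; first exact: gen_hw.
exact: gen_divF.
Qed.

Lemma gen_eval (z : Qq) (s : integral_form n) :
  gen (\sum_(t <- s) (ev t.1.1 z / z ^+ t.1.2) *: foldr (fun ia => divF M ia.1 ia.2) v t.2)
      (teval k qq qfact z s).
Proof. by apply: gen_sum => t _; apply: genZ; apply: gen_word. Qed.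

Lemma eval_qE s : eval_q M v s =
  \sum_(t <- s) (ev t.1.1 qq / qq ^+ t.1.2) *: foldr (fun ia => divF M ia.1 ia.2) v t.2.
Proof. by apply: eq_bigr => t _; rewrite -tf_ev. Qed.

Section Bar.
Variable psi : V -> V.
Hypothesis hpsi : bar_involution M v psi.

Let psiD : {morph psi : x y / x + y}. Proof. by case: hpsi. Qed.

Let psi0 : psi 0 = 0.
Proof. by apply: (addrI (psi 0)); rewrite -psiD !addr0. Qed.

Let psiN x : psi (- x) = - psi x.
Proof. by apply/eqP; rewrite -addr_eq0 -psiD addNr psi0. Qed.

Let psi_sum (I : Type) (r : seq I) (f : I -> V) :
  psi (\sum_(t <- r) f t) = \sum_(t <- r) psi (f t).
Proof. exact: (big_morph psi psiD psi0). Qed.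

Let psi_exp a x : psi (qq ^+ a *: x) = qq ^- a *: psi x.
Proof.
have [_ pq _ _] := hpsi; elim: a x => [|a IHa] x; first by rewrite invr1 !scale1r.
by rewrite exprS -scalerA pq IHa scalerA invfM.
Qed.

Let psi_expV a x : psi (qq ^- a *: x) = qq ^+ a *: psi x.
Proof.
have qa := expf_neq0 a qq_neq0.
by rewrite -{2}[x]scale1r -(mulfV qa) -scalerA psi_exp scalerA (mulfV qa) scale1r.
Qed.

Let psi_int (c : int) x : psi (c%:~R *: x) = c%:~R *: psi x.
Proof.
have psi_nat m y : psi (m%:R *: y) = m%:R *: psi y.
  by elim: m => [|m IHm]; rewrite ?scale0r // -addn1 natrD !scalerDl psiD IHm !scale1r.
case: c => m; first exact: psi_nat.
by rewrite NegzE rmorphN /= !scaleNr psiN psi_nat.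
Qed.

Let psi_ev (p : {poly int}) x : psi (ev p qq *: x) = ev p qq^-1 *: psi x.
Proof.
rewrite /ev; elim/poly_ind: p x => [|p c IHp] x; first by rewrite rmorph0 !horner0 !scale0r.
rewrite rmorphD rmorphM /= map_polyX map_polyC /= !(hornerD, hornerM, hornerX, hornerC).
by rewrite !scalerDl psiD psi_int -!scalerA IHp -[qq]expr1 psi_exp.
Qed.

Let bar_fixed (c : Qq) := forall x, psi (c *: x) = c *: psi x.

Let bar_fixedM c d : bar_fixed c -> bar_fixed d -> bar_fixed (c * d).
Proof. by move=> hc hd x; rewrite -scalerA hc hd scalerA. Qed.

Let bar_fixedV c : c != 0 -> bar_fixed c -> bar_fixed c^-1.
Proof.
by move=> c0 hc x; rewrite -{2}[x]scale1r -(mulfV c0) -scalerA hc scalerA mulVf // scale1r.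
Qed.

Let bar_fixed_qint a : bar_fixed (qint a).
Proof.
move=> x; rewrite /qint;
  (* The numerator and the denominator of [a] both change sign under q -> q^-1. *)
  have anti b y : psi ((qq ^+ b - qq ^- b) *: y) = - ((qq ^+ b - qq ^- b) *: psi y).
  by rewrite !scalerBl psiD psiN psi_exp psi_expV opprB.
set h := qq - qq^-1; have h0 : h != 0 := qq_sub_inv_neq0.
have hV y : psi (h^-1 *: y) = - (h^-1 *: psi y).
  apply: (scalerI h0); rewrite scalerN scalerA (mulfV h0) scale1r.
  rewrite -{2}[y]scale1r -(mulfV h0) -scalerA.
  by have := anti 1%N (h^-1 *: y); rewrite expr1 => ->; rewrite opprK.
by rewrite -!scalerA anti hV scalerN opprK.
Qed.

Let psi_word w : psi (foldr (fun ia => divF M ia.1 ia.2) v w) = foldr (fun ia => divF M ia.1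
  ia.2) v w.
Proof.
have [_ _ pv pE] := hpsi; elim: w => [|[i a] w IHw] //=.
have hf : bar_fixed (qfact a).
  rewrite /qfact; elim/big_rec: _ => [x|j c _ hc]; first by rewrite !scale1r.
  exact: (bar_fixedM (bar_fixed_qint j) hc).
rewrite /divF bar_fixedV ?qfact_neq0 //; congr (_ *: _).
elim: a {hf} => //= a IHa;
  have [_ -> _] := pE i (iter a (opF M i) (foldr (fun ia => divF M ia.1 ia.2) v w)).
by rewrite IHa.
Qed.

(** The q-factorials are bar-invariant, so psi fixes every word in divided powers applied to v and
    acts on the scalar coefficients only. *)
Lemma gen_bar_eval s : gen (psi (eval_q M v s)) (teval k qq qfact qq^-1 s).
Proof.
apply: (gen_eq (gen_eval qq^-1 s)) => //; rewrite eval_qE psi_sum.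
have swap (a b : Qq) (w : V) : (a * b) *: w = b *: (a *: w) by rewrite scalerA mulrC.
by apply: eq_bigr => t _; rewrite !swap psi_expV psi_ev psi_word exprVn invrK.
Qed.

End Bar.

(** Whatever decomposition of x is chosen in V, its primitive vectors have primitive images by
    [gen0_inj], so that [ft_dF] applies term by term. *)
Lemma gen_kashiwara i x x' y : kashiwara_f M i x x' -> gen x y -> gen x' (ft qq i y).
Proof.
move=> [d [w [hE -> ->]]] g.
have [ys hys] := fin_all_exists (fun j => gen_total hM hv (w j)).
have gs : gen (\sum_(j < d) divF M i j (w j))
              (\sum_(j < d) (qfact j)^-1 *: iter j (tF qq i) (ys j)).
  by apply: gen_sum => j _; apply: gen_divF.
rewrite (gen_fun hv g gs) linear_sum.
apply: gen_sum => j _.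
have Ey : tE qq i (ys j) = 0.
  by have := gen_E hv i (hys j); rewrite hE; apply: (gen0_inj hv).
have [c0 c1 c2 _] := qfactorials_qq.
rewrite /= (ft_dF qq_neq0 qq2_neq0 j c0 c1 c2 Ey).
exact: gen_divF.
Qed.

Lemma gen_kashiwara_word w b : kashiwara_word M v w b -> exists2 y, gen b y & in_lattice y.
Proof.
elim: w b => [|i w IHw] b /=.
  by move=> ->; exists (tvac k n Qq); [apply: gen_hw | apply: in_lattice_tbasis].
move=> [x /IHw[y gy ly] kf]; exists (ft qq i y); first exact: gen_kashiwara gy.
exact: in_lattice_ft.
Qed.

Lemma gen_crystal_lattice x : crystal_lattice M v x -> exists2 y, gen x y & in_lattice y.
Proof.
move=> [m [a [y [ha hy ->]]]].
have /fin_all_exists2[ys gs ls] : forall j, exists2 y', gen (y j) y' & in_lattice y'.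
  by move=> j; have [w] := hy j; apply: gen_kashiwara_word.
exists (\sum_(j < m) a j *: ys j); first by apply: gen_sum => j _; apply: genZ.
by elim/big_rec: _ => [|j z _ lz]; [apply: in_lattice0 | apply: in_latticeD => //;
  apply: in_latticeZ].
Qed.

(** The integral form s represents x, and with q^-1 in its coefficients it represents psi x = x.
    This puts its integer polynomials D under [laurent_rigid], and their values at 1 are then known
    whichever s was chosen. *)
Lemma global_specialization x s psi b y Q0 : valid Q0 ->
  x = eval_q M v s -> bar_involution M v psi -> psi x = x ->
  gen b y -> cong_mod_q y (lead Q0) -> eq_mod_qL M v x b ->
  forall (F : fieldType) (c : nat -> F), qfactorials 1 c ->
  teval k 1 c 1 s = bvec 1 Q0.
Proof.
move=> vQ0 xE hpsi psix gb cy [z1 /gen_crystal_lattice[z2 gz2 lz2] xb] F c hc.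
have gx : gen x (teval k qq qfact qq s) by rewrite xE eval_qE; apply: gen_eval.
have gx' : gen x (teval k qq qfact qq^-1 s).
  by rewrite -psix xE; apply: gen_bar_eval.
have eyy := gen_fun hv gx gx'.
have cs : cong_mod_q (teval k qq qfact qq s) (lead Q0).
  have ge : gen (x - b) (qq *: z2) by rewrite xb; apply: genZ.
  exact: cong_mod_q_add cy lz2 (gen_fun hv (genB gx gb) ge).
have [N [D hD]] := teval_bvec k s; move: eyy cs.
clear -hD vQ0 hc; rewrite (hD _ _ _ _ qq_neq0 qq_neq0 erefl qfactorials_qq).
rewrite (hD _ _ _ _ qq_neq0 (invr_neq0 qq_neq0) (qq_invE _) qfactorials_qq) => e cs.
have := laurent_rigid vQ0 cs e.
rewrite (hD _ _ _ _ (oner_neq0 _) (oner_neq0 _) erefl hc).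
exact: delta_coef_sum vQ0.
Qed.

End Global.

(** * Tableaux *)

Lemma foldl_filter (T S : Type) (f : S -> T -> S) (P : pred T) (z : S) (s : seq T) :
  (forall st x, ~~ P x -> f st x = st) -> foldl f z s = foldl f z (filter P s).
Proof.
move=> h; elim: s z => //= x s IHs z.
by case: ifP => [_|/negbT /h ->] /=; rewrite IHs.
Qed.

Lemma pairwise_allpairs (S T U : Type) (r : rel U) (f : S -> T -> U) (s : seq S) (t : seq T)
    (rs : rel S) (rt : rel T) :
  pairwise rs s -> pairwise rt t ->
  (forall x x' y y', rs x x' -> r (f x y) (f x' y')) ->
  (forall x y y', rt y y' -> r (f x y) (f x y')) ->
  pairwise r [seq f x y | x <- s, y <- t].
Proof.
move=> + pt h1 h2; elim: s => //= x s IHs /andP[xs /IHs ps].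
rewrite pairwise_cat ps andbT; apply/andP; split.
  rewrite allrel_mapl; elim: s xs {IHs ps} => [|x' s IHs] /=; first by rewrite allrel0r.
  case/andP=> xx' xs; rewrite allrel_catr IHs // andbT allrel_mapr.
  have all_true T' (p : pred T') (u : seq T') : (forall z, p z) -> all p u.
    by move=> hp; elim: u => //= z u ->; rewrite hp.
  by apply: (all_true) => y; apply: (all_true) => y'; apply: h1.
by rewrite pairwise_map; apply: sub_pairwise pt => y y' yy'; apply: h2.
Qed.

Section Tableau.
Variables (k n : nat).
Implicit Types (S : tableau k n) (i : 'I_n.-1) (c : 'I_k * 'I_2).

Definition read_lt : rel ('I_k * 'I_2) :=
  fun c d => (d.1 < c.1)%N || (c.1 == d.1) && (c.2 < d.2)%N.

Lemma read_lt_irr : irreflexive read_lt.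
Proof. by move=> c; rewrite /read_lt !ltnn andbF. Qed.

Lemma read_lt_trans : transitive read_lt.
Proof. by move=> [r c] [r' c'] [r'' c'']; rewrite /read_lt /= -!val_eqE /=; lia. Qed.

Lemma reading_sorted : sorted read_lt (reading_cells k).
Proof.
rewrite sorted_pairwise; last exact: read_lt_trans.
have p m : pairwise (fun x y : 'I_m => (x < y)%N) (enum 'I_m).
  rewrite -(pairwise_map val ltn) val_enum_ord -sorted_pairwise ?iota_ltn_sorted //.
  exact: ltn_trans.
apply: (pairwise_allpairs (p k) (p 2)) => [x x' y y' xx'|x y y' yy'].
  by rewrite /read_lt /=; have := ltn_ord x'; lia.
by rewrite /read_lt /= eqxx yy' orbT.
Qed.

Lemma mem_reading c : c \in reading_cells k.
Proof.
apply/allpairsP; exists (rev_ord c.1, c.2); rewrite !mem_enum /= rev_ordK.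
by split=> //; case: c.
Qed.

Lemma filter_reading (P : pred ('I_k * 'I_2)) (L : seq ('I_k * 'I_2)) :
  sorted read_lt L -> (forall c, (c \in L) = P c) -> filter P (reading_cells k) = L.
Proof.
move=> sL mL; apply: (irr_sorted_eq read_lt_trans read_lt_irr) => //.
  exact: (sorted_filter read_lt_trans _ reading_sorted).
by move=> c; rewrite mem_filter mem_reading andbT mL.
Qed.

(** The scan ignores all other letters, so it suffices to list the cells holding i or i + 1 in
    reading order; a two-column tableau has at most four. *)
Lemma ftab_scan i S (L : seq ('I_k * 'I_2)) :
  sorted read_lt L ->
  (forall c, (c \in L) = (S c.1 c.2 == low i) || (S c.1 c.2 == high i)) ->
  foldl (bracket_step i S) (0%N, None) (reading_cells k) =
  foldl (bracket_step i S) (0%N, None) L.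
Proof.
move=> sL mL; rewrite (@foldl_filter _ _ _ (fun c => (S c.1 c.2 == low i) || (S c.1 c.2 == high
  i))).
  by rewrite (filter_reading sL mL).
by move=> st c; rewrite negb_or /bracket_step => /andP[/negPf -> /negPf ->].
Qed.

Lemma ssytP S : reflect
  ((forall r, (S r ord0 <= S r ord_max)%N) /\ (forall (c : 'I_2) (r s : 'I_k), (r < s)%N -> (S r
    c < S s c)%N))
  (ssyt S).
Proof.
apply: (iffP andP) => -[h1 h2]; split.
- by move=> r; have := forallP (forallP (forallP h1 r) ord0) ord_max.
- by move=> c r s rs; have := forallP (forallP (forallP h2 c) r) s; rewrite rs.
- apply/forallP => r; apply/forallP => c; apply/forallP => d; apply/implyP.
  have o2 (e : 'I_2) : e = ord0 \/ e = ord_max.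
    by case: e => -[|[|//]] p; [left | right]; apply: val_inj.
  by case: (o2 c) => ->; case: (o2 d) => -> //.
- by apply/forallP => c; apply/forallP => r; apply/forallP => s; apply/implyP; apply: h2.
Qed.

Definition colset S (c : 'I_2) : {set 'I_n} := [set S r c | r : 'I_k].
Definition cols S := (colset S ord0, colset S ord_max).

Lemma mem_colset S (c : 'I_2) x : reflect (exists r, S r c = x) (x \in colset S c).
Proof.
by apply: (iffP imsetP) => [[r _ ->]|[r <-]]; exists r.
Qed.

(* One step of the crystal on the pair of column sets, restricted to pairs on
   which f_i does not vanish. *)
Definition cmove i (p p' : {set 'I_n} * {set 'I_n}) :=
  [/\ isu i p.2, ~~ isd i p.1 & p' = (p.1, sw i p.2)] \/
  [/\ isu i p.1, isd i p.2 & p' = (sw i p.1, p.2)].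

Definition upd S (c0 : 'I_k * 'I_2) (x : 'I_n) : tableau k n :=
  \matrix_(r, d) if (r, d) == c0 then x else S r d.

Lemma upd_upd S c0 x : upd (upd S c0 x) c0 (S c0.1 c0.2) = S.
Proof.
by apply/matrixP => r d; rewrite !mxE; case: eqP => // <-.
Qed.

Lemma ssyt_lt S (c : 'I_2) : ssyt S -> forall r s : 'I_k, (S r c < S s c)%N = (r < s)%N.
Proof.
move=> /ssytP[_ h] r s; case: (ltngtP r s) => [rs|sr|/val_inj ->]; last by rewrite ltnn.
  by rewrite h.
by have := h c _ _ sr; case: ltngtP.
Qed.

Lemma ssyt_inj S (c : 'I_2) : ssyt S -> injective (fun r => S r c).
Proof.
move=> hS r s e; apply: val_inj; have := ssyt_lt c hS r s; have := ssyt_lt c hS s r.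
by rewrite e ltnn; case: ltngtP.
Qed.

Lemma ssyt_ge S (c : 'I_2) : ssyt S -> forall r : 'I_k, (r <= S r c)%N.
Proof.
move=> hS [r rk] /=; elim: r rk => // r IHr rk.
have := IHr (ltnW rk); move=> h; apply: (leq_ltn_trans h).
by rewrite ssyt_lt.
Qed.

Lemma upd_strict i S r0 d : ssyt S -> S r0 d = high i -> low i \notin colset S d ->
  forall (c : 'I_2) (r s : 'I_k), (r < s)%N -> (upd S (r0, d) (low i) r c < upd S (r0, d) (low i)
    s c)%N.
Proof.
move=> hS hi hl c r s rs; rewrite !mxE !xpair_eqE.
have [h1 h2] := ssytP _ hS; have lt := h2 c r s rs.
case: (eqVneq c d) => [e|]; rewrite ?andbF // !andbT.
subst c; case: (eqVneq r r0) => [e|rr0].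
  subst r; case: (eqVneq s r0) => [e|sr0]; first by rewrite e ltnn in rs.
  by apply: leq_trans lt; rewrite hi.
case: (eqVneq s r0) => [e|//].
have : S r d != low i by apply: contraNneq hl => <-; apply/mem_colset; exists r.
by subst s; move: lt; rewrite hi -val_eqE /=; lia.
Qed.

Lemma cols_upd i S r0 d : ssyt S -> S r0 d = high i -> low i \notin colset S d ->
  forall c : 'I_2, colset (upd S (r0, d) (low i)) c = if c == d then sw i (colset S d) else
    colset S c.
Proof.
move=> hS hi hl c; apply/setP => x; case: (eqVneq c d) => [->|cd].
  have hc : high i \in colset S d by apply/mem_colset; exists r0.
  apply/mem_colset/idP => [[r <-]|].
    rewrite mxE xpair_eqE eqxx andbT; case: (eqVneq r r0) => [_|rr0].
      by rewrite low_in_sw.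
    rewrite other_in_sw; first by apply/mem_colset; exists r.
      by apply: contraNneq hl => <-; apply/mem_colset; exists r.
    by rewrite -hi (inj_eq (ssyt_inj hS)).
  have [->|xl] := eqVneq x (low i); first by exists r0; rewrite mxE eqxx.
  have [->|xh] := eqVneq x (high i); first by rewrite high_in_sw (negPf hl).
  rewrite other_in_sw // => /mem_colset[r e]; exists r; rewrite mxE xpair_eqE eqxx andbT.
  by case: eqP => // e'; rewrite -e e' hi eqxx in xh.
by apply/mem_colset/mem_colset => -[r e]; exists r; move: e; rewrite mxE xpair_eqE (negPf cd) andbF.
Qed.

End Tableau.

(** * Raising a semistandard tableau towards the highest weight tableau *)

Section Descend.
Variables (k n : nat) (hkn : (k <= n)%N).
Implicit Types (S : tableau k n) (i : 'I_n.-1).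

Definition tab_weight S : nat := \sum_(r < k) \sum_(d < 2) S r d.

Lemma tab_weight_upd i S r0 d : S r0 d = high i ->
  (tab_weight (upd S (r0, d) (low i)) < tab_weight S)%N.
Proof.
move=> hi; rewrite /tab_weight [X in (X < _)%N](bigD1 r0) //= [X in (_ < X)%N](bigD1 r0) //=.
rewrite -addSn leq_add //.
  rewrite [X in (X < _)%N](bigD1 d) //= [X in (_ <= X)%N](bigD1 d) //= -addSn leq_add //.
    by rewrite mxE eqxx hi.
  by apply: leq_sum => c cd; rewrite mxE xpair_eqE (negPf cd) andbF.
by apply: leq_sum => r rr0; apply: leq_sum => c _; rewrite mxE xpair_eqE (negPf rr0).
Qed.

Lemma ssyt_eq_top S : ssyt S -> (forall r, S r ord_max = r :> nat) -> S = top_tableau hkn.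
Proof.
move=> hS h; apply/matrixP => r c; rewrite mxE; apply: val_inj => /=.
have o2 (e : 'I_2) : e = ord0 \/ e = ord_max.
  by case: e => -[|[|//]] p; [left | right]; apply: val_inj.
case: (o2 c) => -> //; have [h1 _] := ssytP _ hS.
by apply/eqP; rewrite eqn_leq (ssyt_ge ord0 hS) andbT -(h r) h1.
Qed.

(** Take the first row r0 whose right entry exceeds its minimal value r0. The preceding letter
    cannot stand above it, because the rows above hold exactly their own indices. *)
Lemma ssyt_corner S : ssyt S -> S != top_tableau hkn ->
  exists r0 i, S r0 ord_max = high i /\ low i \notin colset S ord_max.
Proof.
move=> hS nt.
have [r hr] : exists r, S r ord_max != r :> nat.
  apply/existsP; apply: contraNT nt; rewrite negb_exists => /forallP h.
  by apply/eqP/ssyt_eq_top => // r; apply/eqP; rewrite -[_ == _]negbK.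
pose P m := [exists r : 'I_k, (r == m :> nat) && (S r ord_max != r :> nat)].
have exP : exists m, P m by exists r; apply/existsP; exists r; rewrite eqxx.
case: (ex_minnP exP) => m /existsP[r0 /andP[/eqP <- hr0]] hmin.
have ge0 := ssyt_ge ord_max hS r0.
have gt0 : (r0 < S r0 ord_max)%N by rewrite ltn_neqAle eq_sym hr0 ge0.
have pos : (0 < S r0 ord_max)%N by apply: leq_ltn_trans gt0.
have ltn : ((S r0 ord_max).-1 < n.-1)%N.
  have := ltn_ord (S r0 ord_max); move: pos; case: (nat_of_ord _) => // s _ /=.
  by clear; lia.
exists r0, (Ordinal ltn); split; first by apply: val_inj; rewrite /= prednK.
apply/mem_colset => -[s e].
have es : S s ord_max = (S r0 ord_max).-1 :> nat by rewrite e.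
have sr : (s < r0)%N by rewrite -(ssyt_lt ord_max hS) es; case: (nat_of_ord _) pos.
have : S s ord_max = s :> nat.
  apply/eqP; apply: contraLR sr => hs; rewrite -leqNgt; apply: hmin.
  by apply/existsP; exists s; rewrite eqxx.
by rewrite es => e2; move: sr gt0; rewrite -e2;
  case: (nat_of_ord (S r0 ord_max)) pos => //= s' _; clear; lia.
Qed.

Lemma ftab_upd i S c0 (L : seq ('I_k * 'I_2)) : S c0.1 c0.2 = high i ->
  let S' := upd S c0 (low i) in
  sorted (@read_lt k) L ->
  (forall c, (c \in L) = (S' c.1 c.2 == low i) || (S' c.1 c.2 == high i)) ->
  (foldl (bracket_step i S') (0%N, None) L).2 = Some c0 ->
  ftab i S' = Some S.
Proof.
move=> hi S' sL mL hL; rewrite /ftab (ftab_scan sL mL) hL; congr Some.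
by rewrite -[RHS](upd_upd S c0 (low i)) hi.
Qed.

Lemma ord2P (c : 'I_2) : c = ord0 \/ c = ord_max.
Proof. by case: c => -[|[|//]] p; [left | right]; apply: val_inj. Qed.

(** A raising step for the root given by [ssyt_corner]: it acts on the left column if that column
    contains i + 1 but not i, and on the right column otherwise, when an i + 1 of the left column is
    paired with an i above it. *)
Lemma ssyt_descend S : ssyt S -> S != top_tableau hkn ->
  exists i S', [/\ ssyt S', ftab i S' = Some S, cmove i (cols S') (cols S) &
    (tab_weight S' < tab_weight S)%N].
Proof.
move=> hS nt; have [r0 [i [hi lJ]]] := ssyt_corner hS nt.
have [h1 h2] := ssytP _ hS.
have hl := low_neq_high i; have lh := high_neq_low i.
have hJ : high i \in colset S ord_max by apply/mem_colset; exists r0.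
have dJ : isd i (colset S ord_max) by rewrite /isd lJ.
have Smax r : (S r ord_max == high i) = (r == r0) by rewrite -hi (inj_eq (ssyt_inj hS)).
have Smaxl r : (S r ord_max == low i) = false.
  by apply: contraNF lJ => /eqP <-; apply/mem_colset; exists r.
have le0 (r1 : 'I_k) : (S r0 ord0 <= S r1 ord0)%N -> (r0 <= r1)%N.
  by rewrite leqNgt (ssyt_lt ord0 hS) -leqNgt.
have vhi : high i = (low i).+1 :> nat by [].
exists i; case dI : (isd i (colset S ord0)).
  (* Both columns have an unpaired i + 1; the left one stands no higher than the right one, hence is
     read first. *)
  have /andP[lI /mem_colset[r1 hr1]] := dI.
  exists (upd S (r1, ord0) (low i)).
  have S0 r : (S r ord0 == high i) = (r == r1) by rewrite -hr1 (inj_eq (ssyt_inj hS)).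
  have S0l r : (S r ord0 == low i) = false.
    by apply: contraNF lI => /eqP <-; apply/mem_colset; exists r.
  split; last exact: tab_weight_upd.
  - apply/ssytP; split; last exact: upd_strict.
    move=> r; rewrite !mxE !xpair_eqE /= andbT andbF; case: (eqVneq r r1) => [->|_] //.
    by apply: leq_trans (h1 r1); rewrite hr1 /=.
  - apply: (@ftab_upd i S (r1, ord0) [:: (r1, ord0); (r0, ord_max)]) => //=.
    + rewrite andbT /read_lt /= andbT -val_eqE /= orbC eq_sym -leq_eqVlt le0 //.
      by apply: leq_trans (h1 r0) _; rewrite hi hr1.
    + move=> [r c]; rewrite !inE !xpair_eqE /= !mxE xpair_eqE.
      case: (ord2P c) => ->; rewrite ?andbF ?andbT ?orbF /=.
        by case: (eqVneq r r1) => [_|/negPf rr1]; rewrite ?eqxx ?S0 ?S0l ?rr1.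
      by rewrite Smax Smaxl.
    + rewrite /bracket_step /= !mxE !xpair_eqE !eqxx /= andbF hi eqxx hl //.
  - right; rewrite /cols !(cols_upd hS hr1 lI) /=; split=> //.
      by rewrite isu_sw.
    by rewrite sw_sw.
(* This keeps row r0 weakly increasing once its right entry becomes i. If the left entry were i + 1,
   the left column would have i in a row above, whose right entry would then also be i, against the
   choice of i. *)
have neI : S r0 ord0 != high i.
  apply: contraFneq dI => e; rewrite /isd; apply/andP; split; last first.
    by apply/mem_colset; exists r0.
  apply/mem_colset => -[r1 e1].
  have r10 : (r1 < r0)%N by rewrite -(ssyt_lt ord0 hS) e e1 vhi.
  have := h2 ord_max _ _ r10; rewrite hi vhi ltnS => le1.
  have := h1 r1; rewrite e1 => ge1; have := Smaxl r1.
  by rewrite -val_eqE /= eqn_leq le1 ge1.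
have leI : (S r0 ord0 <= low i)%N.
  by have := h1 r0; rewrite hi vhi leq_eqVlt ltnS -vhi => /orP[|//]; rewrite [_ == _](negPf neI).
have cm : cmove i (cols (upd S (r0, ord_max) (low i))) (cols S).
  left; rewrite /cols !(cols_upd hS hi lJ) /=; split; first by rewrite isu_sw.
    by rewrite dI.
  by rewrite sw_sw.
exists (upd S (r0, ord_max) (low i)); split=> //; last exact: tab_weight_upd.
  apply/ssytP; split; last exact: upd_strict.
  by move=> r; rewrite !mxE !xpair_eqE /= ?andbF ?andbT; case: (eqVneq r r0) => [->|_].
have updE r c : upd S (r0, ord_max) (low i) r c = if c == ord0 then S r c else if r == r0 then
  low i else S r c.
  by rewrite mxE xpair_eqE; case: (ord2P c) => ->; rewrite ?andbF ?andbT.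
have colmax r c : c = ord_max -> (upd S (r0, ord_max) (low i) r c == low i) || (upd S (r0,
  ord_max) (low i) r c == high i) = (r == r0).
  by move=> ->; rewrite updE /=; case: (eqVneq r r0) => [_|/negPf rr];
    rewrite ?eqxx ?Smax ?Smaxl ?rr.
have [/mem_colset[r1 e1]|lI] := boolP (low i \in colset S ord0); last first.
  have hI : high i \notin colset S ord0 by move: dI; rewrite /isd lI => /negbT.
  apply: (@ftab_upd i S (r0, ord_max) [:: (r0, ord_max)]) => //=.
    move=> [r c]; rewrite !inE !xpair_eqE /=.
    case: (ord2P c) => ec; last by rewrite colmax // ec andbT.
    rewrite updE ec /= andbF; symmetry; apply/norP; split.
      by apply: contraNneq lI => <-; apply/mem_colset; exists r.
    by apply: contraNneq hI => <-; apply/mem_colset; exists r.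
  by rewrite /bracket_step /= !updE /= eqxx hl eqxx.
have r01 : (r0 <= r1)%N by apply: le0; rewrite e1.
have S0l r : (S r ord0 == low i) = (r == r1) by rewrite -e1 (inj_eq (ssyt_inj hS)).
have [/mem_colset[r2 e2]|hI] := boolP (high i \in colset S ord0).
  have r12 : (r1 < r2)%N by rewrite -(ssyt_lt ord0 hS) e1 e2 vhi.
  have S0 r : (S r ord0 == high i) = (r == r2) by rewrite -e2 (inj_eq (ssyt_inj hS)).
  apply: (@ftab_upd i S (r0, ord_max) [:: (r2, ord0); (r1, ord0); (r0, ord_max)]) => //=.
  - by rewrite /read_lt /= r12 /= !andbT -val_eqE /= orbC eq_sym -leq_eqVlt r01.
  - move=> [r c]; rewrite !inE !xpair_eqE /=.
    case: (ord2P c) => ec; last by rewrite colmax // ec !andbF andbT.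
    by rewrite updE ec /= !andbT andbF orbF S0 S0l orbC.
  - by rewrite /bracket_step /= !updE /= ?e1 ?e2 ?(eqxx, hl) /= ?updE /= ?e1 ?(eqxx, hl) /= ?updE
    /= ?(eqxx, hl).
apply: (@ftab_upd i S (r0, ord_max) [:: (r1, ord0); (r0, ord_max)]) => //=.
- by rewrite /read_lt /= !andbT -val_eqE /= orbC eq_sym -leq_eqVlt r01.
- move=> [r c]; rewrite !inE !xpair_eqE /=.
  case: (ord2P c) => ec; last by rewrite colmax // ec !andbF andbT.
  rewrite updE ec /= !andbT andbF orbF S0l; symmetry; rewrite orb_idr // => /eqP e.
  by move/mem_colset: hI; case; exists r.
- by rewrite /bracket_step /= !updE /= ?e1 ?(eqxx, hl) /= ?updE /= ?(eqxx, hl) /=.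
Qed.

End Descend.

(** * Pairings and tableaux *)

Lemma enum_set_sorted n (A : {set 'I_n}) : sorted (fun x y : 'I_n => (x < y)%N) (enum A).
Proof.
have tr : transitive (fun x y : 'I_n => (x < y)%N) by move=> y x z; apply: ltn_trans.
rewrite /enum_mem -enumT; apply: (sorted_filter tr).
by have := iota_ltn_sorted 0 n; rewrite -val_enum_ord sorted_map.
Qed.

Lemma enum_set_eq n (A : {set 'I_n}) (s : seq 'I_n) :
  sorted (fun x y : 'I_n => (x < y)%N) s -> s =i A -> enum A = s.
Proof.
move=> ss sA.
have tr : transitive (fun x y : 'I_n => (x < y)%N) by move=> y x z; apply: ltn_trans.
apply: (irr_sorted_eq tr) => //; first by move=> x; rewrite ltnn.
  exact: enum_set_sorted.
by move=> x; rewrite mem_enum sA.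
Qed.

(** Pigeonhole: were the r-th element of A (counted from 0) larger than that of B, phi would inject
    the r + 1 smallest elements of B into the r smallest of A. *)
Lemma nth_enum_le n (A B : {set 'I_n}) (phi : 'I_n -> 'I_n) (x0 : 'I_n) r :
  {in B &, injective phi} -> (forall y, y \in B -> phi y \in A /\ (phi y <= y)%N) ->
  (r < #|B|)%N -> (r < #|A|)%N -> (nth x0 (enum A) r <= nth x0 (enum B) r)%N.
Proof.
move=> inj hphi rB rA; rewrite leqNgt; apply/negP => lt_yx.
set y := nth x0 (enum B) r in lt_yx.
have trn : transitive (fun x y : 'I_n => (x < y)%N) by move=> ? ? ?; apply: ltn_trans.
have tre : transitive (fun x y : 'I_n => (x <= y)%N) by move=> ? ? ?; apply: leq_trans.
have sle (C : {set 'I_n}) : sorted (fun x y : 'I_n => (x <= y)%N) (enum C).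
  by apply: sub_sorted (enum_set_sorted C) => a b; apply: ltnW.
pose B' := [set z in take r.+1 (enum B)].
have cB' : #|B'| = r.+1.
  rewrite cardsE; have /card_uniqP -> : uniq (take r.+1 (enum B)) by rewrite take_uniq ?enum_uniq.
  by rewrite size_takel // -cardE.
have B'P z : z \in B' -> z \in B /\ (z <= y)%N.
  rewrite inE => zt; split; first by rewrite -mem_enum (mem_take zt).
  have [j jr <-] := nthP x0 zt; move: jr; rewrite size_takel -?cardE // => jr.
  rewrite nth_take //; apply: (sorted_leq_nth tre _ x0 (sle B)); rewrite ?inE -?cardE //.
  exact: leq_trans jr rB.
have : (#|phi @: B'| <= #|[set z in take r (enum A)]|)%N.
  apply: subset_leq_card; apply/subsetP => _ /imsetP[z /B'P[zB zy] ->].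
  have [pA pz] := hphi z zB; rewrite inE.
  have := pA; rewrite -mem_enum => /(nthP x0)[j jA ej].
  have jr : (j < r)%N.
    rewrite ltnNge; apply/negP => rj.
    have := sorted_leq_nth tre (fun a : 'I_n => leqnn a) x0 (sle A).
    move=> /(_ r j); rewrite !inE -cardE rA => /(_ isT); rewrite cardE => /(_ jA rj).
    rewrite ej => le_rj; have := leq_trans lt_yx (leq_trans le_rj (leq_trans pz zy)).
    by rewrite ltnn.
  rewrite -ej -(nth_take x0 jr) mem_nth // size_takel //.
  by rewrite -cardE ltnW.
rewrite card_in_imset ?cB'; last by move=> a b /B'P[aB _] /B'P[bB _]; apply: inj.
rewrite cardsE => h; have := leq_trans h (card_size _); rewrite size_takel ?ltnn //.
by rewrite -cardE ltnW.
Qed.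

Lemma prod_nat_bool (I : finType) (b : I -> bool) :
  (\prod_x b x)%N = [forall x, b x].
Proof.
have [/forallP h|] := boolP [forall x, b x]; first by rewrite big1 // => x _; rewrite h.
by rewrite negb_forall => /existsP[x /negPf bx]; rewrite (bigD1 x) //= bx.
Qed.

Lemma card2_setI (T : finType) (a b : T) (A : {set T}) : a != b ->
  #|[set a; b] :&: A| = ((a \in A) + (b \in A))%N.
Proof.
move=> ab; have -> : #|[set a; b] :&: A| = (\sum_(x in [set a; b]) (x \in A))%N.
  rewrite -sum1_card big_mkcond [RHS]big_mkcond; apply: eq_bigr => x _.
  by rewrite inE; case: (x \in [set a; b]) => //=; case: (x \in A).
by rewrite big_setU1 ?inE //= big_set1.
Qed.

Section Pairings.
Variables (k n : nat).
Implicit Types (P : pairing n) (Q : matching n) (x y : 'I_n).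

Definition mate P x : 'I_n :=
  if [pick y | (y != x) && ([set x; y] \in P.1)] is Some y then y else x.

Definition matching_of P : matching n := ([ffun x => mate P x], P.2).

Definition pairing_of Q : pairing n :=
  ([set [set x; Q.1 x] | x in [set x | Q.1 x != x]], Q.2).

Lemma mate_block P x : mate P x != x -> [set x; mate P x] \in P.1.
Proof. by rewrite /mate; case: pickP => [y /andP[]|]; rewrite ?eqxx. Qed.

Section OnePairing.
Variable P : pairing n.
Hypothesis hP : P \in pairings k n.

Let triv : trivIset P.1. Proof. by move: hP; rewrite inE => /and5P[]. Qed.
Let card2 B : B \in P.1 -> #|B| = 2.
Proof. by move: hP; rewrite inE => /and5P[_ /forallP h _ _ _] BP; apply/eqP/(implyP (h B)). Qed.

Lemma blockE x y : [set x; y] \in P.1 -> x != y /\ mate P x = y.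
Proof.
move=> xyP; have xy : x != y by have := card2 xyP; rewrite cards2; case: eqP.
split=> //; rewrite /mate; case: pickP => [z /andP[zx xzP]|/(_ y)]; last first.
  by rewrite eq_sym xy xyP.
have e : [set x; y] = [set x; z].
  by rewrite -(def_pblock triv xyP (set21 x y)) -(def_pblock triv xzP (set21 x z)).
by have := set22 x z; rewrite -e !inE (negPf zx) => /eqP.
Qed.

Lemma mateK : involutive (mate P).
Proof.
move=> x; have [e|/mate_block xP] := eqVneq (mate P x) x; first by rewrite !e.
by have := xP; rewrite setUC => /blockE[].
Qed.

Lemma mate_cover x : (x \in cover P.1) = (mate P x != x).
Proof.
apply/bigcupP/idP => [[B BP xB]|/mate_block xP]; last by exists [set x; mate P x]; rewrite ?set21.
have /eqP/cards2P[a [b [ab eB]]] := card2 BP.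
move: BP xB; rewrite eB => BP; rewrite !inE => /orP[]/eqP->.
  by have [_ ->] := blockE BP; rewrite eq_sym.
by rewrite setUC in BP; have [_ ->] := blockE BP.
Qed.

Lemma matching_of_valid : valid (matching_of P).
Proof.
have := hP; rewrite inE => /and5P[_ _ nc dj _].
apply/validP; split=> [x|x y|x] /=.
- by rewrite !ffunE mateK.
- rewrite !ffunE => xy yx; rewrite leqNgt; apply/negP => yy.
  have xP : [set x; mate P x] \in P.1.
    by apply: mate_block; rewrite neq_ltn (ltn_trans xy yx) orbT.
  have yP : [set y; mate P y] \in P.1.
    by apply: mate_block; rewrite neq_ltn (ltn_trans yx yy) orbT.
  move: nc => /forallP/(_ x)/forallP/(_ y)/forallP/(_ (mate P x))/forallP/(_ (mate P y)).
  by rewrite xy yx yy xP yP.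
- move=> xT; rewrite ffunE; apply/eqP; rewrite -[_ == _]negbK -mate_cover.
  by rewrite (disjointFr dj xT).
Qed.

Lemma left_columnE : left_column P = opens (matching_of P).
Proof.
apply/setP => x; rewrite !inE ffunE; congr (_ || _).
apply/existsP/idP => [[y /andP[xy /blockE[_ ->]]] //|xm].
by exists (mate P x); rewrite xm mate_block // neq_ltn xm orbT.
Qed.

Lemma right_columnE : right_column P = closes (matching_of P).
Proof.
apply/setP => x; rewrite !inE ffunE; congr (_ || _).
apply/existsP/idP => [[y /andP[xy]]|xm].
  by rewrite setUC => /blockE[_ ->].
by exists (mate P x); rewrite xm setUC mate_block // neq_ltn xm.
Qed.

Lemma pairing_ofK : pairing_of (matching_of P) = P.
Proof.
rewrite /pairing_of /=; case: P mate_cover mate_block card2 blockE => t T /= mc mb c2 bE.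
congr pair; apply/setP => B; apply/imsetP/idP => [[x]|BP].
  by rewrite inE ffunE => /mb xP ->.
have /eqP/cards2P[a [b [ab eB]]] := c2 _ BP.
have := BP; rewrite eB => /bE[_ e]; exists a; rewrite ?inE ffunE e //.
by rewrite eq_sym.
Qed.

(** Compatibility says nothing directly about the points outside S and T, where [loc] demands
    absence from I and J. That follows by counting. *)
Lemma compatibleE (R : comNzRingType) (I J : ksub k n) :
  bcoef (1 : R) (matching_of P) (val I, val J) = (compatible I J P)%:R.
Proof.
have hT x : x \in P.2 -> mate P x = x.
  by have /validP[_ _ h] := matching_of_valid; move=> /h; rewrite ffunE.
have lE x : loc (1 : R) (matching_of P) (val I, val J) x =
   (if mate P x == x then ((x \in val I) == (x \in P.2)) && ((x \in val J) == (x \in P.2))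
    else ((x \in val I) != (x \in val J)) && ((x \in val I) != (mate P x \in val I)))%:R.
  by rewrite /loc /= !ffunE; case: ifP => // _; rewrite if_same mulr1.
rewrite /bcoef (eq_bigr _ (fun x _ => lE x)) -natr_prod; congr (_%:R).
rewrite prod_nat_bool; congr nat_of_bool.
have := hP; rewrite inE => /and5P[_ _ _ dj /eqP cards].
apply/forallP/andP => [h|[/eqP eT /forallP hB] x].
  split.
    apply/eqP/setP => x; rewrite inE; have := h x; case: eqP => [_|/eqP fx].
      by case: (x \in val I); case: (x \in val J); case: (x \in P.2).
    have -> : (x \in P.2) = false by apply: contraNF fx => /hT ->.
    by case: (x \in val I); case: (x \in val J).
  apply/forallP => B; apply/implyP => BP.
  have /eqP/cards2P[a [b [ab eB]]] := card2 BP; rewrite eB in BP *.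
  have [_ ma] := blockE BP; have mb : mate P b = a by rewrite -ma mateK.
  have := h a; have := h b; rewrite ma mb (eq_sym b a) (negPf ab) !card2_setI // .
  by case: (a \in val I); case: (a \in val J); case: (b \in val I); case: (b \in val J).
case: eqP => [fx|/eqP fx].
  have xc : x \notin cover P.1 by rewrite mate_cover fx eqxx.
  case xT : (x \in P.2).
    by move: xT; rewrite -eT inE => /andP[-> ->].
  suff : x \notin val I :|: val J.
    by rewrite inE negb_or => /andP[/negPf -> /negPf ->].
  (* Both sides have cardinality 2k - |T| = |T| + |S|, so one inclusion is enough. *)
  have -> : val I :|: val J = P.2 :|: cover P.1.
    apply/esym/eqP; rewrite eqEcard; apply/andP; split.
      apply/subsetP => y; rewrite !inE => /orP[|].
        by rewrite -eT inE => /andP[->].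
      rewrite mate_cover => /mate_block yP.
      have [yne _] := blockE yP.
      have mc : mate P y \in cover P.1 by rewrite mate_cover mateK.
      have /andP[] := implyP (hB _) yP; rewrite !card2_setI //.
      have := disjointFl dj mc; rewrite -eT inE.
      by case: (y \in val I); case: (y \in val J); case: (_ \in val I); case: (_ \in val J).
    have := cardsUI (val I) (val J); rewrite eT (eqP (valP I)) (eqP (valP J)).
    rewrite (cardsU P.2) (_ : P.2 :&: cover P.1 = set0) ?cards0 ?subn0; first by lia.
    by apply/eqP; rewrite setI_eq0.
  by rewrite inE negb_or xT.
have mx : mate P (mate P x) != mate P x by rewrite mateK eq_sym.
have mT : (mate P x \in P.2) = false by apply: contraNF mx => /hT ->.
have xT : (x \in P.2) = false by apply: contraNF fx => /hT ->.
have /andP[] := implyP (hB _) (mate_block fx).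
rewrite !card2_setI 1?eq_sym //; move: mT xT; rewrite -eT !inE.
by case: (x \in val I); case: (x \in val J); case: (mate P x \in val I); case: (mate P x \in val J).
Qed.

End OnePairing.

End Pairings.

Lemma card_lead n (Q : matching n) : valid Q ->
  #|opens Q| = #|closes Q| /\ (2 * #|opens Q| = 2 * #|Q.2| + #|[set x | Q.1 x != x]|)%N.
Proof.
move=> vQ; have [fK nc hT] := validP _ vQ.
pose A := [set x : 'I_n | (x < Q.1 x)%N]; pose B := [set x : 'I_n | (Q.1 x < x)%N].
have oE : #|opens Q| = (#|Q.2| + #|A|)%N.
  have -> : opens Q = Q.2 :|: A by apply/setP => x; rewrite !inE.
  rewrite cardsU (_ : Q.2 :&: A = set0) ?cards0 ?subn0 //.
  by apply/setP => x; rewrite !inE; apply/negP => /andP[/hT ->]; rewrite ltnn.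
have cE : #|closes Q| = (#|Q.2| + #|B|)%N.
  have -> : closes Q = Q.2 :|: B by apply/setP => x; rewrite !inE.
  rewrite cardsU (_ : Q.2 :&: B = set0) ?cards0 ?subn0 //.
  by apply/setP => x; rewrite !inE; apply/negP => /andP[/hT ->]; rewrite ltnn.
have AB : #|A| = #|B|.
  rewrite -(card_imset (mem A) (inv_inj fK)); congr #|pred_of_set _|.
  apply/setP => x; rewrite inE; apply/imsetP/idP => [[y yA ->]|xB].
    by move: yA; rewrite !inE fK.
  by exists (Q.1 x); rewrite ?inE fK.
have mE : #|[set x | Q.1 x != x]| = (#|A| + #|B|)%N.
  have -> : [set x | Q.1 x != x] = A :|: B.
    by apply/setP => x; rewrite !inE -val_eqE neq_ltn orbC.
  rewrite cardsU (_ : A :&: B = set0) ?cards0 ?subn0 //.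
  by apply/setP => x; rewrite !inE; apply/negP => /andP[]; case: ltngtP.
by rewrite oE cE mE AB; split=> //; lia.
Qed.

(** * Theta as a bijection onto semistandard tableaux *)

Section Theta.
Variables (k n : nat) (hkn : (k <= n)%N).
Implicit Types (P : pairing n) (S : tableau k n).

Lemma card_lead_pairing P : P \in pairings k n ->
  #|opens (matching_of P)| = k /\ #|closes (matching_of P)| = k.
Proof.
move=> hP; have [e1 e2] := card_lead (matching_of_valid hP).
have := hP; rewrite inE => /and5P[_ _ _ _ /eqP cards].
have cE : [set x | (matching_of P).1 x != x] = cover P.1.
  by apply/setP => x; rewrite inE ffunE (mate_cover hP).
rewrite cE in e2; rewrite -e1; suff -> : #|opens (matching_of P)| = k by [].
by apply/eqP; rewrite -(eqn_pmul2l (isT : 0 < 2)%N) e2 cards.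
Qed.

Lemma thetaE P r c : P \in pairings k n -> theta hkn P r c =
  nth (widen_ord hkn r) (enum (if c == ord0 then opens (matching_of P) else closes (matching_of
    P))) r.
Proof. by move=> hP; rewrite mxE (left_columnE hP) (right_columnE hP). Qed.

Lemma theta_ssyt P : P \in pairings k n -> ssyt (theta hkn P).
Proof.
move=> hP; have [co cc] := card_lead_pairing hP.
have vQ := matching_of_valid hP; have [fK nc hT] := validP _ vQ.
apply/ssytP; split=> [r|c r s rs]; rewrite !thetaE //=.
  (* The injection from the right column to the left one fixes T and sends a right end to the left
     end of its strand. *)
  apply: (@nth_enum_le _ _ _ (fun y => if y \in P.2 then y else (matching_of P).1 y)).
  - move=> y z _ _; case: ifP => yT; case: ifP => zT // e.
    + have ez : z = y by rewrite -(fK z) -e hT.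
      by rewrite ez yT in zT.
    + have ey : y = z by rewrite -(fK y) e hT.
      by rewrite ey zT in yT.
    + exact: (inv_inj fK).
  - move=> y; rewrite !inE; case: ifP => [yT|yT /= lt]; first by rewrite yT.
    by rewrite fK lt orbT ltnW.
  - by rewrite cc.
  - by rewrite co.
have sz : size (enum (if c == ord0 then opens (matching_of P) else closes (matching_of P))) = k.
  by case: ifP => _; rewrite -cardE ?co ?cc.
rewrite (set_nth_default (widen_ord hkn r)) ?sz //.
have trn : transitive (fun x y : 'I_n => (x < y)%N) by move=> ? ? ?; apply: ltn_trans.
by apply: (sorted_ltn_nth trn _ (enum_set_sorted _)) => //; rewrite inE sz.
Qed.

Lemma cols_theta P : P \in pairings k n -> cols (theta hkn P) = lead (matching_of P).
Proof.
move=> hP; have [co cc] := card_lead_pairing hP.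
have h (A : {set 'I_n}) c : #|A| = k ->
    (forall r, theta hkn P r c = nth (widen_ord hkn r) (enum A) r) -> colset (theta hkn P) c = A.
  move=> cA e; apply/setP => x; apply/mem_colset/idP => [[r <-]|].
    by rewrite e -mem_enum mem_nth // -cardE cA.
  rewrite -mem_enum => xA; have ix : (index x (enum A) < k)%N by rewrite -cA cardE index_mem.
  by exists (Ordinal ix); rewrite e /= nth_index.
by congr pair; apply: h => // r; rewrite thetaE.
Qed.

Lemma theta_inj : {in pairings k n &, injective (theta hkn)}.
Proof.
move=> P P' hP hP' e.
have eQ : matching_of P = matching_of P'.
  apply: lead_inj; rewrite ?(matching_of_valid hP) ?(matching_of_valid hP') //.
  by rewrite -!cols_theta // e.
by rewrite -(pairing_ofK hP) eQ (pairing_ofK hP').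
Qed.

Lemma ssyt_cols_inj S S' : ssyt S -> ssyt S' -> cols S = cols S' -> S = S'.
Proof.
move=> hS hS' [e0 e1].
have enumE (U : tableau k n) c : ssyt U -> enum (colset U c) = [seq U r c | r <- enum 'I_k].
  move=> hU; apply: enum_set_eq.
    rewrite sorted_map; apply: (@sub_sorted _ (fun r s : 'I_k => (r < s)%N)).
      by move=> r s /= rs; rewrite (ssyt_lt c hU).
    by have := iota_ltn_sorted 0 k; rewrite -val_enum_ord sorted_map.
  move=> x; apply/mapP/mem_colset => [[r _ ->]|[r <-]]; first by exists r.
  by exists r; rewrite ?mem_enum.
have ec c : colset S c = colset S' c by case: (ord2P c) => ->.
apply/matrixP => r c.
have := enumE S c hS; rewrite ec (enumE S' c hS') => /eq_in_map -> //.
by rewrite mem_enum.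
Qed.

(** The matching Q will come from [crystal_path], which carries one along a path instead of
    bracketing the two columns of S. *)
Lemma theta_onto S Q : ssyt S -> valid Q -> lead Q = cols S ->
  exists2 P, P \in pairings k n & theta hkn P = S.
Proof.
move=> hS vQ hQ; have [fK nc hT] := validP _ vQ; have fI := inv_inj fK.
have [e1 e2] := card_lead vQ.
have co : #|opens Q| = k.
  have -> : opens Q = colset S ord0 by case: hQ.
  by rewrite /colset card_imset ?card_ord //; apply: ssyt_inj.
have blockP B : reflect (exists2 x, Q.1 x != x & B = [set x; Q.1 x]) (B \in (pairing_of Q).1).
  by apply: (iffP imsetP) => -[x xQ ->]; exists x => //; rewrite inE in xQ *.
have in_block x y : Q.1 x != x -> (y \in [set x; Q.1 x]) -> [set x; Q.1 x] = [set y; Q.1 y].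
  by move=> _; rewrite !inE => /orP[]/eqP->; rewrite ?fK // setUC.
have coverE : cover (pairing_of Q).1 = [set x | Q.1 x != x].
  apply/setP => x; rewrite inE; apply/bigcupP/idP => [[B /blockP[y yQ ->]]|xQ].
    by rewrite !inE => /orP[]/eqP->; rewrite // fK eq_sym.
  by exists [set x; Q.1 x]; [apply/blockP; exists x | rewrite set21].
have hP : pairing_of Q \in pairings k n.
  rewrite inE; apply/and5P; split.
  - apply/trivIsetP => A B /blockP[x xQ ->] /blockP[y yQ ->];
    apply: contraR => /pred0Pn[z /andP[/= zx zy]].
    by rewrite (in_block x z) // (in_block y z).
  - apply/forallP => B; apply/implyP => /blockP[x xQ ->]; by rewrite cards2 (eq_sym x) xQ.
  - apply/forallP => a; apply/forallP => b; apply/forallP => c; apply/forallP => d.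
    apply/implyP => /and3P[ab bc cd]; apply/negP => /andP[/blockP[x xQ ex] /blockP[y yQ ey]].
    have fa : Q.1 a = c.
      have ax : a \in [set x; Q.1 x] by rewrite -ex set21.
      have := set22 a c; rewrite ex (in_block x a) // !inE => /orP[/eqP e|/eqP //].
      by move: (ltn_trans ab bc); rewrite e ltnn.
    have fb : Q.1 b = d.
      have byy : b \in [set y; Q.1 y] by rewrite -ey set21.
      have := set22 b d; rewrite ey (in_block y b) // !inE => /orP[/eqP e|/eqP //].
      by move: (ltn_trans bc cd); rewrite e ltnn.
    by have := nc a b ab; rewrite fa fb => /(_ bc); rewrite leqNgt cd.
  - rewrite coverE disjoints_subset; apply/subsetP => x /hT e; by rewrite !inE e eqxx.
  - by rewrite coverE /= -e2 co.
exists (pairing_of Q) => //.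
have eQ : matching_of (pairing_of Q) = Q.
  apply: matching_eq => //; apply/ffunP => x; rewrite ffunE.
  have [e|xQ] := eqVneq (Q.1 x) x.
    by rewrite e; apply/eqP; rewrite -[_ == _]negbK -(mate_cover hP) coverE inE e eqxx.
  by have [] := @blockE _ _ _ hP x (Q.1 x) _; first by apply/blockP; exists x.
apply: ssyt_cols_inj => //; first exact: theta_ssyt.
by rewrite cols_theta // eQ.
Qed.

End Theta.

(** * Crystal paths *)

Section Kashiwara.
Variables (n : nat) (F : fieldType) (u : F) (i : 'I_n.-1).

Lemma sw_eq (I J : {set 'I_n}) : (sw i I == J) = (I == sw i J).
Proof. by rewrite -(inj_eq (inv_inj (sw_sw i))) sw_sw. Qed.

(** Together with [ft_tbasis_left], this is the tensor product rule of crystals modulo u: the second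
    summand is the error here, and (1 + u^2)^-1 is 1 modulo u there. *)
Lemma ft_tbasis_right I J : isu i J -> ~~ isd i I ->
  ft u i (tbasis F (I, J)) =
  tbasis F (I, sw i J) + (u * (isu i I)%:R) *: tbasis F (sw i I, J).
Proof.
move=> uJ /negPf dI; apply/ffunP => -[A B]; rewrite !ffunE /GRing.scale /= !xpair_eqE !sw_eq.
have dJ := isu_isd uJ.
have nA : isd i A -> (A == I) = false by move=> dA; apply/negP => /eqP e; rewrite e dI in dA.
have nB : isd i B -> (B == J) = false by move=> dB; apply/negP => /eqP e; rewrite e dJ in dB.
have nB' : isu i B = false -> (B == J) = false by move=> dB; apply/negP => /eqP e;
  rewrite e uJ in dB.
have nA' : isd i A = false -> (isu i I)%:R * ((A == sw i I) && (B == J))%:R = 0 :> F.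
  move=> dA; case: eqP => [e|_]; last by rewrite mulr0.
  by rewrite e isd_sw in dA; rewrite dA mul0r.
have nA2 : isd i A -> (u * (isu i I)%:R) * ((A == sw i I) && (B == J))%:R = u * ((A == sw i I) &&
  (B == J))%:R :> F.
  move=> dA; case: eqP => [e|_]; last by rewrite !mulr0.
  by rewrite e isd_sw in dA; rewrite dA mulr1.
have nB2 : isd i B = false -> (B == sw i J) = false.
  by move=> dB; apply/negP => /eqP e; rewrite e isd_sw uJ in dB.
case dA: (isd i A); last first.
  rewrite -mulrA nA' // mulr0 addr0; case dB: (isd i B) => //.
  by rewrite nB2 // andbF.
rewrite (nA dA) nA2 //= add0r; case dB: (isd i B).
  by rewrite !(nB dB) !andbF !mulr0 add0r mul0r.
by case uB: (isu i B) => //; rewrite (nB' uB) andbF mulr0.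
Qed.

Lemma ft_tbasis_left I J : isu i I -> isd i J ->
  ft u i (tbasis F (I, J)) = (1 + u ^+ 2)^-1 *: tbasis F (sw i I, J).
Proof.
move=> uI dJ; apply/ffunP => -[A B]; rewrite !ffunE /GRing.scale /= !xpair_eqE !sw_eq.
have dI := isu_isd uI.
have nA : isd i A -> (A == I) = false by move=> dA; apply/negP => /eqP e; rewrite e dI in dA.
have nA' : isd i A = false -> (A == sw i I) = false.
  by move=> dA; apply/negP => /eqP e; rewrite e isd_sw uI in dA.
have nB : isd i B = false -> (B == J) = false by move=> dB; apply/negP => /eqP e;
  rewrite e dJ in dB.
have nB' : isd i B -> (B == sw i J) = false.
  by move=> dB; apply/negP => /eqP e; rewrite e isd_sw (isd_isu dJ) in dB.
case dA: (isd i A).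
  rewrite (nA dA) /=; case dB: (isd i B); first by rewrite mulr0 addr0 mulrC.
  by rewrite (nB dB) andbF !mulr0 if_same.
by rewrite (nA' dA) /= mulr0; case dB: (isd i B) => //; rewrite (nB' dB) andbF.
Qed.

End Kashiwara.

Lemma regroup_right (K : fieldType) (W : lmodType K) (a b : K) (x y z : W) :
  x + (a * b) *: y + a *: z = x + a *: (z + b *: y).
Proof. by rewrite scalerDr scalerA -addrA [a *: z + _]addrC. Qed.

Lemma regroup_left (K : fieldType) (W : lmodType K) (u : K) (x z : W) : 1 + u ^+ 2 != 0 ->
  (1 + u ^+ 2)^-1 *: x + u *: z = x + u *: (z - (u / (1 + u ^+ 2)) *: x).
Proof.
move=> u2; rewrite scalerBr scalerA addrA addrAC -[in X in X - _](scale1r x) -scalerBl.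
by congr (_ *: _ + _); field.
Qed.

Lemma cong_mod_q_ft n (i : 'I_n.-1) y p p' : cong_mod_q y p -> cmove i p p' -> cong_mod_q (ft qq
  i y) p'.
Proof.
case: p => I J; move=> [z lz ->] [[/= uJ dI ->]|[/= uI dJ ->]]; rewrite linearD linearZ /=.
  exists (ft qq i z + (isu i I)%:R *: tbasis Qq (sw i I, J)).
    apply: in_latticeD; first exact: in_lattice_ft.
    apply: in_latticeZ; last exact: in_lattice_tbasis.
    by case: (isu i I); [exact: regular_1 | exact: regular_0].
  by rewrite (ft_tbasis_right _ uJ dI); exact: regroup_right.
exists (ft qq i z - (qq / (1 + qq ^+ 2)) *: tbasis Qq (sw i I, J)).
  apply: in_latticeD; first exact: in_lattice_ft.
  rewrite -scaleNr; apply: in_latticeZ; last exact: in_lattice_tbasis.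
  rewrite -mulNr; apply: regularM; last exact: regular_inv_qq2.
  by rewrite -(rmorphN tf); exact: regular_tf.
by rewrite (ft_tbasis_left _ uI dJ); exact: (regroup_left _ _ qq2_neq0).
Qed.

(** * Crystal moves realized on matchings *)

Section LeadMoves.
Variables (n : nat) (i : 'I_n.-1).
Implicit Types (Q : matching n) (x : 'I_n).
Local Notation a := (low i).
Local Notation b := (high i).
Local Notation s := (tperm (low i) (high i)).

Lemma lead_movem Q : valid Q -> Q.1 a = a \/ Q.1 b = b ->
  lead (movem i Q) = (sw i (opens Q), sw i (closes Q)).
Proof.
move=> vQ fab; have [fK nc hT] := validP _ vQ; have fI := inv_inj fK.
have [z [ez zab]] : exists z, Q.1 z = z /\ (z = a \/ z = b).
  by case: fab => e; [exists a | exists b]; auto.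
have mono x : ((s x < s (Q.1 x)) = (x < Q.1 x))%N /\ ((s (Q.1 x) < s x) = (Q.1 x < x))%N.
  have [e|fx] := eqVneq (Q.1 x) x; first by rewrite e !ltnn.
  have xz : x != z by apply: contraNneq fx => ->; rewrite ez.
  have fxz : Q.1 x != z by rewrite -ez (inj_eq fI).
  case: (ltngtP x (Q.1 x)) => [lt|lt|/val_inj e]; last by rewrite -e eqxx in fx.
    by have h := tperm_ltn zab xz fxz lt; rewrite h ltnNge (ltnW h).
  by have h := tperm_ltn zab fxz xz lt; rewrite h ltnNge (ltnW h).
by congr pair; apply/setP => x; rewrite !inE ffunE; have [m1 m2] := mono (s x);
  rewrite -?m1 -?m2 tpermK.
Qed.

Lemma lead_cmove Q p' : valid Q -> cmove i (lead Q) p' -> exists2 Q', valid Q' & lead Q' = p'.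
Proof.
move=> vQ; have [fK nc hT] := validP _ vQ; have fI := inv_inj fK.
have ab := low_neq_high i; have ba := high_neq_low i.
have ltab : (a < b)%N by [].
have fix_oc x : x \in opens Q -> x \in closes Q -> x \in Q.2.
  by rewrite !inE; case: (x \in Q.2) => //= h1 h2; have := ltn_trans h1 h2; rewrite ltnn.
have fix_none x : x \notin opens Q -> x \notin closes Q -> Q.1 x = x.
  rewrite !inE !negb_or => /andP[_ h1] /andP[_ h2]; apply: val_inj.
  by move: h1 h2; case: ltngtP.
case=> [[/= /andP[ac bc] dI ->]|[/= /andP[ao bo] /andP[ac bc] ->]].
- rewrite /isd negb_and negbK in dI.
  have [ao|ao] := boolP (a \in opens Q); have [bo|bo] := boolP (b \in opens Q).
  + have aT := fix_oc _ ao ac; have fa := hT _ aT.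
    exists (movem i Q); first by apply: movem_valid; auto.
    by rewrite lead_movem; auto; rewrite sw_in.
  + have aT := fix_oc _ ao ac; have fa := hT _ aT; have fb := fix_none _ bo bc.
    have bT : b \notin Q.2 by move: bo; rewrite inE negb_or => /andP[].
    exists (cupm i Q); first exact: cupm_valid.
    congr pair; apply/setP => x; rewrite !inE !ffunE.
      have [->|xa] := eqVneq x a; first by rewrite aT ltab orbT.
      have [->|xb] //= := eqVneq x b.
      by rewrite (negPf bT) fb ltnn ltnNge ltnW.
    case: (tpermP a b x) => [->|->|/eqP xa /eqP xb].
    * by rewrite !eqxx /= (negPf bT) fb ltnn ltnNge ltnW.
    * by rewrite ba !eqxx /= ltab orbT aT.
    * by rewrite (negPf xa) (negPf xb).
  + by rewrite (negPf ao) bo in dI.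
  + have fb := fix_none _ bo bc.
    exists (movem i Q); first by apply: movem_valid; auto.
    by rewrite lead_movem; auto; rewrite (sw_notin ao bo).
have aT : a \notin Q.2 by apply: contra ac; rewrite inE => ->.
have bT : b \notin Q.2 by apply: contra bo; rewrite inE => ->.
have fa : (a < Q.1 a)%N by move: ao; rewrite inE (negPf aT).
have fb : (Q.1 b < b)%N by move: bc; rewrite inE (negPf bT).
(* The adjacent points a, opening, and b, closing, are matched to each other; otherwise their
   strands would cross. *)
have fab : Q.1 a = b.
  apply/eqP; apply: contraT => ne.
  have fba : Q.1 b != a by apply: contraNneq ne => <-; rewrite fK.
  have nea : Q.1 a != a by rewrite neq_ltn fa orbT.
  have neb : Q.1 b != b by rewrite neq_ltn fb.
  have [_ o2 _] := ltn_low_high nea ne; have [o1 _ o3] := ltn_low_high fba neb.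
  rewrite o2 in fa; have fb' : (Q.1 b < a)%N by rewrite o3 -o1.
  by have := nc _ _ fb'; rewrite fK => /(_ ltab); rewrite leqNgt fa.
have fba : Q.1 b = a by rewrite -fab fK.
exists (capm i Q).
  by apply: capm_valid; rewrite // ?fab ?fba ?ab ?ba.
have gE x : x != a -> x != b -> (capm i Q).1 x = Q.1 x.
  move=> xa xb; rewrite ffunE (negPf xa) (negPf xb) /=.
  have -> : (Q.1 x == a) = false by rewrite -fba (inj_eq fI) (negPf xb).
  by have -> : (Q.1 x == b) = false by rewrite -fab (inj_eq fI) (negPf xa).
have ga : (capm i Q).1 a = a by rewrite ffunE eqxx.
have gb : (capm i Q).1 b = b by rewrite ffunE eqxx orbT.
congr pair; apply/setP => x.
  rewrite [in LHS]inE [in RHS]inE; case: (tpermP a b x) => [->|->|/eqP xa /eqP xb].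
  + by rewrite ga ltnn (negPf bo) !inE ab (negPf aT).
  + by rewrite gb ltnn ao !inE eqxx.
  + by rewrite gE // !inE (negPf xb).
rewrite [in LHS]inE; have [->|xa] := eqVneq x a.
  by rewrite ga ltnn (negPf ac) !inE ab (negPf aT).
have [->|xb] := eqVneq x b; first by rewrite gb ltnn bc !inE eqxx.
by rewrite gE // !inE (negPf xb).
Qed.

End LeadMoves.

Section Path.
Variables (k n : nat) (hkn : (k <= n)%N).
Variables (V : vectType Qq) (M : Uq_module n V) (v : V).
Hypothesis hM : Uq_irreducible M.
Hypothesis hv : highest_weight_vector k M v.

Lemma colset_top c : colset (top_tableau hkn) c = top_set k n.
Proof.
apply/setP => x; rewrite inE; apply/mem_colset/idP => [[r <-]|xk]; first by rewrite mxE /=.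
by exists (Ordinal xk); rewrite mxE; apply: val_inj.
Qed.

(** The three conclusions belong to one induction on the sum of the entries, since the word, the
    residue modulo q and the matching are all extended by the raising step of [ssyt_descend]. *)
Lemma crystal_path S : ssyt S -> exists w, [/\ ftab_word hkn w = Some S,
  forall b, kashiwara_word M v w b -> exists2 y, gen k M v b y & cong_mod_q y (cols S) &
  exists2 Q, valid Q & lead Q = cols S].
Proof.
have [m] := ubnP (tab_weight S); elim: m S => // m IHm S lem hS.
have [->|nt] := eqVneq S (top_tableau hkn).
  exists [::]; split=> //.
    move=> b /= ->; exists (tvac k n Qq); first exact: gen_hw.
    exists 0; first exact: in_lattice0.
    by rewrite scaler0 addr0 /cols !colset_top.
  by exists (vac_matching n k); [apply: vac_matching_valid | rewrite lead_vac /cols !colset_top].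
have [i [S' [hS' fS cm lt]]] := ssyt_descend hS nt.
have [w [hw hk [Q vQ lQ]]] := IHm S' (leq_trans lt lem) hS'.
exists (i :: w); split.
- by rewrite /= /ftab_word /= -/(ftab_word hkn w) hw.
- move=> b /= [x /hk[y gy cy] kf]; exists (ft qq i y).
    exact: gen_kashiwara kf gy.
  exact: cong_mod_q_ft cm.
- by apply: (@lead_cmove _ i Q); rewrite ?lQ.
Qed.

End Path.

(** * Specialization at q = 1 *)

Section Subsets.
Variables (k n : nat).
Implicit Types (I J : ksub k n) (i : 'I_n.-1).

Fact swk_proof i I : #|sw i (val I)| == k.
Proof. by rewrite card_sw (valP I). Qed.
Definition swk i I : ksub k n := Sub (sw i (val I)) (swk_proof i I).

Lemma lowersE i I J : lowers i I J = isd i (val J) && (I == swk i J).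
Proof.
have hl := high_neq_low i; have lh := low_neq_high i.
rewrite /lowers /isd; apply/and3P/andP => [[lI hI /eqP eJ]|[/andP[lJ hJ] /eqP eI]].
  split; first by rewrite eJ !inE !eqxx lh.
  apply/eqP/val_inj/setP => x; rewrite /= inE eJ !inE.
  case: tpermP => [->|->|/eqP /negPf xl /eqP /negPf xh]; rewrite ?eqxx ?hl ?lh //=.
    exact: negbTE.
  by rewrite xl xh.
have vI : val I = sw i (val J) by rewrite eI.
rewrite vI low_in_sw high_in_sw; split=> //; apply/eqP/setP => x.
rewrite !inE; case: tpermP => [->|->|/eqP /negPf xl /eqP /negPf xh].
- by rewrite lh eqxx; apply: negbTE.
- by rewrite eqxx.
- by rewrite xl xh.
Qed.

Lemma ksub_nthE I (x0 : 'I_n) r : ksub_nth I r = nth x0 (enum (val I)) r.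
Proof. by rewrite /ksub_nth (enum_val_nth x0). Qed.

Lemma ksub_nth_in I r : ksub_nth I r \in val I.
Proof. exact: enum_valP. Qed.

Lemma ksub_nth_inj I : injective (ksub_nth I).
Proof. by move=> r r' /enum_val_inj /cast_ord_inj. Qed.

Lemma ksub_nth_onto I x : x \in val I -> exists r, ksub_nth I r = x.
Proof.
move=> xI; exists (cast_ord (eqP (valP I)) (enum_rank_in xI x)).
by rewrite /ksub_nth cast_ord_comp cast_ord_id enum_rankK_in.
Qed.

Lemma ksub_nth_swk i I r : isd i (val I) ->
  ksub_nth (swk i I) r = tperm (low i) (high i) (ksub_nth I r).
Proof.
move=> /andP[lI hI]; rewrite !(ksub_nthE _ (low i)) /=.
have -> : enum (sw i (val I)) = map (tperm (low i) (high i)) (enum (val I)).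
  apply: enum_set_eq; last first.
    move=> x; rewrite inE; apply/mapP/idP => [[y yI ->]|xI].
      by rewrite tpermK -mem_enum.
    by exists (tperm (low i) (high i) x); rewrite ?mem_enum ?tpermK.
  rewrite sorted_map; apply: (@sub_in_sorted _ (mem (val I)) (fun x y : 'I_n => (x < y)%N)).
  - move=> x y /= xI yI; apply: (@tperm_ltn _ _ (low i)); first by left.
      by apply: contraNneq lI => <-.
    by apply: contraNneq lI => <-.
  - by apply/allP => x; rewrite mem_enum.
  - exact: enum_set_sorted.
by rewrite (nth_map (low i)) // -cardE (eqP (valP I)).
Qed.

End Subsets.

(** * Minors under elementary row operations *)

Section Minors.
Variables (C : fieldType) (k n : nat).
Implicit Types (I J : ksub k n) (i : 'I_n.-1) (g : 'M[C]_n).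

Definition minor I J g : C := \det (mxsub (ksub_nth I) (ksub_nth J) g).

(** The product (1 + s E_(i+1,i)) g. *)
Definition shear i (s : C) g : 'M[C]_n :=
  \matrix_(x, y) (g x y + s * (x == high i)%:R * g (low i) y).

(** By linearity in the row of [high i], the correction is s times the minor with that row replaced
    by the row of [low i]. It has two equal rows if [low i] is in I; otherwise it is the minor of
    the swapped subset, without sign because the two letters are adjacent. *)
Lemma minor_shear i s I J g :
  minor I J (shear i s g) = minor I J g + s * (isd i (val I))%:R * minor (swk i I) J g.
Proof.
case hI : (high i \in val I); last first.
  have -> : isd i (val I) = false by rewrite /isd hI andbF.
  rewrite mulr0 mul0r addr0 /minor; congr (\det _); apply/matrixP => r c; rewrite !mxE.
  have -> : (ksub_nth I r == high i) = false.
    by apply: contraFF hI => /eqP <-; apply: ksub_nth_in.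
  by rewrite mulr0 mul0r addr0.
have [r0 hr0] := ksub_nth_onto hI.
pose A := mxsub (fun r => if r == r0 then low i else ksub_nth I r) (ksub_nth J) g.
have nr r : r != r0 -> (ksub_nth I r == high i) = false.
  by move=> /negPf rr; rewrite -hr0 (inj_eq (@ksub_nth_inj _ _ I)).
have -> : minor I J (shear i s g) = 1 * minor I J g + s * \det A.
  apply: (@determinant_multilinear _ _ _ _ _ r0).
  - by apply/rowP => c; rewrite !mxE eqxx hr0 eqxx mul1r mulr1.
  - by apply/matrixP => r c; rewrite !mxE nr ?mulr0 ?mul0r ?addr0 // eq_sym neq_lift.
  - apply/matrixP => r c; rewrite !mxE eq_sym (negPf (neq_lift _ _)).
    by rewrite nr ?mulr0 ?mul0r ?addr0 // eq_sym neq_lift.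
rewrite mul1r -mulrA; congr (_ + s * _).
case lI : (low i \in val I).
  have -> : isd i (val I) = false by rewrite /isd lI.
  have [r1 hr1] := ksub_nth_onto lI.
  have r10 : r1 != r0.
    by apply/eqP => e; move: hr1; rewrite e hr0 => /eqP; rewrite high_neq_low.
  rewrite mul0r; apply: (determinant_alternate r10) => c.
  by rewrite !mxE eqxx (negPf r10) hr1.
have dI : isd i (val I) by rewrite /isd lI hI.
rewrite dI mul1r /minor; congr (\det _); apply/matrixP => r c; rewrite !mxE.
rewrite ksub_nth_swk //; case: eqP => [->|/eqP rr]; first by rewrite hr0 tpermR.
rewrite tpermD // eq_sym ?nr //.
by apply: contraFneq lI => <-; apply: ksub_nth_in.
Qed.

Lemma shear_unit i s g : g \in unitmx -> shear i s g \in unitmx.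
Proof.
rewrite !unitmxE; suff -> : \det (shear i s g) = \det g by [].
pose A : 'M[C]_n := \matrix_(x, y) (if x == high i then g (low i) y else g x y).
have -> : \det (shear i s g) = 1 * \det g + s * \det A.
  apply: (@determinant_multilinear _ _ _ _ _ (high i)).
  - by apply/rowP => c; rewrite !mxE eqxx mul1r mulr1.
  - by apply/matrixP => r c; rewrite !mxE eq_sym (negPf (neq_lift _ _)) mulr0 mul0r addr0.
  - by apply/matrixP => r c; rewrite !mxE eq_sym (negPf (neq_lift _ _)) mulr0 mul0r addr0.
have lh := low_neq_high i.
rewrite mul1r (_ : \det A = 0) ?mulr0 ?addr0 //.
apply: (determinant_alternate (negbT lh)) => c.
by rewrite !mxE eqxx lh.
Qed.

Lemma minor1 I J : minor I J 1%:M = (I == J)%:R.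
Proof.
rewrite /minor; case: eqP => [->|/eqP IJ].
  rewrite -[RHS](det1 _ k); congr (\det _); apply/matrixP => r c; rewrite !mxE.
  by rewrite (inj_eq (@ksub_nth_inj _ _ J)).
have [x xI xJ] : exists2 x, x \in val I & x \notin val J.
  apply/subsetPn; apply: contra IJ => sIJ; apply/eqP/val_inj/eqP.
  by rewrite eqEcard sIJ (eqP (valP I)) (eqP (valP J)) leqnn.
have [r hr] := ksub_nth_onto xI.
rewrite (expand_det_row _ r) big1 // => c _; rewrite !mxE hr.
have -> : (x == ksub_nth J c) = false.
  by apply: contraNF xJ => /eqP ->; apply: ksub_nth_in.
by rewrite mul0r.
Qed.

End Minors.

Section Classical.
Variables (C : numFieldType) (k n : nat).
Implicit Types (i : 'I_n.-1) (x y : Ext2 C k n) (t : tensor n C).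

Definition restr t : Ext2 C k n := [ffun p => t (val p.1, val p.2)].

Lemma restrD t t' : restr (t + t') = restr t + restr t'.
Proof. by apply/ffunP => p; rewrite !ffunE. Qed.

Lemma restrZ (a : C) t : restr (a *: t) = a *: restr t.
Proof. by apply/ffunP => p; rewrite !ffunE. Qed.

Lemma restr_sum (I : Type) (r : seq I) (P : pred I) (f : I -> tensor n C) :
  restr (\sum_(j <- r | P j) f j) = \sum_(j <- r | P j) restr (f j).
Proof.
apply: (big_morph restr restrD); by apply/ffunP => p; rewrite !ffunE.
Qed.

Lemma f1E i x p : f1 i x p =
  (isd i (val p.1))%:R * (x (swk i p.1, p.2) : C) + (isd i (val p.2))%:R * (x (p.1, swk i p.2) :
    C) :> C.
Proof.
rewrite ffunE; congr (_ + _).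
  rewrite (eq_bigl (fun I => isd i (val p.1) && (I == swk i p.1))); last first.
    by move=> I; rewrite lowersE.
  by case: (isd i (val p.1)); rewrite /= ?big_pred0_eq ?mul0r // big_pred1_eq mul1r.
rewrite (eq_bigl (fun I => isd i (val p.2) && (I == swk i p.2))); last first.
  by move=> I; rewrite lowersE.
by case: (isd i (val p.2)); rewrite /= ?big_pred0_eq ?mul0r // big_pred1_eq mul1r.
Qed.

Lemma f1_restr i t : f1 i (restr t) = restr (tF 1 i t).
Proof.
apply/ffunP => p; rewrite f1E !ffunE /= addrC.
have -> : kap 1 i (val p.2) = 1 :> C by rewrite /kap invr1 !if_same.
by rewrite mulr1.
Qed.

Lemma vplus_restr : vplus C k n = restr (tvac k n C).
Proof. by apply/ffunP => p; rewrite !ffunE xpair_eqE. Qed.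

Lemma qfactorials_fact : qfactorials (1 : C) (fun a => a`!%:R).
Proof.
split=> // [|a]; first by rewrite invr1.
by rewrite pnatr_eq0 -lt0n fact_gt0.
Qed.

Lemma eval_1_restr (s : integral_form n) :
  eval_1 C k s = restr (teval k 1 (fun a => a`!%:R) 1 s).
Proof.
rewrite /teval restr_sum; apply: eq_bigr => -[[p m] w] _ /=; rewrite restrZ.
have -> : ev p 1 / 1 ^+ m = (p.[1])%:~R :> C.
  by rewrite expr1n divr1 /ev -(rmorph1 (intr : int -> C)) horner_map.
congr (_ *: _); elim: w => [|[i a] w IHw] /=; first exact: vplus_restr.
rewrite IHw /divf1 restrZ; congr (_ *: _).
by elim: a => //= a ->; rewrite f1_restr.
Qed.

Lemma inV2_0 : inV2 (0 : Ext2 C k n).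
Proof. by exists 0%N, (fun _ => 0), (fun _ => 0); split=> [[]//|]; rewrite big_ord0. Qed.

Lemma inV2D x y : inV2 x -> inV2 y -> inV2 (x + y).
Proof.
move=> [m [c [g [hg ->]]]] [m' [c' [g' [hg' ->]]]].
exists (m + m')%N, (fun j => match split j with inl a => c a | inr a => c' a end),
  (fun j => match split j with inl a => g a | inr a => g' a end); split.
  by move=> j; case: (split j).
rewrite big_split_ord /=; congr (_ + _); apply: eq_bigr => j _.
  by rewrite -[lshift _ _]/(unsplit (inl j)) unsplitK.
by rewrite -[rshift _ _]/(unsplit (inr j)) unsplitK.
Qed.

Lemma inV2Z (a : C) x : inV2 x -> inV2 (a *: x).
Proof.
move=> [m [c [g [hg ->]]]]; exists m, (fun j => a * c j), g; split=> //.
by rewrite scaler_sumr; apply: eq_bigr => j _; rewrite scalerA.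
Qed.

Lemma inV2_sum (I : Type) (r : seq I) (P : pred I) (f : I -> Ext2 C k n) :
  (forall j, P j -> inV2 (f j)) -> inV2 (\sum_(j <- r | P j) f j).
Proof.
by move=> h; elim/big_rec: _ => [|j x Pj]; [apply: inV2_0 | apply: inV2D; apply: h].
Qed.

Lemma GL_act1 x : GL_act 1%:M x = x.
Proof.
apply/ffunP => p; rewrite ffunE (bigD1 p) //= big1 ?addr0 => [|r rp].
  by rewrite -!/(minor _ _ _) !minor1 !eqxx !mul1r.
rewrite -!/(minor _ _ _) !minor1; case: eqP => e1; last by rewrite !mul0r.
case: eqP => e2; last by rewrite mulr0 mul0r.
by case: p r rp e1 e2 => [I J] [I' J'] /= rp e1 e2; rewrite e1 e2 eqxx in rp.
Qed.

Lemma inV2_vplus : inV2 (vplus C k n).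
Proof.
exists 1%N, (fun _ => 1), (fun _ => 1%:M); split=> [j|]; first exact: unitmx1.
by rewrite big_ord1 scale1r GL_act1.
Qed.

(* The action of 1 + s E is quadratic in s, with linear term f_i. *)
Lemma f1_GL_act i g x : f1 i (GL_act g x) =
  2^-1 *: (GL_act (shear i 1 g) x + (-1) *: GL_act (shear i (-1) g) x).
Proof.
apply/ffunP => p; rewrite f1E !ffunE /GRing.scale /= mulN1r -sumrB !mulr_sumr -big_split /=.
apply: eq_bigr => r _; rewrite -!/(minor _ _ _) !minor_shear.
have two : (2 : C) != 0 by rewrite pnatr_eq0.
by field.
Qed.

Lemma inV2_f1 i x : inV2 x -> inV2 (f1 i x).
Proof.
move=> [m [c [g [hg ->]]]].
have -> : f1 i (\sum_(j < m) c j *: GL_act (g j) (vplus C k n)) =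
    \sum_(j < m) c j *: f1 i (GL_act (g j) (vplus C k n)).
  apply/ffunP => p; rewrite f1E !sum_ffunE !mulr_sumr -big_split /=; apply: eq_bigr => j _.
  by rewrite ffunE [X in _ + _ * X]ffunE [in RHS]ffunE f1E /GRing.scale /=; ring.
have act h : h \in unitmx -> inV2 (GL_act h (vplus C k n)).
  by move=> hh; exists 1%N, (fun _ => 1), (fun _ => h); rewrite big_ord1 scale1r.
apply: inV2_sum => j _; apply: inV2Z; rewrite f1_GL_act; apply: inV2Z; apply: inV2D.
  by apply/act/shear_unit.
by apply/inV2Z/act/shear_unit.
Qed.

(** Elements of [inV2_dual] are linear on V(2 omega_k) only, so the specialized vectors must be
    known to lie there. *)
Lemma inV2_eval_1 s : inV2 (eval_1 C k s : Ext2 C k n).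
Proof.
apply: inV2_sum => -[[p m] w] _ /=; apply: inV2Z.
elim: w => [|[i a] w IHw] /=; first exact: inV2_vplus.
by apply: inV2Z; elim: a => //= a; apply: inV2_f1.
Qed.

Lemma dual_sum (phi : Ext2 C k n -> C) (I : Type) (r : seq I) (P : pred I)
    (c : I -> C) (f : I -> Ext2 C k n) :
  inV2_dual phi -> (forall j, P j -> inV2 (f j)) ->
  phi (\sum_(j <- r | P j) c j *: f j) = \sum_(j <- r | P j) c j * phi (f j).
Proof.
move=> hphi hf; elim: r => [|j r IHr].
  rewrite !big_nil; have := hphi 1 0 0 inV2_0 inV2_0.
  by rewrite scaler0 addr0 mul1r -{1}[phi 0]addr0 => /addrI.
rewrite !big_cons; case Pj: (P j) => //.
by rewrite hphi ?IHr //; [apply: hf | apply: inV2_sum => l Pl; apply/inV2Z/hf].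
Qed.

End Classical.

(** At q = 1 strands have weight 1, and by [compatibleE] the right side is the sum of e_I (x) e_J
    over the pairs compatible with P. *)
Lemma global_basis_specialization (C : numFieldType) (k n : nat) (hkn : (k <= n)%N)
  (V : vectType Qq) (M : Uq_module n V) (v : V)
  (hM : Uq_irreducible M) (hv : highest_weight_vector k M v)
  (G : tableau k n -> V) (hG : global_basis hkn M v G)
  (g : tableau k n -> Ext2 C k n)
  (hg : forall S, ssyt S -> specializes M v (G S) (g S)) P :
  P \in pairings k n -> g (theta hkn P) = restr k (bvec 1 (matching_of P)).
Proof.
move=> hP; have hS := theta_ssyt hkn hP.
have [_ _ [psi hpsi psiG] hw] := hG _ hS.
have [w [fw kw _]] := crystal_path hkn hM hv hS.
have [b kb Gb] := hw w fw; have [y gy cy] := kw b kb.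
have [s Gs ->] := hg _ hS.
rewrite eval_1_restr; congr (restr _ _).
apply: (global_specialization hM hv (matching_of_valid hP) Gs hpsi psiG gy _ Gb).
  by rewrite -(cols_theta hkn hP).
exact: qfactorials_fact.
Qed.

(* V, M, v : V_q(2 omega_k) with its highest weight vector;
   G : its global basis; g : the specialization of G at q = 1;
   H : the basis dual to g; Delta : the Temperley-Lieb immanants. *)
Theorem proposition3p2 (R : realType) (k n : nat) (hk : (1 <= k)%N)
  (hkn : (k <= n)%N)
  (V : vectType Qq) (M : Uq_module n V) (v : V)
  (hM : Uq_irreducible M) (hv : highest_weight_vector k M v)
  (G : tableau k n -> V) (hG : global_basis hkn M v G)
  (g : tableau k n -> Ext2 R[i] k n)
  (hg : forall S, ssyt S -> specializes M v (G S) (g S))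
  (H : tableau k n -> Ext2 R[i] k n -> R[i]) (hH : dual_basis g H)
  (Delta : pairing n -> Ext R[i] k n -> R[i]) (hDelta : TL_immanants Delta) :
  (forall P, P \in pairings k n ->
     eqR (Delta P) (fun X => H (theta hkn P) (tensor_square X))) /\
  (forall f : Ext R[i] k n -> R[i],
     (exists2 P, P \in pairings k n & eqR f (Delta P)) <->
     (exists2 S, ssyt S & eqR f (fun X => H S (tensor_square X)))).
Proof.
have gE P : P \in pairings k n -> g (theta hkn P) = restr k (bvec 1 (matching_of P)).
  exact: (global_basis_specialization hM hv hG hg).
have main P : P \in pairings k n ->
    eqR (Delta P) (fun X => H (theta hkn P) (tensor_square X)).
  move=> hP X dX; have [hlin hdual] := hH _ (theta_ssyt hkn hP).
  have XE : tensor_square X = \sum_(P' in pairings k n) Delta P' X *: g (theta hkn P').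
    apply/ffunP => -[I J]; rewrite ffunE sum_ffunE /=.
    have [_ hD] := hDelta; rewrite (hD I J X dX) big_mkcondr.
    apply: eq_bigr => P' hP'; rewrite ffunE gE // !ffunE /= (compatibleE hP') /GRing.scale /=.
    by case: ifP => _; rewrite ?mulr1 ?mulr0.
  rewrite XE dual_sum //; last first.
    by move=> P' hP'; have [s _ ->] := hg _ (theta_ssyt hkn hP'); apply: inV2_eval_1.
  rewrite (bigD1 P) //= hdual ?theta_ssyt // eqxx mulr1 big1 ?addr0 // => P' /andP[hP' neP].
  rewrite hdual ?theta_ssyt //; case: eqP => [e|_]; last by rewrite mulr0.
  by rewrite (theta_inj hP hP' e) eqxx in neP.
split=> // f; split=> [[P hP fP]|[S hS fS]].
  exists (theta hkn P); first exact: theta_ssyt.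
  by move=> X dX; rewrite fP // main.
(* The matching found along the crystal path to S provides the pairing with tableau S. *)
have [w [_ _ [Q vQ lQ]]] := crystal_path hkn hM hv hS.
have [P hP eP] := theta_onto hkn hS vQ lQ.
by exists P => // X dX; rewrite fS // main // eP.
Qed.
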